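(* With the notation of the context, the following hold. (1) The set $\{[\alpha|\beta]_{Z_\gamma^\top Z_\gamma}\mid(\alpha,\beta)\in D_\gamma\}$ is a sagbi basis of $K[W^\top W,U_\gamma]\cap K[Z_\gamma]$. In particular, $K[Z_\gamma]^{\mathrm{O}(m,-)}=K[W^\top W,U_\gamma]\cap K[Z_\gamma]=K[Z_\gamma^\top Z_\gamma]$. (2) The set $\{[\alpha|\beta]_{Z_\gamma^\top Z_\gamma}\mid(\alpha,\beta)\in D_\gamma\}\cup\{\delta_{Z_\gamma}\mid\delta\in\Gamma(m\times n;\gamma)\}$ is a sagbi basis of $K[W^\top W,\det W,U_\gamma]\cap K[Z_\gamma]$. In particular, $K[Z_\gamma]^{\mathrm{SO}(m,-)}=K[W^\top W,\det W,U_\gamma]\cap K[Z_\gamma]=K[Z_\gamma^\top Z_\gamma,\Gamma(Z_\gamma)]$.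
   Context: $K$ is a field, $m,n$ are integers with $0<m\le n$, and $\gamma=[b_1,\ldots,b_m]$ is fixed with $1\le b_1<\cdots<b_m\le n$. Posets: $\Gamma'(a\times b)=\{[c_1,\ldots,c_r]\mid 1\le r\le a,\ 1\le c_1<\cdots<c_r\le b\}$ (for $a\le b$), ordered by $[c_1,\ldots,c_r]\le[d_1,\ldots,d_s]$ iff $r\ge s$ and $c_i\le d_i$ for $i=1,\ldots,s$; the size of $[c_1,\ldots,c_r]$ is $r$. $\Gamma(m\times n)$ is the subset of $\Gamma'(m\times n)$ of elements of size $m$, and $\Gamma(m\times n;\gamma)=\{\delta\in\Gamma(m\times n)\mid\delta\ge\gamma\}$. $D_\gamma=\{(\alpha,\beta)\mid\alpha,\beta\in\Gamma'(n\times n),\ \alpha\le\beta,\ \mathrm{size}\,\alpha=\mathrm{size}\,\beta,\ \alpha\ge\gamma\}$. Matrices: $W=(W_{ij})$ is an $m\times m$ matrix of indeterminates, and $U_\gamma$ is the $m\times n$ matrix whose $(i,j)$ entry is an indeterminate $U_{ij}$ if $j\ge b_i$ and $0$ if $j<b_i$; all the $W_{ij}$ and $U_{ij}$ are independent. $K[W,U_\gamma]$ is the polynomial ring in all of them. Put $Z_\gamma=WU_\gamma$. For a matrix $M$ over a $K$-algebra, $K[M]$ is the $K$-subalgebra generated by its entries (similarly with several matrices or elements in the brackets), $M^\top$ is the transpose, $\Gamma(M)$ is the set of maximal minors ($m$-minors) of an $m\times n$ matrix $M$, $[c_1,\ldots,c_r|d_1,\ldots,d_r]_M$ is the minor of $M$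 with rows $c_1,\ldots,c_r$ and columns $d_1,\ldots,d_r$, and for $\delta=[c_1,\ldots,c_m]$, $\delta_M$ is the maximal minor of $M$ with columns $c_1,\ldots,c_m$. Monomial order: $K[W,U_\gamma]$ carries a fixed monomial order which is diagonal (the leading monomial of any nonzero minor of $W$ or $U_\gamma$ is the product of its main diagonal entries) and satisfies $W_{ij}>W_{i'j}$, $W_{ij}>W_{ij'}$, $U_{ij}>U_{i'j}$, $U_{ij}>U_{ij'}$ for all possible $i<i'$, $j<j'$. A subset $S$ of a subalgebra $A$ of $K[W,U_\gamma]$ is a sagbi basis of $A$ if the leading monomials of the elements of $S$ generate, as a $K$-algebra, the initial algebra of $A$ (the algebra spanned by the leading monomials of nonzero elements of $A$). Invariants: for a commutative ring $R$, $\mathrm{O}(m,R)=\{g\in\mathrm{GL}(m,R)\mid g^\top g=E_m\}$ and $\mathrm{SO}(m,R)=\{g\in\mathrm{O}(m,R)\mid\det g=1\}$. For a commutative $K$-algebra $B$ and $g\in\mathrm{GL}(m,B)$, $f\mapsto f^g$ denotes the $B$-automorphism of $B[Z_\gamma]$ sending $Z_\gamma$ to $gZ_\gamma$ (it is the restriction of the $B$-automorphism of $B[W,U_\gamma]$ sending $W$ to $gW$ and fixing $U_\gamma$). $K[Z_\gamma]^{\mathrm{O}(m,-)}$ (resp. $K[Z_\gamma]^{\mathrm{SO}(m,-)}$) is the ring of absolute invariants: those $f\in K[Z_\gamma]$ such that for every commutative $K$-algebra $B$ (nilpotents allowed), the image of $f$ in $B[Z_\gamma]$ satisfies $f^g=f$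 for all $g\in\mathrm{O}(m,B)$ (resp. $g\in\mathrm{SO}(m,B)$). *)

(* Defs.v *)
From HB Require Import structures.
From mathcomp Require Import all_boot all_order all_algebra.
From mathcomp Require Import boolp classical_sets.
From mathcomp Require Import mpoly.

Set Implicit Arguments.
Unset Strict Implicit.
Unset Printing Implicit Defensive.

Import GRing.Theory.
Local Open Scope classical_set_scope.
Local Open Scope ring_scope.

(* All indices are 0-based: the index c in {1, ..., b} is represented by the
   element c - 1 of 'I_b.  A bracket [c_1, ..., c_r] is an r-tuple. *)

Section Posets.

Definition increasing (b r : nat) (c : r.-tuple 'I_b) : bool :=
  sorted ltn (map val c).

Definition Gamma' (a b r : nat) (c : r.-tuple 'I_b) : bool :=
  (0 < r <= a)%N && increasing c.

Definition Gamma (m n : nat) (c : m.-tuple 'I_n) : bool := Gamma' m c.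

(* The default value 0 of nth is never used, since i < s <= r. *)
Definition leGamma (b r s : nat) (c : r.-tuple 'I_b) (d : s.-tuple 'I_b) : bool :=
  (s <= r)%N &&
  [forall i : 'I_s, (nth 0 (map val c) i <= nth 0 (map val d) i)%N].

Definition GammaGe (m n : nat) (gamma delta : m.-tuple 'I_n) : bool :=
  Gamma delta && leGamma gamma delta.

(* The condition size alpha = size beta is expressed by the common length r. *)
Definition Dset (m n : nat) (gamma : m.-tuple 'I_n)
    (r : nat) (alpha beta : r.-tuple 'I_n) : bool :=
  [&& Gamma' n alpha, Gamma' n beta, leGamma alpha beta & leGamma gamma alpha].

End Posets.

Section MatricesAndSubalgebras.

Definition minor (A : comNzRingType) (p q r : nat)
    (c : r.-tuple 'I_p) (d : r.-tuple 'I_q) (M : 'M[A]_(p, q)) : A :=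
  \det (mxsub (tnth c) (tnth d) M).

Definition maxminor (A : comNzRingType) (m n : nat)
    (d : m.-tuple 'I_n) (M : 'M[A]_(m, n)) : A :=
  minor (ord_tuple m) d M.

Definition entries (A : Type) (p q : nat) (M : 'M[A]_(p, q)) : set A :=
  [set f | exists i j, f = M i j].

Definition maxminors (A : comNzRingType) (m n : nat) (M : 'M[A]_(m, n)) : set A :=
  [set f | exists d : m.-tuple 'I_n, Gamma d /\ f = maxminor d M].

Inductive subalg (K : fieldType) (A : algType K) (S : set A) : set A :=
| subalg_gen f of S f : subalg S f
| subalg_one : subalg S 1
| subalg_add f g of subalg S f & subalg S g : subalg S (f + g)
| subalg_mul f g of subalg S f & subalg S g : subalg S (f * g)
| subalg_scale (a : K) f of subalg S f : subalg S (a *: f).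

Inductive lspan (K : fieldType) (V : lmodType K) (S : set V) : set V :=
| lspan_gen v of S v : lspan S v
| lspan_zero : lspan S 0
| lspan_add u v of lspan S u & lspan S v : lspan S (u + v)
| lspan_scale (a : K) v of lspan S v : lspan S (a *: v).

End MatricesAndSubalgebras.

Section Sagbi.
Variables (N : nat) (le : rel 'X_{1..N}).

Definition monomial_order : Prop :=
  [/\ total le, antisymmetric le, transitive le,
      forall x, le 0%MM x
    & forall x y z, le x y -> le (x + z)%MM (y + z)%MM].

Definition is_lead (R : nzRingType) (p : {mpoly R[N]}) (mu : 'X_{1..N}) : Prop :=
  mu \in msupp p /\ {in msupp p, forall nu, le nu mu}.

(* Zero has empty support, so it contributes nothing. *)
Definition lead_monomials (K : fieldType) (S : set {mpoly K[N]}) : set {mpoly K[N]} :=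
  [set p | exists f mu, [/\ S f, is_lead f mu & p = 'X_[mu]]].

Definition initial_algebra (K : fieldType) (A : set {mpoly K[N]}) : set {mpoly K[N]} :=
  lspan (lead_monomials A).

Definition sagbi_basis (K : fieldType) (S A : set {mpoly K[N]}) : Prop :=
  S `<=` A /\ subalg (lead_monomials S) = initial_algebra A.

End Sagbi.

Section Generic.
Variables (m n : nat) (gamma : m.-tuple 'I_n).

(* U_ij is an indeterminate exactly when b_i <= j. *)
Definition Uidx : finType :=
  {p : 'I_m * 'I_n | (tnth gamma p.1 <= p.2)%N}.

(* inl (i, j) stands for W_ij and inr (i, j) for U_ij. *)
Definition vars : finType := ('I_m * 'I_m + Uidx)%type.

Definition varmon (v : vars) : 'X_{1..#|vars|} := U_(enum_rank v)%MM.

Section OverRing.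
Variable R : comNzRingType.

Definition var (v : vars) : {mpoly R[#|vars|]} := 'X_(enum_rank v).

Definition Wmx : 'M[{mpoly R[#|vars|]}]_m := \matrix_(i, j) var (inl (i, j)).

Definition Umx : 'M[{mpoly R[#|vars|]}]_(m, n) :=
  \matrix_(i, j) oapp (fun u : Uidx => var (inr u)) 0 (insub (i, j)).

Definition Zmx : 'M[{mpoly R[#|vars|]}]_(m, n) := Wmx *m Umx.

(* The endomorphism of R[W, U] sending W to g W and fixing R and U. *)
Definition act (g : 'M[R]_m) (f : {mpoly R[#|vars|]}) : {mpoly R[#|vars|]} :=
  f \mPo [tuple match enum_val k with
                | inl p => (map_mx (@mpolyC #|vars| R) g *m Wmx) p.1 p.2
                | inr u => var (inr u)
                end | k < #|vars|].

End OverRing.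

(* GL is stated with a two-sided inverse: R need not be a comUnitRingType. *)
Definition GL (R : comNzRingType) : set 'M[R]_m :=
  [set g | exists h, g *m h = 1%:M /\ h *m g = 1%:M].

Definition Orth (R : comNzRingType) : set 'M[R]_m :=
  [set g | @GL R g /\ g^T *m g = 1%:M].

Definition SOrth (R : comNzRingType) : set 'M[R]_m :=
  [set g | @Orth R g /\ \det g = 1].

Variable K : fieldType.

Definition ext_scalars (B : comAlgType K) (f : {mpoly K[#|vars|]}) :
  {mpoly B[#|vars|]} := map_mpoly (GRing.in_alg B) f.

Definition abs_invariants (G : forall B : comNzRingType, set 'M[B]_m) :
    set {mpoly K[#|vars|]} :=
  [set f | subalg (entries (Zmx K)) f /\
     forall (B : comAlgType K) (g : 'M[B]_m), G B g ->
       act g (ext_scalars B f) = ext_scalars B f].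

Variable le : rel 'X_{1..#|vars|}.

(* For r = 0 the minor is 1 and the condition holds for any monomial order. *)
Definition diagonal_for (p q : nat) (M : 'M[{mpoly K[#|vars|]}]_(p, q)) : Prop :=
  forall (r : nat) (c : r.-tuple 'I_p) (d : r.-tuple 'I_q),
    increasing c -> increasing d -> minor c d M != 0 ->
    exists2 mu, is_lead le (minor c d M) mu
              & 'X_[mu] = \prod_(i < r) M (tnth c i) (tnth d i).

Definition var_gt (u v : vars) : Prop :=
  le (varmon v) (varmon u) /\ varmon v <> varmon u.

Definition W_compatible : Prop :=
  (forall i i' j : 'I_m, (i < i')%N -> var_gt (inl (i, j)) (inl (i', j))) /\
  (forall i j j' : 'I_m, (j < j')%N -> var_gt (inl (i, j)) (inl (i, j'))).

Definition U_compatible : Prop :=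
  (forall u v : Uidx, (val u).2 = (val v).2 -> ((val u).1 < (val v).1)%N ->
     var_gt (inr u) (inr v)) /\
  (forall u v : Uidx, (val u).1 = (val v).1 -> ((val u).2 < (val v).2)%N ->
     var_gt (inr u) (inr v)).

Definition admissible_order : Prop :=
  [/\ monomial_order le, diagonal_for (Wmx K), diagonal_for (Umx K),
      W_compatible & U_compatible].

Definition gram_minors : set {mpoly K[#|vars|]} :=
  [set f | exists (r : nat) (alpha beta : r.-tuple 'I_n),
     Dset gamma alpha beta /\ f = minor alpha beta ((Zmx K)^T *m Zmx K)].

Definition maxminors_ge : set {mpoly K[#|vars|]} :=
  [set f | exists delta : m.-tuple 'I_n,
     GammaGe gamma delta /\ f = maxminor delta (Zmx K)].

End Generic.

Arguments abs_invariants {m n} gamma K G.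
Arguments gram_minors {m n} gamma K.
Arguments maxminors_ge {m n} gamma K.
Arguments Wmx {m n} gamma R.
Arguments Umx {m n} gamma R.
Arguments Zmx {m n} gamma R.
Arguments admissible_order {m n} gamma K le.
Arguments Orth m R : clear implicits.
Arguments SOrth m R : clear implicits.

(* Main.v *)
Require Import Defs.
From HB Require Import structures.
From mathcomp Require Import all_boot all_order all_algebra.
From mathcomp Require Import fingroup perm fieldext.
From mathcomp Require Import boolp classical_sets.
From mathcomp Require Import mpoly.
From mathcomp Require Import zify ring.
Set Implicit Arguments.
Unset Strict Implicit.
Unset Printing Implicit Defensive.
Import GRing.Theory.
Local Open Scope classical_set_scope.
Local Open Scope ring_scope.

(** No straightening law is used.  If [f] is a nonzero invariant in [K[Z]], its
    support contains a monomial [prod_i W_ii^(k_i)] times a [U]-monomial whose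
    row contents form a semistandard tableau of shape [k], with all [k_i] even
    (for [O]) or of equal parity (for [SO]).  Since such monomials are exactly
    the products of leading monomials of the proposed generators, subduction
    expresses [f] in them and identifies its leading monomial; the intersections
    [K[W^T W, U] & K[Z]] and [K[W^T W, det W, U] & K[Z]] are squeezed between
    the generated algebra and the invariants.

    To find the monomial: over an extension of [K(W, U)] containing square roots
    of the pivots of [W^T W], one has [g W = D h] with [g] orthogonal, [D]
    diagonal and [h] upper unitriangular.  As [f] depends only on [W U], this
    gives [f(W, U) = f(D, h U)], so the part of [f] of least [U]-weight (row
    indices as weights) has a monomial with diagonal [W]-part, of exponents [k].
    Parity comes from [diag(e, 1, ..., 1)] over [K[e]/(e^2 - 1)].  Let [p] be
    the part of [f] of [W]-row degrees [k].  Minimality of the weight makes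
    [p(h, U)] constant for lower unitriangular [h]; substituting
    [U_i + s z, U_(i+1) - s z] and comparing degrees in [s] yields Garnir-type
    relations which show that a monomial of [p(1, U)] maximizing the sum of
    [row * column] over its entries is semistandard. *)

(** * Weights and top forms *)

(** Pivots of a Gram matrix can vanish, so the factorization needs a reason: at [W = 1] the Gram
    matrix is the identity, hence the pivots of the generic one are units in the local ring of that
    point, in every characteristic. The degree comparison is a count. For rows [i], [i + 1] and a
    column [c0], the substitution attaches [s] to every entry of row [i] in columns at least [c0]
    and of row [i + 1] in columns at most [c0]. Their number exceeds the length [k_i] of row [i]
    exactly when semistandardness fails at [c0]. On the other hand, adding row [i] to row [i + 1]
    cancels [s] from the latter and does not change the value of [p], after which [s] occurs at most
    [k_i] times. The obstacle is cancellation, since several monomials of [p] may yield the same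
    monomial after the substitution. Column contents of the two rows are preserved, and entries
    change rows in only one direction on each side of [c0]. This is why the sum of row times column
    is maximized: for fixed contents it is governed by the first moment of row [i]. *)

Section Weights.
Variable N : nat.
Implicit Types (w : 'I_N -> nat) (mu nu : 'X_{1..N}).

Definition wt w mu : nat := (\sum_i mu i * w i)%N.

Lemma wt0 w : wt w 0%MM = 0%N.
Proof. by rewrite /wt big1 // => i _; rewrite mnm0E. Qed.

Lemma wtD w mu nu : wt w (mu + nu)%MM = (wt w mu + wt w nu)%N.
Proof. by rewrite -big_split; apply: eq_bigr => i _; rewrite mnmDE mulnDl. Qed.

Lemma wtU w i : wt w U_(i)%MM = w i.
Proof.
rewrite /wt (bigD1 i) //= mnm1E eqxx mul1n big1 ?addn0 // => j ji.
by rewrite mnm1E eq_sym (negbTE ji).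
Qed.

Lemma wtMn w mu k : wt w (mu *+ k)%MM = (k * wt w mu)%N.
Proof.
by rewrite /wt big_distrr; apply: eq_bigr => i _; rewrite mulmnE mulnAC mulnC.
Qed.

Lemma wt_sum w (I : Type) (r : seq I) (P : pred I) (F : I -> 'X_{1..N}) :
  wt w (\sum_(i <- r | P i) F i)%MM = (\sum_(i <- r | P i) wt w (F i))%N.
Proof. by apply: (big_morph (wt w)) => [mu nu|]; rewrite ?wtD ?wt0. Qed.

Lemma mdeg_wt mu : mdeg mu = wt (fun _ => 1%N) mu.
Proof. by rewrite mdegE /wt; apply: eq_bigr => i _; rewrite muln1. Qed.

Lemma eq_wt w1 w2 mu : w1 =1 w2 -> wt w1 mu = wt w2 mu.
Proof. by move=> e; apply: eq_bigr => i _; rewrite e. Qed.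

Lemma wt_addw w1 w2 mu :
  wt (fun i => (w1 i + w2 i)%N) mu = (wt w1 mu + wt w2 mu)%N.
Proof. by rewrite -big_split; apply: eq_bigr => i _; rewrite mulnDr. Qed.

End Weights.

(** One set of closure lemmas then serves both degree bounds ([leq]) and homogeneity (equality). *)
Definition addrel (r : rel nat) : Prop :=
  r 0%N 0%N /\ forall a b c d, r a b -> r c d -> r (a + c)%N (b + d)%N.

Lemma addrel_leq : addrel leq.
Proof. by split=> // a b c d; apply: leq_add. Qed.

Lemma addrel_eq : addrel (fun a b => a == b).
Proof. by split=> // a b c d /eqP-> /eqP->. Qed.

Section WeightedSupport.
Variables (N : nat) (R : comNzRingType) (r : rel nat) (w : 'I_N -> nat).
Hypothesis radd : addrel r.
Implicit Types p q : {mpoly R[N]}.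

Definition wsupp (d : nat) p : Prop := {in msupp p, forall mu, r (wt w mu) d}.

Lemma wsuppD d p q : wsupp d p -> wsupp d q -> wsupp d (p + q).
Proof. by move=> hp hq mu /msuppD_le; rewrite mem_cat => /orP[/hp|/hq]. Qed.

Lemma wsuppN d p : wsupp d p -> wsupp d (- p).
Proof. by move=> hp mu; rewrite (perm_mem (msuppN p)) => /hp. Qed.

Lemma wsupp0 d : wsupp d 0.
Proof. by move=> mu; rewrite msupp0. Qed.

Lemma wsuppZ d c p : wsupp d p -> wsupp d (c *: p).
Proof. by move=> hp mu /msuppZ_le /hp. Qed.

Lemma wsupp_sum d (I : Type) (s : seq I) (P : pred I) (F : I -> {mpoly R[N]}) :
  (forall i, P i -> wsupp d (F i)) -> wsupp d (\sum_(i <- s | P i) F i).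
Proof.
by move=> h; apply: big_ind => //; [exact: wsupp0 | move=> ? ?; apply: wsuppD].
Qed.

Lemma wsuppM d e p q : wsupp d p -> wsupp e q -> wsupp (d + e)%N (p * q).
Proof.
move=> hp hq mu /msuppM_le/allpairsP[[a b]] /= [/hp ha /hq hb ->].
by rewrite wtD; apply: (proj2 radd).
Qed.

Lemma wsuppX mu d : r (wt w mu) d -> wsupp d 'X_[mu].
Proof. by move=> h nu /mem_msuppXP <-. Qed.

Lemma wsupp1 : wsupp 0 1.
Proof. by rewrite -mpolyX0; apply: wsuppX; rewrite wt0; case: radd. Qed.

Lemma wsuppC c : wsupp 0 c%:MP.
Proof. by rewrite -[c%:MP]mulr1 mul_mpolyC; apply/wsuppZ/wsupp1. Qed.

Lemma wsupp_prod (I : Type) (s : seq I) (P : pred I) (d : I -> nat)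
    (F : I -> {mpoly R[N]}) :
  (forall i, P i -> wsupp (d i) (F i)) ->
  wsupp (\sum_(i <- s | P i) d i)%N (\prod_(i <- s | P i) F i).
Proof.
move=> h; apply: (big_ind2 (fun e p => wsupp e p)) => //; first exact: wsupp1.
by move=> a p b q; apply: wsuppM.
Qed.

Lemma wsuppXn d p k : wsupp d p -> wsupp (k * d)%N (p ^+ k).
Proof.
move=> hp; elim: k => [|k IHk]; first by rewrite expr0; apply: wsupp1.
by rewrite exprS mulSn; apply: wsuppM.
Qed.

Lemma wsupp_mmap1 N' (h : 'I_N' -> {mpoly R[N]}) (d : 'I_N' -> nat)
    (mu : 'X_{1..N'}) :
  (forall i, mu i != 0%N -> wsupp (d i) (h i)) -> wsupp (wt d mu) (mmap1 h mu).
Proof.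
move=> hh; apply: wsupp_prod => i _.
have [->|mi] := eqVneq (mu i) 0%N; first by rewrite expr0 mul0n; apply: wsupp1.
exact/wsuppXn/hh.
Qed.

Lemma wsupp_det k d (M : 'M[{mpoly R[N]}]_k) :
  (forall i j, wsupp d (M i j)) -> wsupp (k * d)%N (\det M).
Proof.
move=> hM; apply: wsupp_sum => s _.
rewrite mulr_sign; case: ifP => _.
  by apply: wsuppN; rewrite -{1}[k]card_ord -sum_nat_const; apply: wsupp_prod.
by rewrite -{1}[k]card_ord -sum_nat_const; apply: wsupp_prod.
Qed.

End WeightedSupport.

Section TopForms.
Variables (N : nat) (R : comNzRingType) (lt : rel 'X_{1..N}).

(** Totality is not asked for, so that comparison by a weight, which does not separate monomials of
    equal weight, is an instance next to strict monomial orders. *)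
Definition additive_lt : Prop :=
  [/\ irreflexive lt, transitive lt
    & forall a b c, lt a b -> lt (a + c)%MM (b + c)%MM].

Hypothesis ltP : additive_lt.
Implicit Types (p q : {mpoly R[N]}) (tau : 'X_{1..N}).

Definition below tau p : Prop := {in msupp p, forall nu, lt nu tau}.

(** Carrying [c] instead of requiring a nonzero coefficient makes products unconditional, even when
    [R] has zero divisors. *)
Definition topform tau (c : R) p : Prop := below tau (p - c *: 'X_[tau]).

Lemma belowD tau p q : below tau p -> below tau q -> below tau (p + q).
Proof. by move=> hp hq mu /msuppD_le; rewrite mem_cat => /orP[/hp|/hq]. Qed.

Lemma below0 tau : below tau 0.
Proof. by move=> mu; rewrite msupp0. Qed.

Lemma belowZ tau c p : below tau p -> below tau (c *: p).
Proof. by move=> hp mu /msuppZ_le /hp. Qed.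

Lemma below_sum tau (I : Type) (s : seq I) (P : pred I)
    (F : I -> {mpoly R[N]}) :
  (forall i, P i -> below tau (F i)) -> below tau (\sum_(i <- s | P i) F i).
Proof.
by move=> h; apply: big_ind => //; [exact: below0 | move=> ? ?; apply: belowD].
Qed.

Lemma belowMX tau tau' p : below tau p -> below (tau + tau') (p * 'X_[tau']).
Proof.
case: ltP => _ _ ladd hp mu /msuppM_le/allpairsP[[a b]] /= [/hp ha].
by move=> /mem_msuppXP <- ->; apply: ladd.
Qed.

Lemma belowM tau tau' p q :
  below tau p -> below tau' q -> below (tau + tau') (p * q).
Proof.
case: ltP => _ tr ladd hp hq mu /msuppM_le/allpairsP[[a b]] /= [/hp ha /hq hb ->].
apply: tr (ladd _ _ b ha) _; rewrite addmC [(tau + tau')%MM]addmC; exact: ladd.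
Qed.

Lemma topform_coef tau c p : topform tau c p -> p@_tau = c.
Proof.
case: ltP => irr _ _ h; apply/eqP; rewrite -subr_eq0; apply/negPn/negP => h1.
suff /h : tau \in msupp (p - c *: 'X_[tau]) by rewrite irr.
by rewrite mcoeff_msupp mcoeffB mcoeffZ mcoeffX eqxx mulr1.
Qed.

Lemma topform_supp tau c p :
  topform tau c p -> {in msupp p, forall nu, nu = tau \/ lt nu tau}.
Proof.
move=> h nu; have [->|ne] := eqVneq nu tau; first by left.
move=> hnu; right; apply: h.
rewrite mcoeff_msupp mcoeffB mcoeffZ mcoeffX [tau == nu]eq_sym (negbTE ne) mulr0 subr0.
by rewrite -mcoeff_msupp.
Qed.

Lemma topformX tau : topform tau 1 'X_[tau].
Proof. by rewrite /topform scale1r subrr; apply: below0. Qed.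

Lemma topform1 : topform 0%MM 1 1.
Proof. by rewrite -mpolyX0; apply: topformX. Qed.

Lemma topformZ a tau c p : topform tau c p -> topform tau (a * c) (a *: p).
Proof. by rewrite /topform -scalerA -scalerBr => /belowZ. Qed.

Lemma topformDl tau c p q : topform tau c p -> below tau q ->
  topform tau c (p + q).
Proof. by rewrite /topform addrAC => hp hq; apply: belowD. Qed.

Lemma topformM tau tau' c c' p q : topform tau c p -> topform tau' c' q ->
  topform (tau + tau') (c * c') (p * q).
Proof.
rewrite /topform => hp hq.
set a := c *: 'X_[tau] in hp; set b := c' *: 'X_[tau'] in hq.
have -> : p * q - (c * c') *: 'X_[tau + tau'] =
  (p - a) * (q - b) + (c' *: ((p - a) * 'X_[tau']) + c *: ((q - b) * 'X_[tau])).
  have -> : (c * c') *: 'X_[tau + tau'] = a * b.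
    by rewrite mpolyXD /a /b -scalerAl -scalerAr scalerA.
  have -> : c' *: ((p - a) * 'X_[tau']) = (p - a) * b by rewrite -scalerAr.
  have -> : c *: ((q - b) * 'X_[tau]) = (q - b) * a by rewrite -scalerAr.
  ring.
apply: belowD; first exact: belowM.
apply: belowD; apply: belowZ; first exact: belowMX.
by rewrite addmC; apply: belowMX.
Qed.

Lemma topform_prod (I : Type) (s : seq I) (P : pred I)
    (t : I -> 'X_{1..N}) (c : I -> R) (F : I -> {mpoly R[N]}) :
  (forall i, P i -> topform (t i) (c i) (F i)) ->
  topform (\sum_(i <- s | P i) t i)%MM (\prod_(i <- s | P i) c i)
          (\prod_(i <- s | P i) F i).
Proof.
move=> h.
elim: s => [|i s IHs]; first by rewrite !big_nil; apply: topform1.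
by rewrite !big_cons; case: ifP => // Pi; apply: topformM => //; apply: h.
Qed.

Lemma topform_exp tau c p k :
  topform tau c p -> topform (tau *+ k) (c ^+ k) (p ^+ k).
Proof.
move=> h; elim: k => [|k IHk]; first by rewrite !expr0 mulm0n; apply: topform1.
by rewrite !exprS mulmS; apply: topformM.
Qed.

Lemma topform_mmap1 N' (h : 'I_N' -> {mpoly R[N]}) (t : 'I_N' -> 'X_{1..N})
    (c : 'I_N' -> R) (mu : 'X_{1..N'}) :
  (forall i, mu i != 0%N -> topform (t i) (c i) (h i)) ->
  topform (\sum_i t i *+ mu i)%MM (\prod_i c i ^+ mu i) (mmap1 h mu).
Proof.
move=> hh; apply: topform_prod => i _.
have [->|mi] := eqVneq (mu i) 0%N; last exact/topform_exp/hh.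
by rewrite mulm0n !expr0; apply: topform1.
Qed.

End TopForms.

Lemma additive_lt_wt N (w : 'I_N -> nat) :
  additive_lt (fun mu nu => (wt w mu < wt w nu)%N).
Proof.
split=> [mu|mu nu ka|mu nu ka]; first by rewrite ltnn.
  exact: ltn_trans.
by rewrite !wtD ltn_add2r.
Qed.

Lemma additive_lt_order N (le : rel 'X_{1..N}) : monomial_order le ->
  additive_lt (fun mu nu => le mu nu && (mu != nu)).
Proof.
case=> tot anti tr _ ladd; split=> [mu|b a c|a b c].
- by rewrite eqxx andbF.
- move=> /andP[ab nab] /andP[bc nbc]; rewrite (tr _ _ _ ab bc) /=.
  apply: contra nab => /eqP eac; apply/eqP/anti.
  by rewrite ab eac bc.
- by move=> /andP[ab nab]; rewrite ladd //= eqm_add2r.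
Qed.

(** * Cauchy-Binet formula *)

Section IncreasingTuples.
Variables (b r : nat).
Implicit Types c : r.-tuple 'I_b.

Lemma nth_val_tnth c (i : 'I_r) : nth 0%N (map val c) i = tnth c i :> nat.
Proof. by rewrite (nth_map (tnth c i)) ?size_tuple // -tnth_nth. Qed.

Lemma increasingP c :
  reflect (forall i j : 'I_r, (i < j)%N -> (tnth c i < tnth c j)%N)
          (increasing c).
Proof.
apply: (iffP idP) => [sc i j ij|h].
  rewrite -!nth_val_tnth.
  apply: (sorted_ltn_nth ltn_trans) => //; by rewrite inE size_map size_tuple.
apply/(sortedP 0%N) => i; rewrite size_map size_tuple => hi.
have := h (Ordinal (ltnW hi)) (Ordinal hi) (ltnSn i).
by rewrite -!nth_val_tnth.
Qed.

Lemma increasing_inj c : increasing c -> injective (tnth c).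
Proof.
move/increasingP => h i j e; apply/val_inj.
by case: (ltngtP i j) => // /h; rewrite e ltnn.
Qed.

Lemma increasing_ge c (i : 'I_r) : increasing c -> (i <= tnth c i)%N.
Proof.
move/increasingP => h; case: i => i; elim: i => [//|i IHi] hi.
have hi' : (i < r)%N by apply: ltnW.
exact: leq_ltn_trans (IHi hi') (h (Ordinal hi') (Ordinal hi) _).
Qed.

End IncreasingTuples.

Section CauchyBinet.
Variables (A : comNzRingType) (r m : nat).

Lemma det_mulmx_ffun (M : 'M[A]_(r, m)) (N : 'M[A]_(m, r)) :
  \det (M *m N) =
  \sum_(f : {ffun 'I_r -> 'I_m}) (\prod_i M i (f i)) * \det (rowsub f N).
Proof.
rewrite /determinant.
under eq_bigr => s _.
  under eq_bigr => i _ do rewrite mxE.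
  rewrite bigA_distr_bigA big_distrr.
  over.
rewrite exchange_big; apply: eq_bigr => f _ /=.
rewrite big_distrr; apply: eq_bigr => s _ /=.
rewrite big_split /= mulrCA; congr (_ * (_ * _)).
by apply: eq_bigr => i _; rewrite mxE.
Qed.

Lemma det_rowsub_ninj (f : 'I_r -> 'I_m) (N : 'M[A]_(m, r)) :
  ~~ injectiveb f -> \det (rowsub f N) = 0.
Proof.
case/injectivePn => i [j ij e].
by apply: (determinant_alternate ij) => k; rewrite !mxE e.
Qed.

Let cmp : rel 'I_m := fun a b => (a <= b)%N.
Let srt (f : {ffun 'I_r -> 'I_m}) : r.-tuple 'I_m :=
  [tuple of sort cmp [tuple f i | i < r]].

Let srt_perm (f : {ffun 'I_r -> 'I_m}) (c : r.-tuple 'I_m) : srt f = c ->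
  exists s : 'S_r, f = [ffun i => tnth c (s i)].
Proof.
move=> e.
have : perm_eq [tuple f i | i < r] c.
  by rewrite -e /= perm_sym perm_sort.
case/tuple_permP => s es; exists s; apply/ffunP => i; rewrite ffunE.
move/val_inj: es => /(congr1 (fun t => tnth t i)).
by rewrite !tnth_mktuple.
Qed.

Let srt_inc (f : {ffun 'I_r -> 'I_m}) : injectiveb f = increasing (srt f).
Proof.
rewrite /increasing ltn_sorted_uniq_leq sorted_map sort_sorted ?andbT.
  rewrite map_inj_uniq; last exact: val_inj.
  rewrite sort_uniq; apply/injectiveP/idP => [fi|].
    by rewrite map_inj_uniq ?enum_uniq.
  move/tuple_uniqP => h i j e; apply: h.
  by rewrite !tnth_mktuple.
by move=> a b; apply: leq_total.
Qed.

Let srt_c (c : r.-tuple 'I_m) (s : 'S_r) : increasing c ->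
  srt [ffun i => tnth c (s i)] = c.
Proof.
move=> ic; apply: val_inj => /=.
have tr : transitive cmp by move=> x y z; apply: leq_trans.
have an : antisymmetric cmp by move=> x y; rewrite -eqn_leq => /eqP/val_inj.
apply: (sorted_eq tr an).
- by apply: sort_sorted => x y; apply: leq_total.
- by move: ic; rewrite /increasing ltn_sorted_uniq_leq sorted_map => /andP[].
rewrite perm_sort; apply/tuple_permP; exists s.
by apply: eq_map => i; rewrite ffunE.
Qed.

(** Noninjective maps contribute zero. The injective ones are grouped by their sorted image [c];
    over [c] they are the rearrangements of [c], and the signs they bring out of the second factor
    turn their sum into the Leibniz expansion of the first. *)
Theorem cauchy_binet (M : 'M[A]_(r, m)) (N : 'M[A]_(m, r)) :
  \det (M *m N) =
  \sum_(c : r.-tuple 'I_m | increasing c)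
     \det (colsub (tnth c) M) * \det (rowsub (tnth c) N).
Proof.
rewrite det_mulmx_ffun (bigID (fun f : {ffun 'I_r -> 'I_m} => injectiveb f)) /=.
rewrite [X in _ + X]big1 ?addr0 => [|f nf]; last first.
  by rewrite det_rowsub_ninj ?mulr0.
rewrite (partition_big srt (fun c => increasing c)) /= => [|f]; last first.
  by rewrite srt_inc.
apply: eq_bigr => c ic.
pose h (s : 'S_r) : {ffun 'I_r -> 'I_m} := [ffun i => tnth c (s i)].
(* [h'] inverts [h] on the fibre over [c]; the default [1] is never reached there. *)
pose h' f : 'S_r := odflt 1%g [pick s | h s == f].
rewrite (reindex_onto h h') /= => [|f /andP[_ /eqP/srt_perm[s e]]]; last first.
  rewrite /h'; case: pickP => [s' /eqP //|/(_ s)].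
  by rewrite -/h e eqxx.
rewrite [X in X * _]/determinant big_distrl /=.
apply: eq_big => [s|s _].
  rewrite srt_inc srt_c // ic eqxx /=; apply/eqP.
  rewrite /h'; case: pickP => [s' /eqP e|/(_ s)]; last by rewrite eqxx.
  apply/permP => i; move/ffunP/(_ i): e; rewrite !ffunE.
  exact: increasing_inj.
have -> : rowsub (h s) N = perm_mx s *m rowsub (tnth c) N.
  by rewrite -row_permE; apply/matrixP => i j; rewrite !mxE ffunE.
rewrite det_mulmx det_perm mulrCA mulrA; congr (_ * _ * _).
by apply: eq_bigr => i _; rewrite mxE ffunE.
Qed.

End CauchyBinet.

Lemma minor_mulmx (A : comNzRingType) (p k q r : nat) (a : r.-tuple 'I_p)
    (b : r.-tuple 'I_q) (M : 'M[A]_(p, k)) (N : 'M[A]_(k, q)) :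
  minor a b (M *m N) =
  \sum_(c : r.-tuple 'I_k | increasing c) minor a c M * minor c b N.
Proof.
rewrite /minor mxsub_mul cauchy_binet; apply: eq_bigr => c _.
by rewrite -mxsubcr -mxsubrc.
Qed.

Lemma minor_tr (A : comNzRingType) (p q r : nat) (a : r.-tuple 'I_p)
    (b : r.-tuple 'I_q) (M : 'M[A]_(p, q)) : minor b a M^T = minor a b M.
Proof. by rewrite /minor -trmx_mxsub det_tr. Qed.

(** * Subduction *)

Section SubalgebraClosure.
Variables (K : fieldType) (A : comAlgType K).
Implicit Types (S T : set A) (f g : A).

(** A predicate on sets, because intersections and rings of invariants come without generators. *)
Record is_subalgebra (T : set A) : Prop := IsSubalgebra {
  subalgebra1 : T 1;
  subalgebraD : forall f g, T f -> T g -> T (f + g);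
  subalgebraM : forall f g, T f -> T g -> T (f * g);
  subalgebraZ : forall (a : K) f, T f -> T (a *: f) }.

Lemma subalg_is_subalgebra S : is_subalgebra (subalg S).
Proof.
by split; [exact: subalg_one | exact: subalg_add | exact: subalg_mul
          | exact: subalg_scale].
Qed.

Lemma is_subalgebraI S T :
  is_subalgebra S -> is_subalgebra T -> is_subalgebra (S `&` T).
Proof.
move=> [S1 SD SM SZ] [T1 TD TM TZ]; split=> //.
- by move=> f g [? ?] [? ?]; split; [apply: SD | apply: TD].
- by move=> f g [? ?] [? ?]; split; [apply: SM | apply: TM].
- by move=> a f [? ?]; split; [apply: SZ | apply: TZ].
Qed.

Lemma subalg_sub S T : is_subalgebra T -> S `<=` T -> subalg S `<=` T.
Proof.
move=> [T1 TD TM TZ] ST f; elim=> {f} [f Sf||f g _ hf _ hg|f g _ hf _ hg|a f _ hf] //.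
- exact: ST.
- exact: TD.
- exact: TM.
- exact: TZ.
Qed.

Lemma subalg_mono S T : S `<=` T -> subalg S `<=` subalg T.
Proof.
move=> ST; apply: subalg_sub; first exact: subalg_is_subalgebra.
by move=> f /ST; apply: subalg_gen.
Qed.

Variable T : set A.
Hypothesis hT : is_subalgebra T.

Lemma subalgebra0 : T 0.
Proof. by rewrite -(scale0r (1 : A)); apply: subalgebraZ => //; apply: subalgebra1. Qed.

Lemma subalgebraB f g : T f -> T g -> T (f - g).
Proof.
move=> hf hg; rewrite -scaleN1r.
by apply: subalgebraD => //; apply: subalgebraZ.
Qed.

Lemma subalgebra_sum (I : Type) (s : seq I) (P : pred I) (F : I -> A) :
  (forall i, P i -> T (F i)) -> T (\sum_(i <- s | P i) F i).
Proof.
move=> h; apply: big_ind => //; first exact: subalgebra0.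
by move=> f g; apply: subalgebraD.
Qed.

Lemma subalgebra_prod (I : Type) (s : seq I) (P : pred I) (F : I -> A) :
  (forall i, P i -> T (F i)) -> T (\prod_(i <- s | P i) F i).
Proof.
move=> h; apply: big_ind => //; first exact: subalgebra1.
by move=> f g; apply: subalgebraM.
Qed.

Lemma subalgebra_det k (M : 'M[A]_k) :
  (forall i j, T (M i j)) -> T (\det M).
Proof.
move=> h; apply: subalgebra_sum => s _; rewrite mulr_sign.
case: ifP => _; last exact: subalgebra_prod.
by rewrite -scaleN1r; apply: subalgebraZ => //; apply: subalgebra_prod.
Qed.

Lemma subalgebra_mulmx k l p (M : 'M[A]_(k, l)) (P : 'M[A]_(l, p)) :
  (forall i j, T (M i j)) -> (forall i j, T (P i j)) ->
  forall i j, T ((M *m P) i j).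
Proof.
move=> hM hP i j; rewrite mxE; apply: subalgebra_sum => u _.
exact: subalgebraM.
Qed.

End SubalgebraClosure.

Section SagbiCriterion.
Variables (N : nat) (le : rel 'X_{1..N}) (K : fieldType).
Hypothesis leP : monomial_order le.

Definition strict : rel 'X_{1..N} := fun mu nu => le mu nu && (mu != nu).
Let sltP : additive_lt strict := additive_lt_order leP.

Let le_refl mu : le mu mu.
Proof. by case: leP => tot _ _ _ _; have := tot mu mu; rewrite orbb. Qed.

Lemma is_leadP (p : {mpoly K[N]}) mu :
  is_lead le p mu <-> exists2 c, c != 0 & topform strict mu c p.
Proof.
split=> [[hmu h]|[c c0 h]].
  exists p@_mu; first by rewrite -mcoeff_msupp.
  move=> nu; rewrite mcoeff_msupp mcoeffB mcoeffZ mcoeffX.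
  have [->|ne] := eqVneq mu nu; first by rewrite mulr1 subrr eqxx.
  rewrite mulr0 subr0 -mcoeff_msupp => hnu.
  by rewrite /strict h // eq_sym.
split; first by rewrite mcoeff_msupp (topform_coef sltP h).
by move=> nu /(topform_supp h)[->//|/andP[]].
Qed.

Variables (S A : set {mpoly K[N]}) (M : set 'X_{1..N}).
Hypotheses (hA : is_subalgebra A) (SA : S `<=` A).

Lemma subalg_lead_sub : subalg (lead_monomials le S) `<=` initial_algebra le A.
Proof.
have lead_mul f g : lead_monomials le A f -> lead_monomials le A g ->
    lead_monomials le A (f * g).
  move=> [p [mu [Ap /is_leadP[c c0 hp] ->]]] [q [nu [Aq /is_leadP[d d0 hq] ->]]].
  exists (p * q), (mu + nu)%MM; split; first exact: subalgebraM.
    apply/is_leadP; exists (c * d); first by rewrite mulf_neq0.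
    exact: topformM.
  by rewrite mpolyXD.
apply: subalg_sub; last first.
  move=> _ [p [mu [Sp hp ->]]]; apply: lspan_gen.
  by exists p, mu; split=> //; apply: SA.
split.
- apply: lspan_gen; exists 1, 0%MM; split; first exact: subalgebra1.
    apply/is_leadP; exists 1; first exact: oner_neq0.
    by rewrite -mpolyX0; apply: topformX.
  by rewrite mpolyX0.
- by move=> f g; apply: lspan_add.
- move=> f g hf; elim=> {g} [g hg||g1 g2 _ h1 _ h2|a g _ hg].
  + elim: hf => {f} [f hf||f1 f2 _ h1 _ h2|a f _ hf].
    * by apply: lspan_gen; apply: lead_mul.
    * by rewrite mul0r; apply: lspan_zero.
    * by rewrite mulrDl; apply: lspan_add.
    * by rewrite -scalerAl; apply: lspan_scale.
  + by rewrite mulr0; apply: lspan_zero.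
  + by rewrite mulrDr; apply: lspan_add.
  + by rewrite -scalerAr; apply: lspan_scale.
- by move=> a f; apply: lspan_scale.
Qed.

(** Unlike in the usual criterion, the monomial in [M] need not be the leading one; that leading
    monomials lie in [M] is a consequence of subduction. *)
Hypothesis support_meets : forall f, A f -> f != 0 ->
  exists2 mu, mu \in msupp f & M mu.
(** The degree bound is a separate demand, since a monomial order need not refine the degree. *)
Hypothesis lead_attained : forall mu, M mu -> exists P c,
  [/\ subalg S P, c != 0, topform strict mu c P,
      {in msupp P, forall nu, (mdeg nu <= mdeg mu)%N}
    & subalg (lead_monomials le S) 'X_[mu]].

Let subSA : subalg S `<=` A := subalg_sub hA SA.

(* Subtracting multiples of the attained leading terms from the top down never
   leaves the finite set of monomials of degree at most [d], so no
   well-foundedness of the order is needed. *)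
Lemma subduction f : A f -> subalg S f /\
  {in msupp f, forall mu, exists nu, [/\ nu \in msupp f, M nu & le mu nu]}.
Proof.
move=> Af; set d := msize f.
have [tot anti tr _ _] := leP.
pose ge : rel 'X_{1..N} := fun a b => le b a.
have ge_tr : transitive ge by move=> b a c h1 h2; apply: tr h2 h1.
pose L := sort ge (map (@bmnm N d) (enum {: 'X_{1..N < d}})).
have inL mu : (mdeg mu < d)%N -> mu \in L.
  move=> h; rewrite mem_sort; apply/mapP; exists (BMultinom h) => //.
  by rewrite mem_enum.
have Lsorted : sorted ge L by apply: sort_sorted => a b; apply: tot.
have Luniq : uniq L.
  by rewrite sort_uniq map_inj_uniq ?enum_uniq //; apply: val_inj.
(* [s] lists, largest first, the candidates for monomials of [g] in [M]; it is closed downwards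
   among monomials of degree below [d]. Once it is empty, [support_meets] forces [g = 0]. *)
have : forall s, sorted ge s -> uniq s ->
    (forall mu nu, (mdeg mu < d)%N -> nu \in s -> le mu nu -> mu \in s) ->
    forall g, A g -> (forall mu, mu \in msupp g -> (mdeg mu < d)%N) ->
    (forall mu, mu \in msupp g -> M mu -> mu \in s) ->
    subalg S g /\ {in msupp g, forall mu, exists nu,
      [/\ nu \in msupp g, M nu & le mu nu]}.
  elim=> [|x s IHs] ss us ds g Ag dg sg.
    have [->|g0] := eqVneq g 0; last first.
      by case: (support_meets Ag g0) => mu h1 h2; have := sg mu h1 h2.
    by split; [apply: (subalgebra0 (subalg_is_subalgebra _))|move=> mu; rewrite msupp0].
  have xmax nu : nu \in s -> le nu x.
    by move=> hnu; move: ss; rewrite /= (path_sortedE ge_tr) => /andP[/allP/(_ nu hnu)].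
  have ss' : sorted ge s by apply: path_sorted ss.
  have us' : uniq s by case/andP: us.
  have ds' mu nu : (mdeg mu < d)%N -> nu \in s -> le mu nu -> mu \in s.
    move=> h1 h2 h3; have := ds mu nu h1 _ h3; rewrite inE h2 orbT => /(_ isT).
    rewrite inE => /predU1P[e|//]; case/andP: us => /negP xs _; case: xs.
    suff -> : x = nu by [].
    by apply: anti; rewrite -{1}e h3 xmax.
  have [/andP[xg /asboolP Mx]|nx] := boolP ((x \in msupp g) && `[< M x >]); last first.
    apply: IHs => // mu h1 h2; have := sg mu h1 h2; rewrite inE => /predU1P[e|//].
    by case/negP: nx; rewrite -e h1 /=; apply/asboolP.
  have [P [c [SP c0 hP dP _]]] := lead_attained Mx.
  pose g' := g - (g@_x / c) *: P.
  have suppg' mu : mu \in msupp g' -> (mu \in msupp g) || (mu \in msupp P).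
    by move/msuppB_le; rewrite mem_cat => /orP[->//|/msuppZ_le ->]; rewrite orbT.
  have xg' : x \notin msupp g'.
    rewrite mcoeff_msupp negbK mcoeffB mcoeffZ (topform_coef sltP hP).
    by rewrite divfK // subrr.
  have leP' nu : nu \in msupp P -> le nu x.
    by move/(topform_supp hP) => [->//|/andP[]].
  have gE : g = (g@_x / c) *: P + g' by rewrite /g' addrC subrK.
  case: (IHs ss' us' ds' g').
  - apply: subalgebraB => //; apply: subalgebraZ => //; exact: subSA.
  - move=> mu /suppg'/orP[/dg//|/dP h].
    by apply: leq_ltn_trans h _; apply: dg.
  - move=> mu h1 h2.
    have nmx : mu != x by apply: contraNneq xg' => <-.
    (* New monomials come from [P]: they lie below [x] and have no larger degree, so downward
       closure keeps them in the list. *)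
    suff : mu \in x :: s by rewrite inE (negbTE nmx).
    case/orP: (suppg' _ h1) => [h|h]; first exact: sg.
    apply: ds (leP' _ h); last by rewrite mem_head.
    by apply: leq_ltn_trans (dP _ h) _; apply: dg.
  move=> Sg' hg'; split.
    rewrite gE; apply: subalg_add => //; exact: subalg_scale.
  move=> mu mug; exists x; split=> //.
  have [/hg'[nu [h1 h2 h3]]|h] := boolP (mu \in msupp g').
    apply: tr h3 _.
    have nux : nu != x by apply: contraNneq xg' => <-.
    case/orP: (suppg' _ h1) => [h|/leP'//].
    by have := sg nu h h2; rewrite inE (negbTE nux) => /xmax.
  (* A monomial that is absent from [g'] has a coefficient in [g] proportional to the one in [P], so
     it occurs in [P] and is at most [x]. *)
  apply: leP'; move: h; rewrite !mcoeff_msupp negbK.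
  rewrite mcoeffB mcoeffZ subr_eq0 => /eqP e.
  by apply: contraTneq mug => e0; rewrite mcoeff_msupp e e0 mulr0 eqxx.
move/(_ L Lsorted Luniq); apply=> //.
- by move=> mu nu h _ _; apply: inL.
- by move=> mu; apply: msize_mdeg_lt.
- by move=> mu h _; apply: inL; apply: msize_mdeg_lt.
Qed.

Lemma sagbi_criterion : sagbi_basis le S A /\ A = subalg S.
Proof.
split; last first.
  apply/seteqP; split=> [f /subduction[]//|]; exact: subSA.
split=> //; apply/seteqP; split; first exact: subalg_lead_sub.
have [_ anti _ _ _] := leP.
move=> f; elim=> {f} [_ [f [mu [Af [muf hmu] ->]]]||f g _ hf _ hg|a f _ hf].
(* The leading monomial lies below a monomial of the support that is in [M], hence equals it. *)
- have [_ /(_ mu muf)[nu [nuf Mnu hnu]]] := subduction Af.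
  have <- : nu = mu by apply: anti; rewrite hnu hmu.
  by case: (lead_attained Mnu) => P [c []].
- exact: (subalgebra0 (subalg_is_subalgebra _)).
- exact: subalg_add.
- exact: subalg_scale.
Qed.

End SagbiCriterion.

(** * Leading monomials of minors *)

Lemma mpolyX_inj N (R : nzRingType) : injective (fun mu => 'X_[mu] : {mpoly R[N]}).
Proof.
move=> mu nu /(congr1 (mcoeff nu)) /eqP; rewrite !mcoeffX eqxx.
by case: (mu =P nu) => // _; rewrite eq_sym oner_eq0.
Qed.

Section Leads.
Variables (K : fieldType) (m n : nat) (gamma : m.-tuple 'I_n).
Variable le : rel 'X_{1..#|vars gamma|}.
Hypothesis leP : admissible_order gamma K le.

Let N := #|vars gamma|.
Let W : 'M[{mpoly K[N]}]_m := Wmx gamma K.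
Let U : 'M[{mpoly K[N]}]_(m, n) := Umx gamma K.
Let Z : 'M[{mpoly K[N]}]_(m, n) := Zmx gamma K.

Let moP : monomial_order le. Proof. by case: leP. Qed.
Local Notation lt := (strict le).
Let ltP : additive_lt lt := additive_lt_order moP.

Definition Wvarmon (i j : 'I_m) : 'X_{1..N} := varmon (inl (i, j)).

(* The zero entries of [Umx] get the junk value [0]. *)
Definition Uvarmon (i : 'I_m) (j : 'I_n) : 'X_{1..N} :=
  oapp (fun u : Uidx gamma => varmon (inr u)) 0%MM (insub (i, j)).

Lemma WmxE i j : W i j = 'X_[Wvarmon i j].
Proof. by rewrite mxE. Qed.

Lemma UmxE i j : U i j = if (tnth gamma i <= j)%N then 'X_[Uvarmon i j] else 0.
Proof.
rewrite mxE /Uvarmon; case: ifP => h; first by rewrite insubT.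
by rewrite insubF.
Qed.

Let le_refl mu : le mu mu.
Proof. by case: moP => tot _ _ _ _; have := tot mu mu; rewrite orbb. Qed.

Let le_add a b c d : le a b -> le c d -> le (a + c)%MM (b + d)%MM.
Proof.
case: moP => _ _ tr _ add h1 h2; apply: (tr (b + c)%MM); first exact: add.
by rewrite ![(b + _)%MM]addmC; apply: add.
Qed.

Let lt_add a b c d : lt a b -> le c d -> lt (a + c)%MM (b + d)%MM.
Proof.
case: (ltP) => _ tr add h1 h2; have [<-|cd] := eqVneq c d; first exact: add.
apply: (tr (b + c)%MM); first exact: add.
by rewrite ![(b + _)%MM]addmC; apply: add; rewrite /strict h2.
Qed.

Let le_sum r (F G : 'I_r -> 'X_{1..N}) : (forall i, le (F i) (G i)) ->
  le (\sum_i F i)%MM (\sum_i G i)%MM.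
Proof. by move=> h; apply: (big_ind2 (fun a b => le a b)) => // *; apply: le_add. Qed.

Let lt_sum r (F G : 'I_r -> 'X_{1..N}) i : (forall i, le (F i) (G i)) ->
  lt (F i) (G i) -> lt (\sum_i F i)%MM (\sum_i G i)%MM.
Proof.
move=> h hi; rewrite (bigD1 i) //= [X in lt _ X](bigD1 i) //=.
apply: lt_add => //.
by apply: (big_ind2 (fun a b => le a b)) => // *; apply: le_add.
Qed.

Let belowMle tau tau' (p q : {mpoly K[N]}) : below lt tau p ->
  {in msupp q, forall nu, le nu tau'} -> below lt (tau + tau') (p * q).
Proof.
move=> hp hq mu /msuppM_le/allpairsP[[a b]] /= [/hp ha /hq hb ->].
exact: lt_add.
Qed.

Let wmon_lt (i i' j j' : 'I_m) : (i <= i')%N -> (j <= j')%N ->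
  ((i, j) != (i', j')) -> lt (Wvarmon i' j') (Wvarmon i j).
Proof.
have [_ _ _ [hr hc] _] := leP.
have r_lt (a a' b : 'I_m) : (a < a')%N -> lt (Wvarmon a' b) (Wvarmon a b).
  by move=> h; have [h1 h2] := hr _ _ b h; rewrite /strict h1; apply/eqP.
have c_lt (a b b' : 'I_m) : (b < b')%N -> lt (Wvarmon a b') (Wvarmon a b).
  by move=> h; have [h1 h2] := hc a _ _ h; rewrite /strict h1; apply/eqP.
rewrite leq_eqVlt => hi; rewrite leq_eqVlt.
case/predU1P: hi => [/val_inj->|hi] /predU1P[/val_inj->|hj].
- by rewrite eqxx.
- by move=> _; apply: c_lt.
- by move=> _; apply: r_lt.
move=> _; case: (ltP) => _ tr _.
exact: tr (r_lt _ _ _ hi) (c_lt _ _ _ hj).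
Qed.

Let wmon_le (i i' j j' : 'I_m) : (i <= i')%N -> (j <= j')%N ->
  le (Wvarmon i' j') (Wvarmon i j).
Proof.
move=> hi hj; have [[-> ->]//|ne] := (i, j) =P (i', j').
have /andP[] // : lt (Wvarmon i' j') (Wvarmon i j).
by apply: wmon_lt => //; apply/eqP.
Qed.

Let umon_le (i i' : 'I_m) (j : 'I_n) : (i <= i')%N -> (tnth gamma i <= j)%N ->
  (tnth gamma i' <= j)%N -> le (Uvarmon i' j) (Uvarmon i j).
Proof.
rewrite leq_eqVlt => /predU1P[/val_inj->//|ii' h h'].
have [_ _ _ _ [hr _]] := leP.
rewrite /Uvarmon !insubT /=.
by have [] := hr (Sub (i, j) h) (Sub (i', j) h') erefl ii'.
Qed.

Section FixedSize.
Variable r : nat.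
Hypothesis rm : (r <= m)%N.

Definition initial_tuple : r.-tuple 'I_m := [tuple widen_ord rm i | i < r].

Definition Wlead : 'X_{1..N} :=
  (\sum_(i < r) Wvarmon (widen_ord rm i) (widen_ord rm i))%MM.

Definition Ulead (a : r.-tuple 'I_n) : 'X_{1..N} :=
  (\sum_(i < r) Uvarmon (widen_ord rm i) (tnth a i))%MM.

Lemma initial_tuple_increasing : increasing initial_tuple.
Proof. by apply/increasingP => i j ij; rewrite !tnth_mktuple. Qed.

(** An increasing tuple satisfies [i <= tnth e i], so the diagonal factors of any other minor are at
    most the [W_ii], and one of them is strictly smaller. *)
Lemma minorW_below (e c : r.-tuple 'I_m) : increasing e -> increasing c ->
  (e, c) != (initial_tuple, initial_tuple) -> below lt Wlead (minor e c W).
Proof.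
move=> ie ic ne nu hnu; have [_ dW _ _ _] := leP.
have [z|nz] := eqVneq (minor e c W) 0; first by rewrite z msupp0 in hnu.
have [mu [_ hmu] emu] := dW r e c ie ic nz.
suff h : lt mu Wlead.
  have [->//|numu] := eqVneq nu mu.
  case: (ltP) => _ tr _; apply: tr h; rewrite /strict hmu //.
have -> : mu = (\sum_i Wvarmon (tnth e i) (tnth c i))%MM.
  apply: (@mpolyX_inj _ K); rewrite /= emu -mprodXE.
  by apply: eq_bigr => i _; rewrite WmxE.
have /existsP[i hi] : [exists i : 'I_r,
    (widen_ord rm i, widen_ord rm i) != (tnth e i, tnth c i)].
  apply: contraR ne; rewrite negb_exists => /forallP h; apply/eqP.
  by congr (_, _); apply: eq_from_tnth => i; have /negPn/eqP[h1 h2] := h i;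
    rewrite tnth_mktuple.
apply: (lt_sum (i := i)).
  by move=> j; apply: wmon_le => /=; apply: increasing_ge.
by apply: wmon_lt => //=; apply: increasing_ge.
Qed.

Lemma minorW_top : exists2 c, c != 0 &
  topform lt Wlead c (minor initial_tuple initial_tuple W).
Proof.
have [_ dW _ _ _] := leP; set t := initial_tuple.
have it := initial_tuple_increasing; rewrite -/t in it.
have nz : minor t t W != 0.
  (* The minor takes the value [1] at [W = 1], hence is nonzero. *)
  pose ev := meval (fun k : 'I_N => match enum_val k with
    | inl p => (p.1 == p.2)%:R | inr _ => 0 end : K).
  apply: (contra_neq (z1 := ev (minor t t W)) (z2 := 0)); last first.
    rewrite /ev /minor -det_map_mx.
    have -> : map_mx ev (mxsub (tnth t) (tnth t) W) = 1%:M.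
      apply/matrixP => i j; rewrite !mxE /ev mevalXU enum_rankK /=.
      by rewrite (inj_eq (increasing_inj it)).
    by rewrite det1 oner_neq0.
  by move=> ->; rewrite /ev meval0.
have [mu hmu emu] := dW r t t it it nz.
have -> : Wlead = mu; last exact/(is_leadP moP).
apply: (@mpolyX_inj _ K); rewrite /= emu -mprodXE.
by apply: eq_bigr => i _; rewrite WmxE tnth_mktuple.
Qed.

Variable a : r.-tuple 'I_n.
Hypotheses (ia : increasing a)
  (age : forall i : 'I_r, (tnth gamma (widen_ord rm i) <= tnth a i)%N).

(** A monomial is nonzero, so no factor can be one of the zero entries of [U]. *)
Lemma minorU_lead (c : r.-tuple 'I_m) mu :
  'X_[mu] = \prod_(i < r) U (tnth c i) (tnth a i) ->
  mu = (\sum_(i < r) Uvarmon (tnth c i) (tnth a i))%MM /\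
  forall i, (tnth gamma (tnth c i) <= tnth a i)%N.
Proof.
move=> emu.
have h i : (tnth gamma (tnth c i) <= tnth a i)%N.
  apply/negPn/negP => hi; have : ('X_[mu] : {mpoly K[N]}) != 0.
    by apply/negP => /eqP/(congr1 (mcoeff mu))/eqP; rewrite mcoeffX eqxx mcoeff0 oner_eq0.
  by rewrite emu (bigD1 i) //= UmxE (negbTE hi) mul0r eqxx.
split=> //; apply: (@mpolyX_inj _ K); rewrite /= emu -mprodXE.
by apply: eq_bigr => i _; rewrite UmxE h.
Qed.

Lemma minorU_supp_le (c : r.-tuple 'I_m) : increasing c ->
  {in msupp (minor c a U), forall nu, le nu (Ulead a)}.
Proof.
move=> ic nu hnu; have [_ _ dU _ _] := leP.
have [z|nz] := eqVneq (minor c a U) 0; first by rewrite z msupp0 in hnu.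
have [mu [_ hmu] /minorU_lead[emu hc]] := dU r c a ic ia nz; subst mu.
case: (moP) => _ _ tr _ _; apply: tr (hmu _ hnu) _.
by apply: le_sum => i; apply: umon_le => //=; apply: increasing_ge.
Qed.

Lemma minorU_top : exists2 c, c != 0 &
  topform lt (Ulead a) c (minor initial_tuple a U).
Proof.
have [_ _ dU _ _] := leP; set t := initial_tuple.
have it := initial_tuple_increasing; rewrite -/t in it.
have nz : minor t a U != 0.
  (* Setting the variables of [U] at the positions [(tnth t i, tnth a i)] to [1] and all others to
     [0] turns the submatrix into the identity; [age] says that these positions carry variables. *)
  pose ev := meval (fun k : 'I_N => match enum_val k with
    | inl p => 0 | inr u => [exists i : 'I_r,
        (val u == (tnth t i, tnth a i))]%:R end : K).
  apply: (contra_neq (z1 := ev (minor t a U)) (z2 := 0)); last first.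
    rewrite /ev /minor -det_map_mx.
    have -> : map_mx ev (mxsub (tnth t) (tnth a) U) = 1%:M.
      apply/matrixP => i j; rewrite mxE [X in ev X]mxE UmxE mxE.
      have ex_ij : [exists k : 'I_r,
          (tnth t i, tnth a j) == (tnth t k, tnth a k)] = (i == j).
        apply/existsP/eqP => [[k /eqP[e1 e2]]|<-]; last by exists i.
        by rewrite (increasing_inj it e1) (increasing_inj ia e2).
      case: ifP => h; last first.
        rewrite /ev meval0; case: (i =P j) => // e; move: h.
        by rewrite -e tnth_mktuple age.
      rewrite /Uvarmon insubT /ev mevalXU enum_rankK /=.
      by rewrite ex_ij.
    by rewrite det1 oner_neq0.
  by move=> ->; rewrite /ev meval0.
have [mu hmu /minorU_lead[emu _]] := dU r t a it ia nz.
have -> : Ulead a = mu; last exact/(is_leadP moP).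
by rewrite emu; apply: eq_bigr => i _; rewrite tnth_mktuple.
Qed.

Let minorZ_cb (e : r.-tuple 'I_m) : minor e a Z =
  \sum_(c : r.-tuple 'I_m | increasing c) minor e c W * minor c a U.
Proof. exact: minor_mulmx. Qed.

(** In the Cauchy-Binet expansion, every index tuple other than the initial one has a strictly
    smaller [W] factor and a [U] factor that is no larger, so nothing cancels the initial term. *)
Lemma minorZ_top : exists2 c, c != 0 &
  topform lt (Wlead + Ulead a) c (minor initial_tuple a Z).
Proof.
have [c c0 hc] := minorW_top; have [d d0 hd] := minorU_top.
exists (c * d); first exact: mulf_neq0.
rewrite minorZ_cb (bigD1 initial_tuple) ?initial_tuple_increasing //=.
apply: topformDl; first exact: (topformM ltP hc hd).
apply: below_sum => t /andP[it tne]; apply: belowMle.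
  apply: minorW_below => //; first exact: initial_tuple_increasing.
  by rewrite xpair_eqE eqxx.
exact: minorU_supp_le.
Qed.

Lemma minorZ_below (e : r.-tuple 'I_m) : increasing e -> e != initial_tuple ->
  below lt (Wlead + Ulead a) (minor e a Z).
Proof.
move=> ie ne; rewrite minorZ_cb; apply: below_sum => t it; apply: belowMle.
  by apply: minorW_below => //; rewrite xpair_eqE negb_and ne.
exact: minorU_supp_le.
Qed.

End FixedSize.

(** Cauchy-Binet for [Z^T Z] sums products of two minors of [Z] with the same rows; both factors are
    largest for the initial rows, so a single term carries the top monomial. *)
Lemma gram_minor_top r (rm : (r <= m)%N) (a b : r.-tuple 'I_n) :
  increasing a -> increasing b ->
  (forall i : 'I_r, (tnth gamma (widen_ord rm i) <= tnth a i)%N) ->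
  (forall i : 'I_r, (tnth gamma (widen_ord rm i) <= tnth b i)%N) ->
  exists2 c, c != 0 &
    topform lt (Wlead rm + Ulead rm a + (Wlead rm + Ulead rm b)) c
      (minor a b (Z^T *m Z)).
Proof.
move=> ia ib ga gb.
rewrite minor_mulmx; under eq_bigr => e _ do rewrite minor_tr.
have [c c0 hc] := minorZ_top ia ga; have [d d0 hd] := minorZ_top ib gb.
exists (c * d); first exact: mulf_neq0.
rewrite (bigD1 (initial_tuple rm)) ?initial_tuple_increasing //=.
apply: topformDl; first exact: (topformM ltP hc hd).
apply: below_sum => t /andP[it tne].
by apply: (belowM ltP); apply: minorZ_below.
Qed.

End Leads.

(** * Semistandard tableaux *)

Lemma increasing_step b r (c : r.-tuple 'I_b) :
  (forall i j : 'I_r, j = i.+1 :> nat -> (tnth c i < tnth c j)%N) -> increasing c.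
Proof.
move=> h; apply/(sortedP 0%N) => i; rewrite size_map size_tuple => hi.
have := h (Ordinal (ltnW hi)) (Ordinal hi) erefl.
by rewrite -!nth_val_tnth.
Qed.

Section Tableaux.
Variables m n : nat.
Implicit Types a : 'I_m -> 'I_n -> nat.

Definition rowsum a (i : 'I_m) : nat := (\sum_j a i j)%N.

(* [a i j] is the number of entries [j] in row [i] of a row-sorted filling; the
   condition says that columns increase strictly and that rows get shorter. *)
Definition semistandard a : Prop :=
  forall (i i' : 'I_m) (c : 'I_n), i' = i.+1 :> nat ->
  (\sum_(j : 'I_n | (j <= c)%N) a i' j <= \sum_(j : 'I_n | (j < c)%N) a i j)%N.

(** The filling with a single column, whose entry in row [k] is [tnth t k]. *)
Definition column_indicator r (rm : (r <= m)%N) (t : r.-tuple 'I_n)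
    (i : 'I_m) (j : 'I_n) : nat :=
  (\sum_(k < r) ((widen_ord rm k == i) && (tnth t k == j)))%N.

Lemma rowsum_le a (i i' : 'I_m) : semistandard a -> (i <= i')%N ->
  (rowsum a i' <= rowsum a i)%N.
Proof.
move=> ss; case: i' => i' hi' /=; elim: i' hi' => [|k IHk] hk.
  by rewrite leqn0 => /eqP i0; rewrite (_ : Ordinal hk = i) //; apply/val_inj.
rewrite leq_eqVlt => /predU1P[e|ik].
  by rewrite (_ : Ordinal hk = i) //; apply/val_inj.
apply: leq_trans (IHk (ltnW hk) ik); rewrite /rowsum.
case: (posnP n) => [n0|n0].
  by rewrite big1 // => j; have := ltn_ord j; rewrite {2}n0.
(* Semistandardness at the last column compares whole row lengths. *)
have cP : (n.-1 < n)%N by rewrite prednK.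
have := ss (Ordinal (ltnW hk)) (Ordinal hk) (Ordinal cP) erefl.
have -> : (\sum_j a (Ordinal hk) j =
    \sum_(j : 'I_n | (j <= n.-1)%N) a (Ordinal hk) j)%N.
  by apply: eq_bigl => j; rewrite -ltnS prednK ?ltn_ord.
move=> h; apply: leq_trans h _; rewrite [leqRHS](bigID (fun j : 'I_n => (j < n.-1)%N)) /=.
exact: leq_addr.
Qed.

(** The first column of the tableau is removed: [t] holds the least entries of the rows, and [r] is
    the number of nonempty rows, which come first by [rowsum_le]. *)
Lemma strip_column a : semistandard a ->
  exists r (rm : (r <= m)%N) (t : r.-tuple 'I_n) a',
  [/\ [/\ forall i : 'I_m, (i < r)%N = (0 < rowsum a i)%N, increasing t
       & forall i j, a i j = (a' i j + column_indicator rm t i j)%N],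
      [/\ semistandard a' & forall i, rowsum a' i = (rowsum a i).-1]
    & (forall k, (0 < a (widen_ord rm k) (tnth t k))%N) /\
      (forall k j, (0 < a (widen_ord rm k) j)%N -> (tnth t k <= j)%N)].
Proof.
move=> ss.
pose Q k := [forall i : 'I_m, (k <= i)%N ==> (rowsum a i == 0%N)].
have exQ : exists k, Q k.
  by exists m; apply/forallP => i; rewrite leqNgt ltn_ord.
case: (ex_minnP exQ) => r /forallP Qr minr.
have rP (i : 'I_m) : (i < r)%N = (0 < rowsum a i)%N.
  rewrite lt0n; apply/idP/idP => [ir|]; last first.
    by rewrite ltnNge; apply: contra => h; have := Qr i; rewrite h.
  apply: contraTneq ir => e; rewrite -leqNgt; apply: minr.
  apply/forallP => j; apply/implyP => ij.
  by have := rowsum_le ss ij; rewrite e leqn0.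
have rm : (r <= m)%N.
  by apply: minr; apply/forallP => i; rewrite leqNgt ltn_ord.
have colP (k : 'I_r) : exists j : 'I_n, (0 < a (widen_ord rm k) j)%N /\
    forall j', (0 < a (widen_ord rm k) j')%N -> (j <= j')%N.
  have := rP (widen_ord rm k); rewrite /= ltn_ord => /esym.
  rewrite lt0n sum_nat_eq0 negb_forall => /existsP[j0].
  rewrite -lt0n => h0.
  by case: (@arg_minnP _ j0 (fun j => (0 < a (widen_ord rm k) j)%N) (@nat_of_ord n) h0) => j h1 h2; exists j.
have [f fP] := fin_all_exists colP.
pose t : r.-tuple 'I_n := [tuple f k | k < r].
pose a' i j := (a i j - column_indicator rm t i j)%N.
have indw k j : column_indicator rm t (widen_ord rm k) j = (f k == j).
  rewrite /column_indicator (bigD1 k) //= eqxx tnth_mktuple big1 ?addn0 // => l lk.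
  by rewrite -val_eqE /= val_eqE (negbTE lk).
have row_out (i : 'I_m) j : ~~ (i < r)%N -> a i j = 0%N.
  by rewrite rP -eqn0Ngt sum_nat_eq0 => /forallP/(_ j)/eqP.
have widenE (i : 'I_m) (ir : (i < r)%N) : widen_ord rm (Ordinal ir) = i.
  exact: val_inj.
have ind_out (i : 'I_m) j : ~~ (i < r)%N -> column_indicator rm t i j = 0%N.
  move=> h; rewrite /column_indicator big1 // => k _.
  by case: eqP => // e; move: h; rewrite -e /= ltn_ord.
have le_ind i j : (column_indicator rm t i j <= a i j)%N.
  have [ir|ir] := boolP (i < r)%N; last by rewrite ind_out.
  rewrite -(widenE i ir) indw; case: eqP => // <-.
  by have [] := fP (Ordinal ir).
(* On a downward closed set of columns, removing the least entry of a row lowers a positive count by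
   exactly one, and a zero count stays zero. Both sides of the semistandard inequality therefore
   pass to their predecessors. *)
have sumP (P : pred 'I_n) i :
    (forall j j' : 'I_n, P j -> (j' <= j)%N -> P j') ->
    (\sum_(j | P j) a' i j = (\sum_(j | P j) a i j).-1)%N.
  move=> Pd; case: (posnP (\sum_(j | P j) a i j)%N) => [e|].
    have : (\sum_(j | P j) a' i j <= \sum_(j | P j) a i j)%N.
      by apply: leq_sum => j _; apply: leq_subr.
    by rewrite e leqn0 => /eqP.
  rewrite lt0n sum_nat_eq0 negb_forall => /existsP[j].
  rewrite negb_imply -lt0n => /andP[Pj aj].
  have ir : (i < r)%N by apply: contraTT aj => /row_out ->.
  rewrite -(widenE i ir) in aj *; set k := Ordinal ir in aj *.
  have [h1 h2] := fP k.
  have Pf : P (f k) by apply: Pd Pj _; apply: h2.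
  rewrite (bigD1 (f k)) //= [in RHS](bigD1 (f k)) //=.
  rewrite {1}/a' indw eqxx subn1 -[in RHS](prednK h1) addSn /=; congr addn.
  apply: eq_bigr => l /andP[_ lf].
  by rewrite /a' indw eq_sym (negbTE lf) subn0.
exists r, rm, t, a'; split; [split=> //| split |split].
(* Semistandardness at column [f k']: the entry [f k'] in row [k'] forces an entry strictly before
   it in row [k]. *)
- apply: increasing_step => k k' e; rewrite !tnth_mktuple.
  have [h1 _] := fP k'.
  have := ss (widen_ord rm k) (widen_ord rm k') (f k') e.
  rewrite (bigD1 (f k')) //= => h.
  have : (0 < \sum_(j : 'I_n | (j < f k')%N) a (widen_ord rm k) j)%N.
    by apply: leq_trans h; rewrite addn_gt0 h1.
  rewrite lt0n sum_nat_eq0 negb_forall => /existsP[j].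
  rewrite negb_imply -lt0n => /andP[jf /(proj2 (fP k)) fj].
  exact: leq_ltn_trans fj jf.
- by move=> i j; rewrite subnK.
- move=> i i' c e; rewrite !sumP.
  + by rewrite -!subn1 leq_sub2r //; apply: ss.
  + by move=> j j' h1 h2; apply: leq_ltn_trans h2 h1.
  + by move=> j j' h1 h2; apply: leq_trans h2 h1.
- by move=> i; rewrite /rowsum sumP.
- by move=> k; rewrite tnth_mktuple; case: (fP k).
- by move=> k j; rewrite tnth_mktuple; case: (fP k) => _; apply.
Qed.

End Tableaux.

(** * Products of leading monomials of the generators *)

Section StandardMonomials.
Variables (K : fieldType) (m n : nat) (gamma : m.-tuple 'I_n).
Variable le : rel 'X_{1..#|vars gamma|}.
Hypothesis leP : admissible_order gamma K le.
Let N := #|vars gamma|.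
Implicit Types a : 'I_m -> 'I_n -> nat.
Local Notation Z := (Zmx gamma K).
Local Notation wmon := (@Wvarmon m n gamma).
Local Notation umon := (@Uvarmon m n gamma).

Let moP : monomial_order le. Proof. by case: leP. Qed.
Let ltP : additive_lt (strict le) := additive_lt_order moP.

(** The exponents of the [W_ii] are forced: the leading monomial of a minor of [Z] has one factor
    [W_ii] for each entry of its column tableau in row [i]. *)
Definition tableau_monomial a : 'X_{1..N} :=
  (\sum_i (wmon i i *+ rowsum a i) + \sum_i \sum_j (umon i j *+ a i j))%MM.

Definition fits a : Prop :=
  forall i j, (0 < a i j)%N -> (tnth gamma i <= j)%N.

Let mulmDr (mu : 'X_{1..N}) k l : (mu *+ (k + l) = mu *+ k + mu *+ l)%MM.
Proof. by apply/mnmP => i; rewrite mnmDE !mulmnE mulnDr. Qed.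

Lemma tableau_monomialD a b c : (forall i j, c i j = (a i j + b i j)%N) ->
  tableau_monomial c = (tableau_monomial a + tableau_monomial b)%MM.
Proof.
move=> h; rewrite /tableau_monomial.
have -> : (\sum_i wmon i i *+ rowsum c i =
    \sum_i wmon i i *+ rowsum a i + \sum_i wmon i i *+ rowsum b i)%MM.
  rewrite -big_split; apply: eq_bigr => i _ /=; rewrite -mulmDr; congr (_ *+ _)%MM.
  by rewrite /rowsum -big_split; apply: eq_bigr => j _.
have -> : (\sum_i \sum_j umon i j *+ c i j =
    \sum_i \sum_j umon i j *+ a i j + \sum_i \sum_j umon i j *+ b i j)%MM.
  rewrite -big_split; apply: eq_bigr => i _ /=; rewrite -big_split.
  by apply: eq_bigr => j _ /=; rewrite -mulmDr h.
by apply/mnmP => i; rewrite !mnmDE addnACA.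
Qed.

Lemma tableau_monomial_indicator r (rm : (r <= m)%N) (t : r.-tuple 'I_n) :
  tableau_monomial (column_indicator rm t) =
  (Wlead gamma rm + Ulead gamma rm t)%MM.
Proof.
have msum (I : finType) (mu : 'X_{1..N}) (F : I -> nat) :
    (mu *+ (\sum_i F i) = \sum_i mu *+ F i)%MM.
  by apply: (big_morph (fun k => (mu *+ k)%MM)).
rewrite /tableau_monomial /column_indicator; congr (_ + _)%MM.
  under eq_bigr => i _.
    rewrite /rowsum exchange_big /= msum.
    over.
  rewrite exchange_big; apply: eq_bigr => k _ /=.
  rewrite (bigD1 (widen_ord rm k)) //= [X in (_ + X)%MM]big1 ?addm0 => [|i ik].
    rewrite (bigD1 (tnth t k)) //= !eqxx big1 ?addn0 ?mulm1n // => j jk.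
    by rewrite eq_sym (negbTE jk).
  by rewrite big1 // => j _; rewrite eq_sym (negbTE ik).
under eq_bigr => i _.
  under eq_bigr => j _ do rewrite msum.
  rewrite exchange_big /=.
  over.
rewrite exchange_big; apply: eq_bigr => k _ /=.
rewrite (bigD1 (widen_ord rm k)) //= [X in (_ + X)%MM]big1 ?addm0 => [|i ik].
  rewrite (bigD1 (tnth t k)) //= !eqxx big1 ?addm0 ?mulm1n // => j jk.
  by rewrite eq_sym (negbTE jk).
by rewrite big1 // => j _; rewrite eq_sym (negbTE ik).
Qed.

Lemma tableau_monomial0 a : (forall i, rowsum a i = 0%N) ->
  tableau_monomial a = 0%MM.
Proof.
move=> h.
have a0 i j : a i j = 0%N.
  by have /eqP := h i; rewrite sum_nat_eq0 => /forallP/(_ j)/eqP.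
rewrite /tableau_monomial !big1 ?addm0 // => i _; last by rewrite h.
by rewrite big1 // => j _; rewrite a0.
Qed.

(** The requirement [lead_attained] of the criterion, for a single monomial. *)
Definition attained (S : set {mpoly K[N]}) (mu : 'X_{1..N}) : Prop :=
  exists P c, [/\ subalg S P, c != 0, topform (strict le) mu c P,
      {in msupp P, forall nu, (mdeg nu <= mdeg mu)%N}
    & subalg (lead_monomials le S) 'X_[mu]].

Lemma attained0 S : attained S 0%MM.
Proof.
exists 1, 1; split; [exact: subalg_one|exact: oner_neq0|exact: topform1| |].
  by move=> nu; rewrite -mpolyX0 => /mem_msuppXP <-.
by rewrite mpolyX0; apply: subalg_one.
Qed.

Lemma attainedD S mu nu :
  attained S mu -> attained S nu -> attained S (mu + nu).
Proof.
move=> [P [c [SP c0 hP dP lP]]] [Q [d [SQ d0 hQ dQ lQ]]].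
exists (P * Q), (c * d); split.
- exact: subalg_mul.
- exact: mulf_neq0.
- exact: topformM.
- move=> x /msuppM_le/allpairsP[[a b]] /= [/dP ha /dQ hb ->].
  by rewrite !mdegD leq_add.
- by rewrite mpolyXD; apply: subalg_mul.
Qed.

(** Homogeneity of the generator supplies the degree bound. *)
Lemma attained_gen (S : set {mpoly K[N]}) P c mu d : S P -> c != 0 ->
  topform (strict le) mu c P -> wsupp (fun x y => x == y) (fun=> 1%N) d P ->
  attained S mu.
Proof.
move=> SP c0 hP dP; exists P, c; split=> //; first exact: subalg_gen.
  have muP : mu \in msupp P by rewrite mcoeff_msupp (topform_coef ltP hP).
  move=> nu /dP/eqP e; rewrite !mdeg_wt e.
  by have /eqP -> := dP _ muP.
apply: subalg_gen; exists P, mu; split=> //.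
by apply/(is_leadP moP); exists c.
Qed.

Lemma attained_mono (S T : set {mpoly K[N]}) mu :
  S `<=` T -> attained S mu -> attained T mu.
Proof.
move=> ST [P [c [SP c0 hP dP lP]]]; exists P, c; split=> //.
  exact: subalg_mono SP.
apply: subalg_mono lP => _ [f [nu [Sf hf ->]]].
by exists f, nu; split=> //; apply: ST.
Qed.

Let wsuppW i j : wsupp (fun x y => x == y) (fun=> 1%N) 1 (Wmx gamma K i j).
Proof. by rewrite WmxE; apply: wsuppX; rewrite -mdeg_wt mdeg1. Qed.

Let wsuppU i j : wsupp (fun x y => x == y) (fun=> 1%N) 1 (Umx gamma K i j).
Proof.
rewrite UmxE; case: ifP => h; last exact: wsupp0.
by apply: wsuppX; rewrite -mdeg_wt /umon insubT mdeg1.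
Qed.

Let wsuppZ i j : wsupp (fun x y => x == y) (fun=> 1%N) 2 (Zmx gamma K i j).
Proof.
rewrite mxE; apply: wsupp_sum => k _.
exact: (wsuppM addrel_eq (d := 1) (e := 1)).
Qed.

Lemma attained_gram r (rm : (r <= m)%N) (a b : r.-tuple 'I_n) :
  (0 < r)%N -> (m <= n)%N -> increasing a -> increasing b ->
  (forall i : 'I_r, (tnth a i <= tnth b i)%N) ->
  (forall i : 'I_r, (tnth gamma (widen_ord rm i) <= tnth a i)%N) ->
  attained (gram_minors gamma K)
    (Wlead gamma rm + Ulead gamma rm a + (Wlead gamma rm + Ulead gamma rm b)).
Proof.
move=> r0 mn ia ib ab ga.
have gb i : (tnth gamma (widen_ord rm i) <= tnth b i)%N.
  exact: leq_trans (ga i) (ab i).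
have [c c0 hc] := gram_minor_top leP ia ib ga gb.
apply: (attained_gen (d := (r * 4)%N) _ c0 hc).
  exists r, a, b; split=> //; rewrite /Dset /Gamma' /leGamma r0 ia ib leqnn rm.
  rewrite (leq_trans rm mn) /=; apply/andP; split; apply/forallP => i.
    by rewrite !nth_val_tnth.
  rewrite nth_val_tnth.
  by have := nth_val_tnth gamma (widen_ord rm i); rewrite /= => ->; apply: ga.
apply: wsupp_det => [|i j]; first exact: addrel_eq.
rewrite mxE mxE; apply: wsupp_sum => k _; rewrite mxE.
exact: (wsuppM addrel_eq (d := 2) (e := 2)).
Qed.

Lemma attained_maxminor (a : m.-tuple 'I_n) :
  (0 < m)%N -> increasing a ->
  (forall i : 'I_m, (tnth gamma i <= tnth a i)%N) ->
  attained (maxminors_ge gamma K)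
    (Wlead gamma (leqnn m) + Ulead gamma (leqnn m) a).
Proof.
move=> m0 ia ga.
have wE i : widen_ord (leqnn m) i = i by apply: val_inj.
have [|c c0 hc] := minorZ_top (rm := leqnn m) leP ia; first by move=> i; rewrite wE.
apply: (attained_gen (d := (m * 2)%N) _ c0 hc).
  exists a; split; last first.
    congr (minor _ _ _); apply: eq_from_tnth => i.
    by rewrite tnth_mktuple tnth_ord_tuple wE.
  rewrite /GammaGe /Gamma /Gamma' /leGamma m0 leqnn ia /=.
  by apply/forallP => i; rewrite !nth_val_tnth.
by apply: wsupp_det => [|i j]; [exact: addrel_eq|rewrite mxE].
Qed.

(** Columns are removed two at a time. Even row lengths make the first two columns equally long, so
    they are the two index tuples of one Gram minor. *)
Lemma attained_even a : (m <= n)%N -> semistandard a -> fits a ->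
  (forall i, ~~ odd (rowsum a i)) ->
  attained (gram_minors gamma K) (tableau_monomial a).
Proof.
move=> mn; have [k] := ubnP (\sum_i rowsum a i)%N.
elim: k a => // k IHk a ak ss fa ev.
case: (posnP (\sum_i rowsum a i)%N) => [/eqP|pos].
  rewrite sum_nat_eq0 => /forallP h; rewrite tableau_monomial0.
    exact: attained0.
  by move=> i; apply/eqP; apply: h.
have [r [rm [t [a1 [[r1 it a1E] [ss1 row1] [t1 t1min]]]]]] := strip_column ss.
have [r' [rm' [t' [a2 [[r2 it' a2E] [ss2 row2] [t2 t2min]]]]]] := strip_column ss1.
have err' : r = r'.
  (* A row of even length is nonempty exactly when it keeps an entry after one removal. *)
  have hi (i : 'I_m) : (i < r)%N = (i < r')%N.
    rewrite r1 r2 row1; move: (ev i); case: (rowsum a i) => [|[|?]] //.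
  apply/eqP; rewrite eqn_leq; apply/andP; split; rewrite leqNgt; apply/negP => h.
    have h' := leq_trans h rm; have := hi (Ordinal h').
    by rewrite /= ltnn h.
  have h' := leq_trans h rm'; have := hi (Ordinal h').
  by rewrite /= ltnn h.
subst r'; rewrite (bool_irrelevance rm' rm) in a2E t2 t2min.
have r0 : (0 < r)%N.
  move: pos; rewrite lt0n sum_nat_eq0 negb_forall => /existsP[i].
  by rewrite -lt0n -r1; apply: leq_ltn_trans.
have aE i j : a i j =
    (a2 i j + (column_indicator rm t i j + column_indicator rm t' i j))%N.
  by rewrite a1E a2E addnAC addnA.
rewrite (tableau_monomialD aE) [X in (_ + X)%MM](tableau_monomialD
  (a := column_indicator rm t) (b := column_indicator rm t')) //.
rewrite !tableau_monomial_indicator; apply: attainedD.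
  apply: (IHk a2 _ ss2).
  - rewrite -ltnS; apply: leq_trans ak; rewrite ltnS.
    have h i : (rowsum a2 i <= rowsum a i)%N by rewrite row2 row1; lia.
    move: pos; rewrite lt0n sum_nat_eq0 negb_forall => /existsP[i].
    rewrite -lt0n => hi; rewrite (bigD1 i) //= [X in (_ < X)%N](bigD1 i) //=.
    rewrite -addSn leq_add //; first by rewrite row2 row1; lia.
    by apply: leq_sum => j _; apply: h.
  - by move=> i j h; apply: fa; rewrite aE addn_gt0 h.
  - by move=> i; rewrite row2 row1; have := ev i; case: (rowsum a i) => [|[|?]] //=; rewrite negbK.
apply: attained_gram => //.
(* The entries of the second column already occur in the same rows of [a], where [t] holds the least
   ones; hence [t <= t'] entrywise. *)
- by move=> i; apply: t1min; rewrite a1E addn_gt0 t2.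
- by move=> i; apply: fa.
Qed.

(** When all rows are odd, none is empty, so the first column has full length [m] and gives a
    maximal minor; what remains has even rows. *)
Lemma attained_parity a : (0 < m <= n)%N -> semistandard a -> fits a ->
  (forall i j, odd (rowsum a i) = odd (rowsum a j)) ->
  attained (gram_minors gamma K `|` maxminors_ge gamma K) (tableau_monomial a).
Proof.
move=> /andP[m0 mn] ss fa par.
have [od|ev] := boolP (odd (rowsum a (Ordinal m0))); last first.
  apply: (attained_mono (S := gram_minors gamma K)); first by move=> x; left.
  by apply: attained_even => // i; rewrite (par i (Ordinal m0)).
have oddi i : odd (rowsum a i) by rewrite (par i (Ordinal m0)).
have [r [rm [t [a1 [[r1 it a1E] [ss1 row1] [t1 t1min]]]]]] := strip_column ss.
have erm : r = m.
  apply/eqP; rewrite eqn_leq rm leqNgt; apply/negP => h.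
  by have := r1 (Ordinal h); rewrite /= ltnn odd_gt0.
subst r; rewrite (bool_irrelevance rm (leqnn m)) in a1E t1 t1min.
rewrite (tableau_monomialD a1E) tableau_monomial_indicator; apply: attainedD.
  apply: (attained_mono (S := gram_minors gamma K)); first by move=> x; left.
  apply: attained_even => //.
  - by move=> i j h; apply: fa; rewrite a1E addn_gt0 h.
  - by move=> i; rewrite row1; have := oddi i; case: (rowsum a i).
apply: (attained_mono (S := maxminors_ge gamma K)); first by move=> x; right.
apply: attained_maxminor => // i.
by apply: fa; have := t1 i; rewrite (_ : widen_ord _ _ = i) //; apply: val_inj.
Qed.

End StandardMonomials.

(** * Orthogonal-triangular factorization *)

Section SquareRoots.

(** A quadratic polynomial without root is irreducible; this includes the inseparable case in
    characteristic two. *)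
Lemma sqrt_extension (L : fieldType) (a : L) :
  exists (L' : fieldType) (phi : {rmorphism L -> L'}) (b : L'), b ^+ 2 = phi a.
Proof.
have [[b hb]|nb] := pselect (exists b, b ^+ 2 = a).
  by exists L, idfun, b.
have sz : size ('X^2 - a%:P) = 3%N by rewrite size_XnsubC.
have irr : irreducible_poly ('X^2 - a%:P).
  apply: cubic_irreducible; first by rewrite sz.
  move=> x; apply/negP; rewrite rootE !hornerE subr_eq0 => /eqP e.
  by apply: nb; exists x.
have [L' _ [z rz _]] := irredp_FAdjoin irr.
exists L', (in_alg L'), z.
by move: rz; rewrite rootE rmorphB rmorphXn /= map_polyX map_polyC !hornerE subr_eq0 => /eqP.
Qed.

Lemma sqrt_extensions (L : fieldType) (s : seq L) :
  exists (L' : fieldType) (phi : {rmorphism L -> L'}),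
    {in s, forall a, exists b, b ^+ 2 = phi a}.
Proof.
elim: s => [|a s [L1 [phi1 IHs]]]; first by exists L, idfun.
have [L2 [phi2 [b hb]]] := sqrt_extension (phi1 a).
exists L2, (phi2 \o phi1) => x; rewrite inE => /predU1P[->|/IHs[c hc]].
  by exists b.
by exists (phi2 c); rewrite -rmorphXn hc.
Qed.

End SquareRoots.

Section Cholesky.
Variables (L : fieldType) (I : L -> Prop).

(* [I] plays the role of the maximal ideal of a local subring of [L]: matrices
   congruent to the identity modulo [I] have invertible pivots. *)
Record pivot_ideal : Prop := PivotIdeal {
  pivot0 : I 0;
  pivotD : forall x y, I x -> I y -> I (x + y);
  pivotN : forall x, I x -> I (- x);
  pivotM : forall x y, I x -> I y -> I (x * y);
  pivotV : forall x, I x -> 1 + x != 0 /\ I ((1 + x)^-1 - 1) }.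

Hypothesis IP : pivot_ideal.

Definition near_one n (S : 'M[L]_n) : Prop := forall i j, I (S i j - (i == j)%:R).

Definition upper_unitriangular (R : comNzRingType) n (h : 'M[R]_n) : Prop :=
  (forall i j : 'I_n, (j < i)%N -> h i j = 0) /\ forall i, h i i = 1.

(** Symmetric Gaussian elimination: the corner entry lies in [1 + I], hence is invertible, and the
    Schur complement is again congruent to the identity, so all pivots are nonzero. *)
Lemma near_one_LDL n (S : 'M[L]_n) : S^T = S -> near_one S ->
  exists (h : 'M[L]_n) (d : 'rV[L]_n),
    [/\ upper_unitriangular h, S = h^T *m diag_mx d *m h & forall i, d 0 i != 0].
Proof.
elim: n S => [|n IHn]; last first.
  rewrite -[n.+1]/(1 + n)%N => S symS oneS.
  have [A [v [w [S1 eS]]]] : exists A v w S1, S = block_mx A v w S1.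
    by exists (ulsubmx S), (ursubmx S), (dlsubmx S), (drsubmx S); rewrite submxK.
  subst S.
  move: symS; rewrite tr_block_mx => /eq_block_mx[_ _ vw symS1].
  set a := A 0 0.
  have hA : A = a%:M by rewrite [A]mx11_scalar.
  have Ia : I (a - 1).
    by have := oneS (lshift n 0) (lshift n 0); rewrite block_mxEul eqxx.
  have Iv i : I (v 0 i).
    have := oneS (lshift n 0) (rshift 1 i); rewrite block_mxEur eq_lrshift.
    by rewrite subr0.
  have IS1 i j : I (S1 i j - (i == j)%:R).
    by have := oneS (rshift 1 i) (rshift 1 j); rewrite block_mxEdr eq_rshift.
  have [a0 Ia'] := pivotV IP Ia; rewrite addrC subrK in a0 Ia'.
  have [||h [d [[hu h1] hS hd]]] := IHn (S1 - a^-1 *: (v^T *m v)).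
  - by rewrite linearB linearZ /= trmx_mul trmxK symS1.
  - move=> i j; rewrite !mxE big_ord1 !mxE.
    (* Since [a^-1 - 1] rather than [a^-1] lies in the ideal, [a^-1] is split as
       [(a^-1 - 1) + 1]. *)
    have -> : S1 i j - a^-1 * (v 0 i * v 0 j) - (i == j)%:R =
      (S1 i j - (i == j)%:R) - ((a^-1 - 1) * (v 0 i * v 0 j) + v 0 i * v 0 j) by ring.
    apply: (pivotD IP) => //; apply: (pivotN IP).
    by apply: (pivotD IP); do ?apply: (pivotM IP).
  exists (block_mx 1%:M (a^-1 *: v) 0 h : 'M_(1 + n)), (row_mx a%:M d); split.
  - split=> [i j|i].
      rewrite -[i]splitK -[j]splitK; case: (split i) => i'; case: (split j) => j' /=.
      + by rewrite !ord1 ltnn.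
      + by rewrite ord1.
      + by rewrite block_mxEdl mxE.
      + by rewrite block_mxEdr ltn_add2l; apply: hu.
    rewrite -[i]splitK; case: (split i) => i' /=.
      by rewrite block_mxEul ord1 mxE.
    by rewrite block_mxEdr.
  - rewrite diag_mx_row tr_block_mx !mulmx_block !trmx0 !mul0mx !mulmx0 !addr0.
    rewrite !add0r trmx1 mul1mx mulmx1 -hS.
    have -> : diag_mx a%:M = a%:M :> 'M_1.
      by apply/matrixP => i j; rewrite !mxE !ord1.
    congr block_mx.
    + by rewrite hA.
    + by rewrite mul_scalar_mx scalerA divff // scale1r mul0mx addr0.
    + by rewrite -vw mulmx1 mul_mx_scalar linearZ /= scalerA divff // scale1r.
    + have -> : (a^-1 *: v)^T = a^-1 *: v^T by rewrite linearZ.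
      by rewrite mul_mx_scalar scalerA divff // scale1r -scalemxAr addrC subrK.
  - move=> i; rewrite -[i]splitK; case: (split i) => i' /=.
      by rewrite row_mxEl ord1 mxE mulr1n.
    by rewrite row_mxEr.
move=> S _ _; exists 1%:M, 0.
by split; [split; case|apply/matrixP; case|case].
Qed.

Lemma near_one_gram n (W : 'M[L]_n) : near_one W -> near_one (W^T *m W).
Proof.
move=> hW i j.
pose X := W - 1%:M.
have IX k l : I (X k l) by rewrite !mxE; apply: hW.
have -> : W = X + 1%:M by rewrite subrK.
have -> : (X + 1%:M)^T = X^T + 1%:M by rewrite linearD /= trmx1.
have -> : ((X^T + 1%:M) *m (X + 1%:M)) i j - (i == j)%:R =
    (X^T *m X) i j + X j i + X i j.
  rewrite mulmxDl !mulmxDr !mul1mx !mulmx1 [X in X - _]mxE.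
  by rewrite [X in X + _ - _]mxE [X in _ + X - _]mxE !mxE; ring.
rewrite mxE; apply: (pivotD IP); last exact: IX.
apply: (pivotD IP); last exact: IX.
apply: big_ind; [exact: (pivot0 IP)|exact: (pivotD IP)|].
by move=> k _; rewrite mxE; apply: (pivotM IP).
Qed.

(* A generic matrix is the product of an orthogonal matrix and a triangular one
   after adjoining square roots of the pivots of its Gram matrix; the sign of
   one square root is used to make the determinant [1]. *)
Lemma orthogonal_triangular n (W : 'M[L]_n) : (0 < n)%N -> near_one W ->
  exists (L' : fieldType) (phi : {rmorphism L -> L'}) (g h : 'M[L']_n)
    (t : 'rV[L']_n),
  [/\ g^T *m g = 1%:M, \det g = 1, upper_unitriangular h
    & g *m map_mx phi W = diag_mx t *m h].
Proof.
move=> n0 oneW.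
have [|h0 [d [[h0u h01] eS d0]]] := near_one_LDL _ (near_one_gram oneW).
  by rewrite trmx_mul trmxK.
have [L' [phi hphi]] := sqrt_extensions [seq d 0 i | i : 'I_n].
have ex_b i : exists b, b ^+ 2 = phi (d 0 i) by apply: hphi; apply: map_f; rewrite mem_enum.
have [b bP] := fin_all_exists ex_b.
pose h := map_mx phi h0; pose W' := map_mx phi W.
have hu : upper_unitriangular h.
  by split=> [i j ij|i]; rewrite mxE ?h01 ?rmorph1 // h0u ?rmorph0.
have uW' : W' \in unitmx.
  have : \det (W^T *m W) != 0.
    rewrite eS !det_mulmx det_tr det_diag.
    have -> : \det h0 = 1.
      rewrite -det_tr det_trig; first by rewrite big1 // => i _; rewrite mxE.
      by apply/is_trig_mxP => i j ij; rewrite mxE h0u.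
    by rewrite mul1r mulr1; apply/prodf_neq0 => i _.
  rewrite det_mulmx det_tr mulf_eq0 orbb => dW.
  by rewrite unitmxE unitfE det_map_mx fmorph_eq0.
(* Orthogonality of [g t] amounts to [T^T T = W'^T W'], which holds as soon as the squares of the
   entries of [t] are the pivots. *)
pose T t : 'M_n := diag_mx t *m h; pose g t := T t *m invmx W'.
have gW (t : 'rV_n) : g t *m W' = T t by rewrite /g mulmxKV.
have gO (t : 'rV_n) : (forall i, t 0 i ^+ 2 = phi (d 0 i)) -> (g t)^T *m g t = 1%:M.
  move=> ht.
  have TT : (T t)^T *m T t = W'^T *m W'.
    rewrite /W' map_trmx -map_mxM /= eS !map_mxM /= -map_trmx -/h.
    rewrite /T trmx_mul tr_diag_mx !mulmxA; congr (_ *m _); rewrite -!mulmxA.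
    congr (_ *m _); rewrite mulmx_diag; apply/matrixP => i j.
    by rewrite !mxE rmorphMn /= -ht expr2.
  rewrite /g trmx_mul trmx_inv mulmxA -[_ *m _ *m T t]mulmxA TT.
  by rewrite -trmx_inv mulmxA -trmx_mul mulmxV // trmx1 mul1mx mulmxV.
pose t0 : 'rV_n := \row_i b i.
pose t1 : 'rV_n := \row_i ((-1) ^+ (i == Ordinal n0) * b i).
have ht0 i : t0 0 i ^+ 2 = phi (d 0 i) by rewrite mxE.
have ht1 i : t1 0 i ^+ 2 = phi (d 0 i) by rewrite mxE exprMn sqrr_sign mul1r.
have dets : \det (g t1) = - \det (g t0).
  rewrite /g /T !det_mulmx !det_diag.
  have -> : \prod_i t1 0 i = - \prod_i t0 0 i; last by rewrite !mulNr.
  rewrite (bigD1 (Ordinal n0)) //= [in RHS](bigD1 (Ordinal n0)) //=.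
  rewrite !mxE eqxx expr1 mulN1r mulNr; congr (- (_ * _)).
  by apply: eq_bigr => i ni; rewrite !mxE (negbTE ni) mul1r.
have := congr1 determinant (gO _ ht0); rewrite det_mulmx det_tr det1 -expr2.
move/eqP; rewrite sqrf_eq1 => /orP[] /eqP e.
  by exists L', phi, (g t0), h, t0; split=> //; apply: gO.
exists L', phi, (g t1), h, t1; split=> //; first exact: gO.
by rewrite dets e opprK.
Qed.

End Cholesky.

(** * Evaluation over test rings *)

Section AlgebraOfMorphism.
Variables (K S : comNzRingType) (phi : {rmorphism K -> S}).

(* A copy of [S]; the dummy [let] indexes its [K]-algebra structure by [phi]. *)
Definition algebra_of : Type := let _ := phi in S.

HB.instance Definition _ := GRing.ComNzRing.on algebra_of.

Definition algebra_of_scale (a : K) (x : algebra_of) : algebra_of :=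
  (phi a : algebra_of) * x.

Lemma algebra_of_scaleA a b x :
  algebra_of_scale a (algebra_of_scale b x) = algebra_of_scale (a * b) x.
Proof. by rewrite /algebra_of_scale mulrA rmorphM. Qed.

Lemma algebra_of_scale1 : left_id 1 algebra_of_scale.
Proof. by move=> x; rewrite /algebra_of_scale rmorph1 mul1r. Qed.

Lemma algebra_of_scaleDr : right_distributive algebra_of_scale +%R.
Proof. by move=> a x y; rewrite /algebra_of_scale mulrDr. Qed.

Lemma algebra_of_scaleDl x : {morph algebra_of_scale^~ x : a b / a + b}.
Proof. by move=> a b; rewrite /algebra_of_scale rmorphD mulrDl. Qed.

HB.instance Definition _ := GRing.Zmodule_isLmodule.Build K algebra_of
  algebra_of_scaleA algebra_of_scale1 algebra_of_scaleDr algebra_of_scaleDl.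

Lemma algebra_of_scaleAl (a : K) (x y : algebra_of) : a *: (x * y) = a *: x * y.
Proof. exact: mulrA. Qed.

HB.instance Definition _ :=
  GRing.Lmodule_isLalgebra.Build K algebra_of algebra_of_scaleAl.
HB.instance Definition _ := GRing.Lalgebra_isComAlgebra.Build K algebra_of.

Lemma algebra_of_in_alg (a : K) : in_alg algebra_of a = phi a.
Proof. exact: mulr1. Qed.

End AlgebraOfMorphism.

Section Evaluation.
Variables (N : nat).

(** Together with [eq_mmap], this reduces equalities between composites of evaluations to constants
    and variables. *)
Lemma rmorph_mmap (R S : comNzRingType) (theta : {rmorphism {mpoly R[N]} -> S}) p :
  theta p = mmap (theta \o mpolyC N (R:=R)) (fun i => theta 'X_i) p.
Proof.
rewrite {1}[p]mpolyE rmorph_sum; apply: eq_bigr => mu _.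
rewrite -mul_mpolyC rmorphM /=; congr (_ * _).
by rewrite mpolyXE_id rmorph_prod; apply: eq_bigr => i _; rewrite rmorphXn.
Qed.

Lemma eq_mmap (R S : comNzRingType) (f1 f2 : R -> S) (h1 h2 : 'I_N -> S)
  (p : {mpoly R[N]}) : f1 =1 f2 -> h1 =1 h2 -> mmap f1 h1 p = mmap f2 h2 p.
Proof.
move=> ef eh; apply: eq_bigr => mu _; rewrite ef; congr (_ * _).
by apply: eq_bigr => i _; rewrite eh.
Qed.

Variables (R : comNzRingType).
Implicit Types (P : pred 'X_{1..N}) (p : {mpoly R[N]}).

Definition mrestrict P p : {mpoly R[N]} :=
  \sum_(mu <- msupp p | P mu) p@_mu *: 'X_[mu].

Lemma mcoeff_restrict P p mu :
  (mrestrict P p)@_mu = if P mu then p@_mu else 0.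
Proof.
rewrite /mrestrict raddf_sum /= big_mkcond /=.
have [hm|hm] := boolP (mu \in msupp p); last first.
  rewrite big_seq big1 => [|nu hnu].
    by rewrite (memN_msupp_eq0 hm) if_same.
  case: ifP => // _; rewrite mcoeffZ mcoeffX.
  by case: eqP => [e|]; [rewrite -e hnu in hm|rewrite mulr0].
rewrite (bigD1_seq mu) ?msupp_uniq //= big1 => [|nu ne].
  by rewrite addr0; case: ifP => // _; rewrite mcoeffZ mcoeffX eqxx mulr1.
by case: ifP => // _; rewrite mcoeffZ mcoeffX (negbTE ne) mulr0.
Qed.

Lemma mmap_restrict (S : comNzRingType) (phi : {rmorphism R -> S})
    (h : 'I_N -> S) P p :
  mmap phi h (mrestrict P p) =
  \sum_(mu <- msupp p | P mu) phi p@_mu * mmap1 h mu.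
Proof.
rewrite /mrestrict raddf_sum /=; apply: eq_bigr => mu _.
by rewrite mmapZ mmapX.
Qed.

(* Scaling the variables by powers of ['X] isolates the part of least weight. *)
Lemma coef_mmap_lowest (S : comNzRingType) (phi : {rmorphism R -> S})
    (w : 'I_N -> nat) (h q : 'I_N -> {poly S}) (a : 'I_N -> S) (e : nat) p :
  (forall k, h k = 'X^(w k) * q k) -> (forall k, (q k)`_0 = a k) ->
  {in msupp p, forall mu, (e <= wt w mu)%N} ->
  (mmap (polyC \o phi) h p)`_e = mmap phi a (mrestrict (fun mu => wt w mu == e) p).
Proof.
move=> hE qE hw; rewrite mmap_restrict /mmap coef_sum [RHS]big_mkcond /=.
rewrite !big_seq; apply: eq_bigr => mu hmu; rewrite coefCM.
have -> : mmap1 h mu = 'X^(wt w mu) * \prod_i q i ^+ mu i.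
  rewrite /mmap1 /wt -prodrXr -big_split; apply: eq_bigr => i _ /=.
  by rewrite hE exprMn -exprM mulnC.
rewrite coefXnM; case: ltngtP (hw _ hmu) => // [lt|->] _; first by rewrite mulr0.
rewrite subnn; congr (_ * _); rewrite -horner_coef0 horner_prod.
by apply: eq_bigr => i _; rewrite horner_exp horner_coef0 qE.
Qed.

End Evaluation.

Section Points.
Variables (K : fieldType) (m n : nat) (gamma : m.-tuple 'I_n).
Let N := #|vars gamma|.
Implicit Types (f : {mpoly K[N]}).

Definition point (S : comNzRingType) (W0 : 'M[S]_m) (U0 : 'M[S]_(m, n)) :
    'I_N -> S := fun k => match enum_val k with
  | inl p => W0 p.1 p.2 | inr u => U0 (val u).1 (val u).2 end.

(** The matrices to which [U] may be specialized. *)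
Definition staircase (S : comNzRingType) (U0 : 'M[S]_(m, n)) : Prop :=
  forall (i : 'I_m) (j : 'I_n), (j < tnth gamma i)%N -> U0 i j = 0.

Section OnePoint.
Variables (S : comNzRingType) (phi : {rmorphism K -> S}).
Variables (W0 : 'M[S]_m) (U0 : 'M[S]_(m, n)).
Let ev := mmap phi (point W0 U0).

Lemma mmap_var (v : vars gamma) : ev (var K v) = point W0 U0 (enum_rank v).
Proof. by rewrite /ev mmapX mmap1U. Qed.

Lemma map_Wmx : map_mx ev (Wmx gamma K) = W0.
Proof.
by apply/matrixP => i j; rewrite !mxE mmap_var /point enum_rankK.
Qed.

Lemma map_Umx : staircase U0 -> map_mx ev (Umx gamma K) = U0.
Proof.
move=> sU; apply/matrixP => i j; rewrite !mxE.
case: insubP => [u _ eu|] /=.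
  by rewrite mmap_var /point enum_rankK eu.
by rewrite -ltnNge /= => h; rewrite /ev raddf0 sU.
Qed.

Lemma map_Zmx : staircase U0 -> map_mx ev (Zmx gamma K) = W0 *m U0.
Proof. by move=> sU; rewrite map_mxM /= map_Wmx map_Umx. Qed.

End OnePoint.

(** A polynomial in [m * n] free variables, so that elements of [K[Z]] can be evaluated at an
    arbitrary matrix; the representing [F] need not be unique. *)
Definition coordinate_polynomial (F : {mpoly K[#|{: 'I_m * 'I_n}|]})
    (S : comNzRingType) (phi : K -> S) (Z0 : 'M[S]_(m, n)) : S :=
  mmap phi (fun k => Z0 (enum_val k).1 (enum_val k).2) F.

Lemma subalg_Zmx f : subalg (entries (Zmx gamma K)) f ->
  exists F, f = coordinate_polynomial F (@mpolyC N K) (Zmx gamma K).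
Proof.
pose ev := mmap (@mpolyC N K)
  (fun k : 'I_#|{: 'I_m * 'I_n}| => Zmx gamma K (enum_val k).1 (enum_val k).2).
change (subalg (entries (Zmx gamma K)) f -> exists F, f = ev F).
elim=> {f} [f [i [j ->]]||f g _ [F ->] _ [G ->]|f g _ [F ->] _ [G ->]|a f _ [F ->]].
- by exists 'X_(enum_rank (i, j)); rewrite /ev mmapX mmap1U enum_rankK.
- by exists 1; rewrite /ev rmorph1.
- by exists (F + G); rewrite /ev raddfD.
- by exists (F * G); rewrite /ev rmorphM.
- by exists (a *: F); rewrite /ev mmapZ mul_mpolyC.
Qed.

Lemma mmap_coordinate_polynomial F (S : comNzRingType) (phi : {rmorphism K -> S})
    (W0 : 'M[S]_m) (U0 : 'M[S]_(m, n)) : staircase U0 ->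
  mmap phi (point W0 U0) (coordinate_polynomial F (@mpolyC N K) (Zmx gamma K)) =
  coordinate_polynomial F phi (W0 *m U0).
Proof.
move=> sU; rewrite -(map_Zmx phi W0 sU).
pose ev := mmap phi (point W0 U0).
pose zz := mmap (@mpolyC N K)
  (fun k : 'I_#|{: 'I_m * 'I_n}| => Zmx gamma K (enum_val k).1 (enum_val k).2).
rewrite -/ev /coordinate_polynomial -/zz.
rewrite -[LHS]/((ev \o zz) F) [LHS]rmorph_mmap; apply: eq_mmap => [a|k] /=.
  by rewrite /zz mmapC /ev mmapC.
by rewrite mxE /zz mmapX mmap1U.
Qed.

(** Both sides are the value of one representing polynomial at the common product. *)
Lemma eval_subalg_Zmx f (S : comNzRingType) (phi : {rmorphism K -> S})
    (W1 W2 : 'M[S]_m) (U1 U2 : 'M[S]_(m, n)) :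
  subalg (entries (Zmx gamma K)) f -> staircase U1 -> staircase U2 ->
  W1 *m U1 = W2 *m U2 ->
  mmap phi (point W1 U1) f = mmap phi (point W2 U2) f.
Proof.
case/subalg_Zmx => F -> s1 s2 e.
by rewrite !mmap_coordinate_polynomial // e.
Qed.

Variable G : forall B : comNzRingType, set 'M[B]_m.

Lemma abs_invariants_act f (S : comNzRingType) (phi : {rmorphism K -> S})
    (g : 'M[S]_m) : abs_invariants gamma K G f -> @G (algebra_of phi) g ->
  act g (map_mpoly phi f) = map_mpoly phi f.
Proof.
move=> [_ hf] Gg; have := hf (algebra_of phi) g Gg; rewrite /ext_scalars.
have -> : map_mpoly (in_alg (algebra_of phi)) f =
    map_mpoly (phi : K -> algebra_of phi) f.
  by apply: eq_mmap => // a; apply: congr1 (algebra_of_in_alg phi a).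
exact.
Qed.

(** Invariance over [S] is specialized along [psi]. In the application the group element lives over
    a field, while [U0] has polynomial entries over it. *)
Lemma abs_invariants_eval f (S S' : comNzRingType) (phi : {rmorphism K -> S})
    (psi : {rmorphism S -> S'}) (g : 'M[S]_m) (W0 : 'M[S']_m) (U0 : 'M[S']_(m, n)) :
  abs_invariants gamma K G f -> @G (algebra_of phi) g ->
  mmap (psi \o phi) (point (map_mx psi g *m W0) U0) f =
  mmap (psi \o phi) (point W0 U0) f.
Proof.
move=> hf Gg; have := congr1 (mmap psi (point W0 U0)) (abs_invariants_act hf Gg).
have mapE : mmap psi (point W0 U0) (map_mpoly phi f) =
    mmap (psi \o phi) (point W0 U0) f.
  pose ev := mmap psi (point W0 U0).
  rewrite -[LHS]/((ev \o map_mpoly phi) f) [LHS]rmorph_mmap.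
  apply: eq_mmap => [a|k] /=.
    by rewrite map_mpolyC /ev mmapC.
  by rewrite map_mpolyX /ev mmapX mmap1U.
rewrite mapE => <-; rewrite /act.
set lq := [tuple _ | k < _].
pose ev := mmap psi (point W0 U0).
rewrite -[RHS]/((ev \o comp_mpoly lq \o map_mpoly phi) f) [RHS]rmorph_mmap.
apply: eq_mmap => [a|k] /=.
  by rewrite map_mpolyC comp_mpolyC /ev mmapC.
rewrite map_mpolyX comp_mpolyXU -tnth_nth tnth_mktuple /point.
case: (enum_val k) => [p|u]; last by rewrite /ev mmapX mmap1U /point enum_rankK.
rewrite mxE [in RHS]mxE rmorph_sum; apply: eq_bigr => l _ /=.
rewrite rmorphM /= !mxE /ev mmapC; congr (_ * _).
by rewrite /var mmapX mmap1U /point enum_rankK.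
Qed.

End Points.

(** * Monomials of invariants *)

Section InvolutionRing.
Variable K : fieldType.

Let h : {poly K} := 'X^2 - 1%:P.

(* [K[e]/(e^2 - 1)]: the coordinate ring of the group scheme of square roots of
   unity, which is not reduced in characteristic two. *)
Definition involution_ring : comNzRingType := {poly %/ h}.
Definition involution : involution_ring := in_qpoly h 'X.
Definition involution_const : {rmorphism K -> involution_ring} := qpolyC h.

Let hmonic : h \is monic. Proof. exact: monicXnsubC. Qed.
Let hsize : size h = 3%N. Proof. exact: size_XnsubC. Qed.
Let hE : mk_monic h = h. Proof. by rewrite /mk_monic hsize hmonic. Qed.

Lemma involution_sqr : involution ^+ 2 = 1.
Proof.
rewrite expr2 /involution -in_qpolyM.
have -> : 'X * 'X = h + 1 :> {poly K} by rewrite /h subrK expr2.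
rewrite in_qpolyD in_qpoly1 (_ : in_qpoly h h = 0) ?add0r //.
by apply: val_inj; rewrite /= hE Pdiv.RingMonic.rmodpp.
Qed.

(** [1] and the involution are linearly independent, as the coefficients of ['X] show. *)
Lemma involution_free c : involution_const c * involution = involution_const c ->
  c = 0.
Proof.
have -> : involution_const c * involution = c *: involution.
  have -> : involution_const c = c *: 1 :> {poly %/ h}.
    by apply: val_inj; rewrite /= -mul_polyC mulr1.
  by rewrite -scalerAl mul1r.
move/(congr1 (fun q : {poly %/ h} => (q : {poly K})`_1)).
have -> : ((c *: involution : {poly %/ h}) : {poly K}) = c *: 'X.
  by rewrite /= hE Pdiv.CommonRing.rmodp_small // hsize size_polyX.
by rewrite coefZ coefX mulr1 /= coefC.
Qed.

Lemma involution_exp_even c k :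
  involution_const c * involution ^+ k = involution_const c -> c != 0 -> ~~ odd k.
Proof.
move=> e; apply: contra => ok; apply/eqP/involution_free.
move: e; rewrite -{1}(odd_double_half k) ok exprD expr1 -mul2n exprM.
by rewrite involution_sqr expr1n mulr1.
Qed.

End InvolutionRing.

Section Invariants.
Variables (K : fieldType) (m n : nat) (gamma : m.-tuple 'I_n).
Let N := #|vars gamma|.
Implicit Types (f : {mpoly K[N]}) (mu : 'X_{1..N}).

Definition W_weight (b : 'I_m -> 'I_m -> nat) (k : 'I_N) : nat :=
  match enum_val k with inl p => b p.1 p.2 | inr _ => 0%N end.

Definition U_weight (b : 'I_m -> 'I_n -> nat) (k : 'I_N) : nat :=
  match enum_val k with inl _ => 0%N | inr u => b (val u).1 (val u).2 end.

Section Parity.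
Variable G : forall B : comNzRingType, set 'M[B]_m.

(** The diagonal element multiplies a monomial of weight [k] by the [k]-th power of the involution,
    which can fix a nonzero coefficient only if [k] is even. *)
Lemma parity_of_invariant f (b : 'I_m -> nat) :
  abs_invariants gamma K G f ->
  @G (algebra_of (involution_const K))
    (diag_mx (\row_i involution K ^+ b i) : 'M[involution_ring K]_m) ->
  {in msupp f, forall mu, ~~ odd (wt (W_weight (fun i _ => b i)) mu)}.
Proof.
set phi := involution_const K; set g := diag_mx _ => hf Gg mu hmu.
have := congr1 (mcoeff mu) (abs_invariants_act hf Gg).
pose w := W_weight (fun i _ => b i).
have -> : act g (map_mpoly phi f) =
    \sum_(nu <- msupp f) (phi f@_nu * involution K ^+ wt w nu) *: 'X_[nu].
  rewrite /act; set lq := [tuple _ | k < _].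
  have lqE k : tnth lq k = involution K ^+ w k *: 'X_k.
    rewrite tnth_mktuple /w /W_weight; case ek: (enum_val k) => [[i j]|u] /=.
      rewrite mxE (bigD1 i) //= big1 ?addr0 => [|l li]; last first.
        by rewrite !mxE eq_sym (negbTE li) mulr0n mpolyC0 mul0r.
      rewrite !mxE eqxx mulr1n mul_mpolyC /var; congr (_ *: 'X_[U_(_)]).
      by rewrite -ek enum_valK.
    by rewrite scale1r /var -ek enum_valK.
  rewrite -[LHS]/((comp_mpoly lq \o map_mpoly phi) f) {1}[f]mpolyE rmorph_sum.
  apply: eq_bigr => nu _ /=.
  rewrite map_mpolyZ comp_mpolyZ -scalerA; congr (_ *: _).
  rewrite map_mpolyX comp_mpolyX [in RHS]mpolyXE_id /wt -prodrXr.
  rewrite -mul_mpolyC rmorph_prod -big_split; apply: eq_bigr => i _ /=.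
  by rewrite lqE -mul_mpolyC exprMn -rmorphXn /= -exprM mulnC.
rewrite raddf_sum /= mcoeff_map_mpoly (bigD1_seq mu) ?msupp_uniq //=.
rewrite big1 => [|nu ne]; last by rewrite mcoeffZ mcoeffX (negbTE ne) mulr0.
rewrite addr0 mcoeffZ mcoeffX eqxx mulr1 => /involution_exp_even; apply.
by rewrite -mcoeff_msupp.
Qed.

End Parity.

Lemma involution_diag_SOrth (b : 'I_m -> nat) :
  Orth m (involution_ring K) (diag_mx (\row_i involution K ^+ b i)).
Proof.
set g := diag_mx _.
have gg : g *m g = 1%:M.
  rewrite mulmx_diag; apply/matrixP => i j; rewrite !mxE -expr2 -exprM.
  by rewrite mulnC exprM involution_sqr expr1n.
by split; [exists g | rewrite tr_diag_mx].
Qed.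

Lemma Orth_parity f i : abs_invariants gamma K (Orth m) f ->
  {in msupp f, forall mu, ~~ odd (wt (W_weight (fun i' _ => i' == i : nat)) mu)}.
Proof.
move=> hf; apply: (parity_of_invariant (b := fun i' => i' == i : nat) hf).
exact: (involution_diag_SOrth (fun i' => i' == i : nat)).
Qed.

Lemma SOrth_parity f i j : abs_invariants gamma K (SOrth m) f ->
  {in msupp f, forall mu,
    odd (wt (W_weight (fun i' _ => i' == i : nat)) mu) =
    odd (wt (W_weight (fun i' _ => i' == j : nat)) mu)}.
Proof.
(* The involution in places [i] and [j] has determinant [involution ^+ 2 = 1]; for [i = j] the two
   factors meet in one place and give the identity. *)
move=> hf mu hmu; pose b i' := ((i' == i) + (i' == j))%N.
have sumb : (\sum_i' b i' = 2)%N.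
  by rewrite big_split /= (bigD1 i) //= [X in (_ + X)%N](bigD1 j) //= !eqxx
    !big1 // => l /negbTE->.
have Gg : SOrth m (algebra_of (involution_const K))
    (diag_mx (\row_i involution K ^+ b i) : 'M[involution_ring K]_m).
  have : SOrth m (involution_ring K) (diag_mx (\row_i involution K ^+ b i)).
    split; first exact: involution_diag_SOrth.
    rewrite det_diag; under eq_bigr do rewrite mxE.
    by rewrite prodrXr sumb involution_sqr.
  exact.
have := parity_of_invariant hf Gg hmu.
rewrite (@eq_wt _ _ (fun k => (W_weight (fun i' _ => i' == i : nat) k +
  W_weight (fun i' _ => i' == j : nat) k)%N)).
  by rewrite wt_addw oddD; case: odd; case: odd.
by move=> k; rewrite /W_weight; case: enum_val.
Qed.

Section DiagonalMonomial.
Variable G : forall B : comNzRingType, set 'M[B]_m.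
Hypothesis SG : forall (B : comNzRingType) (g : 'M[B]_m), SOrth m B g -> @G B g.
Hypotheses (m0 : (0 < m)%N) (gammaP : Gamma gamma).

Lemma gamma_lt (i j : 'I_m) : (i < j)%N -> (tnth gamma i < tnth gamma j)%N.
Proof. by case/andP: gammaP => _ /increasingP h; apply: h. Qed.

Local Notation tofrac := (@FracField.tofrac {mpoly K[N]}).
Local Notation "x %:F" := (tofrac x).

Let one_pt : 'I_N -> K := point (1%:M : 'M[K]_m) (0 : 'M[K]_(m, n)).
Let chi : {rmorphism {mpoly K[N]} -> K} := meval one_pt.

(* Fractions defined and vanishing at the point [W = 1], [U = 0]. *)
Let J (x : {fraction {mpoly K[N]}}) : Prop :=
  exists p q : {mpoly K[N]}, [/\ chi p = 0, chi q != 0 & x = p%:F / q%:F].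

Let frac_neq0 (q : {mpoly K[N]}) : chi q != 0 -> q%:F != 0.
Proof. by apply: contra; rewrite tofrac_eq0 => /eqP->; rewrite rmorph0. Qed.

Let JP : pivot_ideal J.
Proof.
split.
- by exists 0, 1; rewrite rmorph0 rmorph1 oner_neq0 tofrac0 mul0r.
- move=> _ _ [p [q [p0 q0 ->]]] [p' [q' [p0' q0' ->]]].
  exists (p * q' + p' * q), (q * q'); split.
  + by rewrite rmorphD !rmorphM p0 p0' !mul0r addr0.
  + by rewrite rmorphM mulf_neq0.
  + by rewrite tofracD !tofracM addf_div ?frac_neq0.
- move=> _ [p [q [p0 q0 ->]]]; exists (- p), q; split=> //.
    by rewrite rmorphN p0 oppr0.
  by rewrite tofracN mulNr.
- move=> _ _ [p [q [p0 q0 ->]]] [p' [q' [p0' q0' ->]]].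
  exists (p * p'), (q * q'); split.
  + by rewrite rmorphM p0 mul0r.
  + by rewrite rmorphM mulf_neq0.
  + by rewrite !tofracM mulf_div.
- move=> _ [p [q [p0 q0 ->]]].
  have qp0 : chi (q + p) != 0 by rewrite rmorphD p0 addr0.
  have E : 1 + p%:F / q%:F = (q + p)%:F / q%:F.
    by rewrite tofracD mulrDl divff ?frac_neq0.
  rewrite E; split; first by rewrite mulf_neq0 ?invr_eq0 ?frac_neq0.
  exists (- p), (q + p); split=> //; first by rewrite rmorphN p0 oppr0.
  rewrite invf_div -[X in _ - X](@divff _ (q + p)%:F) ?frac_neq0 // -mulrBl.
  by rewrite -tofracB opprD addrA subrr add0r.
Qed.

(** Row [i] of [U] is scaled by ['X^i]. As [h] is upper unitriangular, row [i] of [h U] becomes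
    ['X^i] times row [i] of [U] plus higher powers, so the coefficients of least order give
    [f_e(W, U) = f_e(D, U)] for the part [f_e] of least [U]-weight [e]. The left side is nonzero,
    hence some monomial of [f_e] survives at a diagonal [W]. *)
Lemma diagonal_lowest_monomial f :
  abs_invariants gamma K G f -> f != 0 ->
  exists mu, [/\ mu \in msupp f,
     forall i j, i != j -> mu (enum_rank (inl (i, j) : vars gamma)) = 0%N
   & {in msupp f, forall nu,
       (wt (U_weight (fun i _ => i)) mu <= wt (U_weight (fun i _ => i)) nu)%N}].
Proof.
move=> hf f0; pose w := U_weight (fun i _ => i : nat).
pose Q k := has (fun mu => wt w mu == k) (msupp f).
have exQ : exists k, Q k.
  case E: (msupp f) => [|mu s]; first by move: f0; rewrite -msupp_eq0 E.
  by exists (wt w mu); rewrite /Q E /= eqxx.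
case: (ex_minnP exQ) => e /hasP[mu1 mu1f /eqP mu1e] mine.
have lee : {in msupp f, forall nu, (e <= wt w nu)%N}.
  by move=> nu hnu; apply: mine; apply/hasP; exists nu.
pose W0 := map_mx (tofrac) (Wmx gamma K).
have oneW : near_one J W0.
  move=> i j; exists (Wmx gamma K i j - (i == j)%:R), 1; split.
  - rewrite rmorphB rmorph_nat mxE /= mevalXU /one_pt /point enum_rankK mxE.
    exact: subrr.
  - by rewrite rmorph1 oner_neq0.
  - by rewrite mxE tofrac1 divr1 rmorphB rmorph_nat.
have [L [phi [g [h [t [gO gdet [hu h1] gW]]]]]] := orthogonal_triangular JP m0 oneW.
pose iota : {rmorphism {mpoly K[N]} -> L} := phi \o tofrac.
pose phiK : {rmorphism K -> L} := iota \o @mpolyC N K.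
pose W1 := map_mx iota (Wmx gamma K); pose U1 := map_mx iota (Umx gamma K).
have W1E : map_mx phi W0 = W1 by rewrite /W1 /W0 -map_mx_comp.
pose D := diag_mx t; pose psi : {rmorphism L -> {poly L}} := polyC.
pose Ut : 'M[{poly L}]_(m, n) := \matrix_(i, j) ('X^i * (U1 i j)%:P).
have U1s : staircase gamma U1.
  move=> i j ij; rewrite !mxE insubF ?raddf0 //=.
  by rewrite leqNgt ij.
have Uts : staircase gamma Ut by move=> i j ij; rewrite mxE U1s // polyC0 mulr0.
(* Upper triangular matrices preserve the zero pattern because [gamma] increases. *)
have hUts : staircase gamma (map_mx psi h *m Ut).
  move=> i j ij; rewrite mxE big1 // => l _.
  case: (ltnP l i) => li; first by rewrite mxE hu // rmorph0 mul0r.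
  rewrite Uts ?mulr0 //; apply: leq_trans ij _.
  by move: li; rewrite leq_eqVlt => /predU1P[/val_inj->//|/gamma_lt/ltnW].
have Gg : @G (algebra_of phiK) g.
  apply: SG; have : SOrth m L g.
    split=> //; split=> //; exists g^T; split=> //.
    exact: mulmx1C.
  exact.
have E := abs_invariants_eval psi (map_mx psi W1) Ut hf Gg.
have E2 : map_mx psi g *m map_mx psi W1 = map_mx psi D *m map_mx psi h.
  by rewrite -!map_mxM -W1E gW.
have := eval_subalg_Zmx (psi \o phiK) (W1 := map_mx psi g *m map_mx psi W1)
  (W2 := map_mx psi D) (U1 := Ut) (U2 := map_mx psi h *m Ut) (proj1 hf) Uts hUts.
rewrite E E2 mulmxA => /(_ erefl)/(congr1 (fun p : {poly L} => p`_e)).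
pose a1 := point W1 U1 (gamma := gamma); pose a2 := point D U1 (gamma := gamma).
rewrite (coef_mmap_lowest phiK (w := w) (q := fun k => (a1 k)%:P) (a := a1)) //; first last.
- by move=> k; rewrite coefC.
- move=> k; rewrite /point /w /U_weight /a1 /point; case: (enum_val k) => [p|u].
    by rewrite expr0 mul1r mxE.
  by rewrite mxE.
(* Row [i] of [h Ut] divided by ['X^i]; its constant term is [U1 i j]. *)
pose q2 (i : 'I_m) (j : 'I_n) : {poly L} :=
  \sum_(l < m | (i <= l)%N) (h i l * U1 l j) *: 'X^(l - i).
rewrite (coef_mmap_lowest phiK (w := w) (q := fun k => match enum_val k with
   | inl p => (D p.1 p.2)%:P | inr u => q2 (val u).1 (val u).2 end) (a := a2)) //;
  first last.
- move=> k; rewrite /a2 /point; case: (enum_val k) => [p|u]; first by rewrite coefC.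
  rewrite /q2 coef_sum (bigD1 (val u).1) //= coefZ subnn coefXn mulr1 h1 mul1r.
  rewrite big1 ?addr0 // => l /andP[le ne]; rewrite coefZ coefXn.
  have -> : (0 == l - (val u).1)%N = false; last by rewrite mulr0.
  apply/negbTE; rewrite eq_sym subn_eq0 -ltnNge ltn_neqAle le andbT.
  by rewrite eq_sym.
- move=> k; rewrite /point /w /U_weight; case: (enum_val k) => [p|u].
    by rewrite expr0 mul1r mxE.
  rewrite mxE /q2 big_distrr [LHS](bigID (fun l : 'I_m => ((val u).1 <= l)%N)) /=.
  rewrite [X in _ + X]big1 ?addr0 => [|l]; last first.
    by rewrite -ltnNge => li; rewrite mxE hu // rmorph0 mul0r.
  apply: eq_bigr => l li; rewrite !mxE /= -mul_polyC polyCM.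
  by rewrite mulrCA -{1}(subnKC li) exprD; ring.
(* The point [(W1, U1)] is generic: evaluation there is the injection [iota] of the polynomial ring
   into [L]. *)
have nz : mmap phiK a1 (mrestrict (fun nu => wt w nu == e) f) != 0.
  have -> : mmap phiK a1 (mrestrict (fun nu => wt w nu == e) f) =
      iota (mrestrict (fun nu => wt w nu == e) f).
    rewrite [RHS]rmorph_mmap; apply: eq_mmap => // k.
    rewrite /a1 /point; case ek: (enum_val k) => [[i j]|u].
      by rewrite !mxE /var -ek enum_valK.
    rewrite !mxE; case: insubP => [v _ ev|/negP[]]; last exact: (valP u).
    have -> : v = u by apply: val_inj; rewrite ev; case: (val u).
    by rewrite /= /var -ek enum_valK.
  rewrite fmorph_eq0 tofrac_eq0; apply/negP => /eqP/(congr1 (mcoeff mu1))/eqP.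
  by rewrite mcoeff_restrict mu1e eqxx mcoeff0 -[_ == 0]negbK -mcoeff_msupp mu1f.
move=> E3; move: nz; rewrite E3 mmap_restrict => nz.
have [mu /and3P[muf /eqP mue mu2]] : exists mu,
    [&& mu \in msupp f, wt w mu == e & mmap1 a2 mu != 0].
  apply/not_existsP => h0; move/eqP: nz; apply.
  rewrite big_seq_cond big1 // => mu /andP[muf mue].
  have := h0 mu; rewrite muf mue /= => /negP; rewrite negbK => /eqP->.
  by rewrite mulr0.
exists mu; split=> //; last by move=> nu hnu; rewrite -/w mue lee.
move=> i j ij; apply/eqP; move/prodf_neq0: mu2.
move/(_ (enum_rank (inl (i, j) : vars gamma)) isT).
rewrite /a2 /point enum_rankK /= mxE (negbTE ij) mulr0n expr0n.
by case: (mu _ == 0%N); rewrite ?eqxx.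
Qed.

End DiagonalMonomial.
End Invariants.

Lemma eq_sum_leq (I : finType) (F G : I -> nat) :
  (forall i, F i <= G i)%N -> (\sum_i G i <= \sum_i F i)%N -> forall i, F i = G i.
Proof.
move=> FG GF i; apply/eqP; rewrite eqn_leq FG /=.
move: GF; rewrite (bigD1 i) //= [leqRHS](bigD1 i) //=.
have : (\sum_(j | j != i) F j <= \sum_(j | j != i) G j)%N by apply: leq_sum.
lia.
Qed.

(* Moving mass towards smaller indices across [c0] cannot raise the first moment. *)
Lemma moment_rigidity n (a a' : 'I_n -> nat) (c0 : 'I_n) :
  (\sum_c a c = \sum_c a' c)%N ->
  (forall c : 'I_n, (c < c0)%N -> (a c <= a' c)%N) ->
  (forall c : 'I_n, (c0 < c)%N -> (a' c <= a c)%N) ->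
  (\sum_c a c * c <= \sum_c a' c * c)%N -> forall c, a c = a' c.
Proof.
move=> e lo hi mom.
(* Termwise [(a c - a' c) (c - c0) >= 0], here written without subtraction, while the sum is at most
   [0] by the moment hypothesis; so every term vanishes. *)
have h c : (a' c * c + a c * c0 = a c * c + a' c * c0)%N.
  apply: (eq_sum_leq (F := fun c : 'I_n => (a' c * c + a c * c0)%N)
                     (G := fun c : 'I_n => (a c * c + a' c * c0)%N)).
    by move=> d; case: (ltngtP d c0) => dc; [have := lo d dc|have := hi d dc|rewrite dc]; nia.
  by rewrite !big_split /= -!big_distrl /= e leq_add2r.
have ne c : c != c0 -> a c = a' c.
  have key x y p q : (x <= y)%N -> (p < q)%N ->
      (y * p + x * q = x * p + y * q)%N -> x = y.
    by move=> /subnKC<- /subnKC<-; set d := (y - x)%N; set d' := (q - _)%N; nia.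
  rewrite neq_ltn => /orP[cc|cc]; first exact: key (lo c cc) cc (h c).
  by apply/esym; apply: key (hi c cc) cc _; rewrite addnC h addnC.
move=> c; have [->|/ne//] := eqVneq c c0.
move: e; rewrite (bigD1 c0) //= [RHS](bigD1 c0) //= (eq_bigr a') => [|d /ne//].
by move/addIn.
Qed.

Lemma seq_argmax (T : eqType) (s : seq T) (F : T -> nat) x : x \in s ->
  exists2 y, y \in s & {in s, forall z, (F z <= F y)%N}.
Proof.
elim: s x => // a [|b s] IHs x xs.
  by exists a; rewrite ?mem_head // => z; rewrite inE => /eqP->.
have [y ys ymax] := IHs b (mem_head _ _).
case: (leqP (F a) (F y)) => h.
  exists y; first by rewrite inE ys orbT.
  by move=> z; rewrite inE => /predU1P[->//|/ymax].
exists a; first exact: mem_head.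
move=> z; rewrite inE => /predU1P[->//|/ymax/leq_trans]; apply; exact: ltnW.
Qed.

(** * Exponents of monomials as matrices *)

Section Degrees.
Variables (m n : nat) (gamma : m.-tuple 'I_n).
Let N := #|vars gamma|.
Implicit Types mu nu : 'X_{1..N}.
Local Notation on_W := (W_weight (gamma := gamma)).
Local Notation on_U := (U_weight (gamma := gamma)).
Local Notation wmon := (@Wvarmon m n gamma).
Local Notation umon := (@Uvarmon m n gamma).

Definition wexp mu (i j : 'I_m) : nat := mu (enum_rank (inl (i, j) : vars gamma)).

(** The default [0] outside the staircase makes every [udeg mu] a filling that fits [gamma]. *)
Definition udeg mu (i : 'I_m) (j : 'I_n) : nat :=
  oapp (fun u : Uidx gamma => mu (enum_rank (inr u : vars gamma))) 0%N (insub (i, j)).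

Lemma udeg_fits mu : fits gamma (udeg mu).
Proof. by move=> i j; rewrite /udeg; case: insubP. Qed.

Lemma sum_vars (F : 'I_N -> nat) :
  (\sum_k F k = \sum_i \sum_j F (enum_rank (inl (i, j) : vars gamma)) +
   \sum_i \sum_j oapp (fun u : Uidx gamma => F (enum_rank (inr u : vars gamma)))
                      0 (insub (i, j)))%N.
Proof.
rewrite (reindex (@enum_rank (vars gamma))) /=; last first.
  by apply: onW_bij; apply: enum_rank_bij.
rewrite big_sumType /=; congr addn.
  by rewrite pair_bigA; apply: eq_bigr; case.
rewrite pair_bigA /= [RHS](bigID (fun p : 'I_m * 'I_n => (tnth gamma p.1 <= p.2)%N)) /=.
rewrite [X in (_ = _ + X)%N]big1 ?addn0 => [|[i j] /= h]; last by rewrite insubF ?(negbTE h).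
rewrite [RHS](reindex_omap (val : Uidx gamma -> _) insub) /=; last first.
  by move=> [i j] /= h; rewrite insubT.
apply: eq_big => [u|u _]; first by rewrite valK eqxx (valP u).
by rewrite -surjective_pairing valK.
Qed.

Lemma wt_on_W b mu : wt (on_W b) mu = (\sum_i \sum_j wexp mu i j * b i j)%N.
Proof.
rewrite /wt sum_vars [X in (_ + X)%N]big1 ?addn0 => [|i _]; last first.
  rewrite big1 // => j _; case: insub => [u|] //=.
  by rewrite /on_W enum_rankK muln0.
by apply: eq_bigr => i _; apply: eq_bigr => j _; rewrite /on_W enum_rankK.
Qed.

Lemma wt_on_U b mu : wt (on_U b) mu = (\sum_i \sum_j udeg mu i j * b i j)%N.
Proof.
rewrite /wt sum_vars [X in (X + _)%N]big1 ?add0n => [|i _]; last first.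
  by rewrite big1 // => j _; rewrite /on_U enum_rankK muln0.
apply: eq_bigr => i _; apply: eq_bigr => j _; rewrite /udeg.
case: insubP => [u _ eu|_] //=.
by rewrite /on_U enum_rankK eu.
Qed.

Lemma sum_delta (I J : finType) (F : I -> J -> nat) a b :
  (\sum_i \sum_j F i j * ((i == a) && (j == b)) = F a b)%N.
Proof.
rewrite (bigD1 a) //= [X in (_ + X)%N]big1 ?addn0 => [|i /negbTE ia].
  rewrite (bigD1 b) //= !eqxx muln1 big1 ?addn0 // => j /negbTE->.
  by rewrite andbF muln0.
by rewrite big1 // => j _; rewrite ia muln0.
Qed.

Lemma sum_row (I J : finType) (F : I -> J -> nat) a :
  (\sum_i \sum_j F i j * (i == a) = \sum_j F a j)%N.
Proof.
rewrite (bigD1 a) //= [X in (_ + X)%N]big1 ?addn0 => [|i /negbTE ia].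
  by apply: eq_bigr => j _; rewrite eqxx muln1.
by rewrite big1 // => j _; rewrite ia muln0.
Qed.

Lemma degrees_inj mu nu : (forall i j, wexp mu i j = wexp nu i j) ->
  (forall i j, udeg mu i j = udeg nu i j) -> mu = nu.
Proof.
move=> hW hU; apply/mnmP => k; rewrite -(enum_valK k).
case: (enum_val k) => [[i j]|u]; first exact: hW.
have := hU (val u).1 (val u).2; rewrite /udeg -surjective_pairing valK.
exact.
Qed.

Lemma wt_on_W_wmon b i j : wt (on_W b) (wmon i j) = b i j.
Proof. by rewrite wtU /on_W enum_rankK. Qed.

Lemma wt_on_U_wmon b i j : wt (on_U b) (wmon i j) = 0%N.
Proof. by rewrite wtU /on_U enum_rankK. Qed.

Lemma wt_on_W_umon b i j : wt (on_W b) (umon i j) = 0%N.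
Proof.
rewrite /Uvarmon; case: insubP => [u _ _|_] /=; last exact: wt0.
by rewrite wtU /on_W enum_rankK.
Qed.

Lemma wt_on_U_umon b (i : 'I_m) (j : 'I_n) : (tnth gamma i <= j)%N ->
  wt (on_U b) (umon i j) = b i j.
Proof.
by move=> h; rewrite /Uvarmon insubT /= wtU /on_U enum_rankK.
Qed.

Lemma umon_val (u : Uidx gamma) :
  umon (val u).1 (val u).2 = U_(enum_rank (inr u : vars gamma))%MM.
Proof. by rewrite /Uvarmon -surjective_pairing valK. Qed.

Lemma tableau_monomial_degrees mu : (forall i j, i != j -> wexp mu i j = 0%N) ->
  (forall i, wexp mu i i = rowsum (udeg mu) i) ->
  tableau_monomial gamma (udeg mu) = mu.
Proof.
move=> off dia.
have h (w : 'I_N -> nat) : wt w (tableau_monomial gamma (udeg mu)) =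
    (\sum_i rowsum (udeg mu) i * wt w (wmon i i) +
     \sum_i \sum_j udeg mu i j * wt w (umon i j))%N.
  rewrite wtD !wt_sum; congr addn; apply: eq_bigr => i _; first by rewrite wtMn.
  by rewrite wt_sum; apply: eq_bigr => j _; rewrite wtMn.
apply: degrees_inj => i j.
  have := h (on_W (fun a b => (a == i) && (b == j) : nat)).
  rewrite wt_on_W sum_delta => ->.
  rewrite [X in (_ + X)%N]big1 ?addn0 => [|a _]; last first.
    by rewrite big1 // => b _; rewrite wt_on_W_umon muln0.
  under eq_bigr => a _ do rewrite wt_on_W_wmon.
  rewrite (bigD1 i) //= eqxx big1 ?addn0 => [|a /negbTE->]; last by rewrite muln0.
  by have [<-|/off->] := eqVneq i j; rewrite ?muln1 ?muln0.
have := h (on_U (fun a b => (a == i) && (b == j) : nat)).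
rewrite wt_on_U sum_delta => ->.
rewrite big1 ?add0n => [|a _]; last by rewrite wt_on_U_wmon muln0.
rewrite -[RHS](sum_delta (udeg mu)).
apply: eq_bigr => a _; apply: eq_bigr => b _.
case: (posnP (udeg mu a b)) => [->//|/udeg_fits ab].
by rewrite wt_on_U_umon.
Qed.

End Degrees.

(** * Degree constraints on elements of [K[Z]] *)

Section SupportInSubalgebra.
Variables (K : fieldType) (m n : nat) (gamma : m.-tuple 'I_n).
Let N := #|vars gamma|.
Implicit Types (f : {mpoly K[N]}) (mu nu : 'X_{1..N}).
Local Notation on_W := (W_weight (gamma := gamma)).
Local Notation on_U := (U_weight (gamma := gamma)).
Local Notation Z := (Zmx gamma K).

Section WeightsOfEntries.
Variables (r : rel nat).
Hypothesis radd : addrel r.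
Hypothesis rrefl : reflexive r.

Lemma wsupp_Wmx_on_W b i j : wsupp r (on_W b) (b i j) (Wmx gamma K i j).
Proof. by rewrite WmxE; apply: wsuppX; rewrite wt_on_W_wmon. Qed.

Lemma wsupp_Wmx_on_U b i j : wsupp r (on_U b) 0 (Wmx gamma K i j).
Proof. by rewrite WmxE; apply: wsuppX; rewrite wt_on_U_wmon. Qed.

Lemma wsupp_Umx_on_W b i j : wsupp r (on_W b) 0 (Umx gamma K i j).
Proof.
rewrite UmxE; case: ifP => _; last exact: wsupp0.
by apply: wsuppX; rewrite wt_on_W_umon.
Qed.

Lemma wsupp_Umx_on_U b i j : wsupp r (on_U b) (b i j) (Umx gamma K i j).
Proof.
rewrite UmxE; case: ifP => h; last exact: wsupp0.
by apply: wsuppX; rewrite wt_on_U_umon.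
Qed.

Lemma wsupp_Zmx_row i a b :
  wsupp r (on_W (fun i' _ => i' == i : nat)) (a == i) (Z a b).
Proof.
rewrite mxE; apply: wsupp_sum => l _; rewrite -[nat_of_bool _]addn0.
apply: wsuppM => //; last exact: wsupp_Umx_on_W.
exact: (wsupp_Wmx_on_W (fun i' _ => i' == i : nat)).
Qed.

End WeightsOfEntries.

(* [W U = (W t^-1) (t U)] for diagonal [t]: column degrees of [W] and row degrees
   of [U] agree on [K[W U]]. *)
Lemma subalg_Zmx_balanced (c : 'I_m -> nat) f : subalg (entries Z) f ->
  {in msupp f, forall mu,
    wt (on_W (fun _ j => c j)) mu = wt (on_U (fun i _ => c i)) mu}.
Proof.
pose T : set {mpoly K[N]} := [set f | {in msupp f, forall mu,
    wt (on_W (fun _ j => c j)) mu = wt (on_U (fun i _ => c i)) mu}].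
suff : subalg (entries Z) `<=` T by apply.
have TM p q : T p -> T q -> T (p * q).
  move=> hp hq mu /msuppM_le/allpairsP[[a b]] /= [/hp ha /hq hb ->].
  by rewrite !wtD ha hb.
have TD p q : T p -> T q -> T (p + q).
  by move=> hp hq mu /msuppD_le; rewrite mem_cat => /orP[/hp|/hq].
have T0 : T 0 by move=> mu; rewrite msupp0.
apply: subalg_sub; last first.
  move=> _ [i [j ->]]; rewrite mxE.
  apply: (big_ind T) => // l _.
  rewrite WmxE UmxE; case: ifP => h; last by rewrite mulr0.
  rewrite -mpolyXD => mu /mem_msuppXP <-.
  by rewrite !wtD wt_on_W_wmon wt_on_U_wmon wt_on_W_umon wt_on_U_umon // addn0.
split=> //.
- by move=> mu; rewrite -mpolyX0 => /mem_msuppXP <-; rewrite !wt0.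
- by move=> a p hp mu /msuppZ_le /hp.
Qed.

Definition row_degrees (k : 'I_m -> nat) : pred 'X_{1..N} :=
  fun mu => [forall i, wt (on_W (fun i' _ => i' == i : nat)) mu == k i].

Definition coordinate_row_degrees (k : 'I_m -> nat) :
    pred 'X_{1..#|{: 'I_m * 'I_n}|} :=
  fun ka => [forall i, wt (fun x => (enum_val x).1 == i : nat) ka == k i].

(** The rows of [Z] are homogeneous for the row degrees of [W], so the row-homogeneous parts of an
    element of [K[Z]] come from those of [F] and stay in [K[Z]]. *)
Lemma restrict_coordinate_polynomial k F :
  mrestrict (row_degrees k) (coordinate_polynomial F (@mpolyC N K) Z) =
  coordinate_polynomial (mrestrict (coordinate_row_degrees k) F) (@mpolyC N K) Z.
Proof.
pose zz := fun x : 'I_#|{: 'I_m * 'I_n}| => Z (enum_val x).1 (enum_val x).2.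
have key mu ka : mu \in msupp (mmap1 zz ka) ->
    row_degrees k mu = coordinate_row_degrees k ka.
  move=> h; apply: eq_forallb => i.
  have := wsupp_mmap1 (r := fun a b => a == b)
    (w := on_W (fun i' _ => i' == i : nat)) addrel_eq
    (d := fun x => (enum_val x).1 == i : nat) (h := zz) (mu := ka).
  move=> H; have /eqP e := H (fun x _ => @wsupp_Zmx_row _ addrel_eq (fun a => eqxx a) i _ _) mu h.
  by rewrite e.
have term0 c mu ka : row_degrees k mu != coordinate_row_degrees k ka ->
    (@mpolyC N K c * mmap1 zz ka)@_mu = 0.
  move=> ne; rewrite mcoeffCM (memN_msupp_eq0 (p := mmap1 zz ka)) ?mulr0 //.
  by apply: contra ne => /key->.
apply/mpolyP => mu; rewrite mcoeff_restrict /coordinate_polynomial mmap_restrict.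
rewrite /mmap !raddf_sum /= [in RHS]big_mkcond /=.
case: ifP => hmu.
  apply: eq_bigr => ka _; case: ifP => hnu //.
  by rewrite term0 // hmu hnu.
rewrite big1 // => ka _; case: ifP => hnu //.
by rewrite term0 // hmu hnu.
Qed.

Section LowestDiagonal.
Variables (f : {mpoly K[N]}) (mu0 : 'X_{1..N}).
Hypotheses (Zf : subalg (entries Z) f) (mu0f : mu0 \in msupp f).
Hypothesis mu0diag : forall i j, i != j -> wexp mu0 i j = 0%N.
Hypothesis mu0min : {in msupp f, forall nu,
  (wt (on_U (fun i _ => i)) mu0 <= wt (on_U (fun i _ => i)) nu)%N}.

Let k (i : 'I_m) : nat := wt (on_W (fun i' _ => i' == i : nat)) mu0.

Lemma rows_weight mu : row_degrees k mu ->
  wt (on_W (fun i _ => i)) mu = wt (on_W (fun i _ => i)) mu0.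
Proof.
move/forallP => h; rewrite !wt_on_W; apply: eq_bigr => i _.
rewrite -!big_distrl /=; congr muln.
by have /eqP := h i; rewrite /k !wt_on_W !sum_row.
Qed.

(** On and below the diagonal, column indices are at most row indices, so the column weight of [mu]
    is at most its row weight, which is that of [mu0]. By balance column weights are [U]-weights,
    and [mu0] is diagonal and of least [U]-weight, so equality holds throughout. *)
Lemma lower_triangular_diagonal mu : mu \in msupp f -> row_degrees k mu ->
  (forall i j : 'I_m, (i < j)%N -> wexp mu i j = 0%N) ->
  forall i j, i != j -> wexp mu i j = 0%N.
Proof.
move=> muf hk low.
have wE := subalg_Zmx_balanced (fun i => i : nat) Zf.
have colrow0 : wt (on_W (fun _ j => j)) mu0 = wt (on_W (fun i _ => i)) mu0.
  rewrite !wt_on_W; apply: eq_bigr => i _; apply: eq_bigr => j _.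
  by have [->//|/mu0diag->] := eqVneq i j.
have tot : (wt (on_W (fun i _ => i)) mu <= wt (on_W (fun _ j => j)) mu)%N.
  by rewrite rows_weight // -colrow0 !wE // mu0min.
have term i j : (wexp mu i j * j <= wexp mu i j * i)%N.
  by case: (leqP j i) => h; [rewrite leq_mul2l h orbT|rewrite low].
move=> i j ij; move: tot; rewrite !wt_on_W !pair_bigA /= => tot.
have := eq_sum_leq (F := fun p : 'I_m * 'I_m => (wexp mu p.1 p.2 * p.2)%N)
  (G := fun p : 'I_m * 'I_m => (wexp mu p.1 p.2 * p.1)%N)
  (fun p => term p.1 p.2) tot (i, j).
move=> /= /eqP; rewrite eqn_mul2l => /orP[/eqP//|/eqP/val_inj e].
by rewrite e eqxx in ij.
Qed.

(** A monomial with a factor [W_ij], [i < j], vanishes at both points; any other one has only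
    diagonal [W] factors by [lower_triangular_diagonal], and both points have ones there. *)
Lemma eval_lower_unitriangular (S : comNzRingType) (phi : {rmorphism K -> S})
    (h : 'M[S]_m) (U0 : 'M[S]_(m, n)) :
  (forall i j : 'I_m, (i < j)%N -> h i j = 0) -> (forall i, h i i = 1) ->
  mmap phi (point h U0) (mrestrict (row_degrees k) f) =
  mmap phi (point 1%:M U0) (mrestrict (row_degrees k) f).
Proof.
move=> hl h1; rewrite !mmap_restrict big_seq_cond [RHS]big_seq_cond.
apply: eq_bigr => mu /andP[muf muk]; congr (_ * _).
have [[p [p1 p2]]|nex] := pselect (exists p : 'I_m * 'I_m,
    (p.1 < p.2)%N /\ wexp mu p.1 p.2 != 0%N).
  have z (h' : 'M[S]_m) : h' p.1 p.2 = 0 -> mmap1 (point h' U0 (gamma := gamma)) mu = 0.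
    move=> h0; rewrite /mmap1 (bigD1 (enum_rank (inl p : vars gamma))) //=.
    rewrite {1}/point enum_rankK h0 expr0n.
    by move: p2; rewrite /wexp -surjective_pairing => /negbTE->; rewrite mul0r.
  rewrite !z ?hl //.
  by rewrite mxE (_ : (p.1 == p.2) = false) //; apply/negbTE; rewrite neq_ltn p1.
have diag := lower_triangular_diagonal muf muk.
apply: eq_bigr => x _; rewrite /point -(enum_valK x) enum_rankK.
case: (enum_val x) => [[i j]|u] //=.
have [<-|ij] := eqVneq i j; first by rewrite h1 mxE eqxx.
rewrite (_ : mu _ = 0%N) ?expr0 //; apply: diag => // i' j' lt'.
apply/eqP/negPn/negP => ne; apply: nex; by exists (i', j').
Qed.

End LowestDiagonal.
End SupportInSubalgebra.

(** * Garnir relations *)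

Lemma below_wsupp N (R : comNzRingType) (w : 'I_N -> nat) d tau (p : {mpoly R[N]}) :
  wsupp leq w d p -> (d < wt w tau)%N ->
  below (fun mu nu => (wt w mu < wt w nu)%N) tau p.
Proof. by move=> hp hd mu /hp h; apply: leq_ltn_trans h hd. Qed.

Section GarnirSubstitution.
Variables (K : fieldType) (m n : nat) (gamma : m.-tuple 'I_n).
Let N := #|vars gamma|.
Implicit Types (f : {mpoly K[N]}) (mu nu : 'X_{1..N}).
Local Notation on_W := (W_weight (gamma := gamma)).
Local Notation on_U := (U_weight (gamma := gamma)).
Local Notation umon := (@Uvarmon m n gamma).
Local Notation Z := (Zmx gamma K).
Local Notation U := (Umx gamma K).

Variables (i i' : 'I_m) (c0 : 'I_n).
Hypothesis ii' : i' = i.+1 :> nat.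
Hypothesis gammaP : Gamma gamma.
Hypothesis gc0 : (tnth gamma i' <= c0)%N.

Let ine : (i' == i) = false.
Proof. by apply/eqP => e; have := ii'; rewrite e; lia. Qed.

Let gc0i : (tnth gamma i <= c0)%N.
Proof. by apply: leq_trans gc0; apply/ltnW/gamma_lt => //; rewrite ii'. Qed.

(* Any variable that does not occur in [U] may serve as the parameter. *)
Let svar : 'I_N := enum_rank (inl (i, i) : vars gamma).
Let s : {mpoly K[N]} := 'X_svar.

(** The row to be exchanged: row [i'] before [c0], row [i] from [c0] on. It enters rows [i] and [i']
    with opposite signs, so their sum is free of [s]; [x] and [y] omit the columns in which every
    entry has to carry [s]. *)
Let z (c : 'I_n) : {mpoly K[N]} := if (c < c0)%N then U i' c else U i c.
Let x (c : 'I_n) : {mpoly K[N]} := if (c < c0)%N then U i c else 0.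
Let y (c : 'I_n) : {mpoly K[N]} := if (c0 < c)%N then U i' c else 0.

Definition garnir_mx : 'M[{mpoly K[N]}]_(m, n) := \matrix_(a, c)
  (if a == i then x c + s * z c else if a == i' then y c - s * z c else U a c).

Definition garnir_point : 'I_N -> {mpoly K[N]} := point 1%:M garnir_mx.

(** For a variable of [U], the monomial of largest [garnir_weight] in the entry substituted for it.
    Column [c0] of row [i'] is special: the entry there is [- s] times the variable in row [i]. *)
Definition garnir_mon (k : 'I_N) : 'X_{1..N} :=
  match enum_val k with
  | inl _ => 0
  | inr u =>
    if (val u).1 == i then
      if ((val u).2 < c0)%N then U_(k) else U_(k) + U_(svar)
    else if (val u).1 == i' then
      if ((val u).2 < c0)%N then U_(k) + U_(svar)
      else if (c0 < (val u).2)%N then U_(k) else umon i c0 + U_(svar)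
    else U_(k)
  end%MM.

Definition garnir_sign (k : 'I_N) : K :=
  match enum_val k with
  | inl _ => 1
  | inr u => (-1) ^+ (((val u).1 == i') && ((val u).2 <= c0)%N)
  end.

Definition garnir_top (mu : 'X_{1..N}) : 'X_{1..N} :=
  (\sum_k garnir_mon k *+ mu k)%MM.

Let Ustair (a : 'I_m) (c : 'I_n) : (c < tnth gamma a)%N -> U a c = 0.
Proof. by move=> h; rewrite UmxE leqNgt h. Qed.

Lemma garnir_staircase : staircase gamma garnir_mx.
Proof.
move=> a c h; rewrite mxE /x /y /z.
have [ai|ai] := eqVneq a i; first subst a.
  have cc0 : (c < c0)%N by apply: leq_trans h gc0i.
  have h' : (c < tnth gamma i')%N.
    by apply: ltn_trans h (gamma_lt gammaP _); rewrite ii'.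
  by rewrite cc0 !Ustair // mulr0 addr0.
have [ai'|ai'] := eqVneq a i'; last exact: Ustair.
subst a; have cc0 : (c < c0)%N by apply: leq_trans h gc0.
by rewrite cc0 ltnNge (ltnW cc0) /= Ustair // mulr0 subr0.
Qed.

Let sE : s = Wmx gamma K i i. Proof. by rewrite WmxE. Qed.

Section GarnirWeights.
Variable r : rel nat.
Hypothesis radd : addrel r.
Hypothesis rrefl : reflexive r.
Hypothesis rtrans : transitive r.
Variable b : 'I_m -> 'I_n -> nat.
Hypothesis b_lo : forall c : 'I_n, (c < c0)%N -> r (b i' c) (b i c).
Hypothesis b_hi : forall c : 'I_n, (c0 <= c)%N -> r (b i c) (b i' c).

Let wsupp_U a c d : r (b a c) d -> wsupp r (on_U b) d (U a c).
Proof.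
by move=> h nu /(wsupp_Umx_on_U rrefl b) /rtrans; apply.
Qed.

Let wsupp_sU a c d : r (b a c) d -> wsupp r (on_U b) d (s * U a c).
Proof.
move=> h; rewrite sE -[d]add0n; apply: wsuppM => //; last exact: wsupp_U.
exact: wsupp_Wmx_on_U.
Qed.

(** Before [c0] the substitution can only turn entries of row [i] into entries of row [i'], and from
    [c0] on only the reverse; the hypotheses on [b] say that both moves respect [r]. *)
Lemma wsupp_garnir mu tau : tau \in msupp (mmap1 garnir_point mu) ->
  r (wt (on_U b) tau) (wt (on_U b) mu).
Proof.
apply: wsupp_mmap1 => // k _.
rewrite /garnir_point /point /U_weight; case: (enum_val k) => [p|u].
  rewrite mxE; case: eqP => _; first exact: wsupp1.
  exact: wsupp0.
move: (val u).1 (val u).2 => a c; rewrite mxE /x /y /z.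
have [->|ai] := eqVneq a i.
  case: ltnP => cc; last by rewrite add0r; apply: wsupp_sU.
  by apply: wsuppD; [apply: wsupp_U | apply: wsupp_sU => //; apply: b_lo].
have [->|ai'] := eqVneq a i'; last exact: wsupp_U.
case: (ltngtP c c0) => [cc|cc|/val_inj->].
- by rewrite sub0r; apply: wsuppN; apply: wsupp_sU.
- apply: wsuppD; first exact: wsupp_U.
  by apply: wsuppN; apply: wsupp_sU; apply: b_hi; apply: ltnW.
- by rewrite sub0r; apply: wsuppN; apply: wsupp_sU; apply: b_hi.
Qed.

End GarnirWeights.

(** Chosen so that in the entries with two terms, row [i] before [c0] and row [i'] after [c0], the
    term without [s] wins. *)
Definition garnir_weight (a : 'I_m) (c : 'I_n) : nat :=
  ((a == i) && (c < c0)%N) || ((a == i') && (c0 < c)%N).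

Local Notation gw := (on_U garnir_weight).
Local Notation glt := (fun mu nu : 'X_{1..N} => (wt gw mu < wt gw nu)%N).

Let gltP : additive_lt glt := additive_lt_wt gw.

Lemma garnir_topform k : (forall a b, enum_val k = inl (a, b) -> a = b) ->
  topform glt (garnir_mon k) (garnir_sign k) (garnir_point k).
Proof.
rewrite /garnir_mon /garnir_sign /garnir_point /point.
case ek: (enum_val k) => [[a b]|u] dia.
  by rewrite mxE -(dia a b erefl) eqxx; apply: topform1.
have kE : U_(k)%MM = umon (val u).1 (val u).2 by rewrite umon_val -ek enum_valK.
rewrite kE; move: (val u).1 (val u).2 (valP u : (tnth gamma (val u).1 <= _)%N).
move=> a c ac {ek kE dia u}.
have UE : U a c = 'X_[umon a c] by rewrite UmxE ac.
have below_sU a' : garnir_weight a c = 1%N ->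
    garnir_weight a' c = 0%N -> below glt (umon a c) (s * U a' c).
  move=> w1 w0; apply: (below_wsupp (d := 0)).
    rewrite sE -w0 -[garnir_weight a' c]add0n; apply: (wsuppM addrel_leq).
      by apply: wsupp_Wmx_on_U; apply: leqnn.
    by apply: wsupp_Umx_on_U; apply: leqnn.
  by rewrite wt_on_U_umon // w1.
have XE a' (c' : 'I_n) : (tnth gamma a' <= c')%N ->
    s * U a' c' = 'X_[umon a' c' + U_(svar)].
  by move=> h; rewrite UmxE h mulrC mpolyXD.
rewrite mxE /x /y /z.
have [ai|ai] := eqVneq a i.
  subst a; rewrite eq_sym ine /= expr0; case: ltnP => cc.
    apply: topformDl; first by rewrite UE; apply: topformX.
    apply: below_sU; first by rewrite /garnir_weight eqxx cc.
    by rewrite /garnir_weight ine eqxx [(c0 < c)%N]ltnNge (ltnW cc) andbF.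
  by rewrite add0r XE //; apply: topformX.
have [ai'|ai'] := eqVneq a i'; last by rewrite /= expr0 UE; apply: topformX.
subst a => /=; case: (ltngtP c c0) => [cc|cc|/val_inj cc].
- rewrite expr1 sub0r XE // -scaleN1r -[X in topform _ _ X]mulr1.
  by apply: topformZ; apply: topformX.
- rewrite expr0; apply: topformDl; first by rewrite UE; apply: topformX.
  rewrite -scaleN1r; apply: belowZ; apply: below_sU.
    by rewrite /garnir_weight ine eqxx cc.
  by rewrite /garnir_weight eqxx [i == i']eq_sym ine ltnNge (ltnW cc).
- subst c; rewrite expr1 sub0r XE // -scaleN1r -[X in topform _ _ X]mulr1.
  by apply: topformZ; apply: topformX.
Qed.

Definition Wdiag mu : Prop := forall a b, a != b -> wexp mu a b = 0%N.

Lemma garnir_top_coef mu : Wdiag mu ->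
  (mmap1 garnir_point mu)@_(garnir_top mu) != 0.
Proof.
move=> dia.
have h : topform glt (garnir_top mu) (\prod_k garnir_sign k ^+ mu k)
    (mmap1 garnir_point mu).
  apply: topform_mmap1 => // k muk; apply: garnir_topform => a b ek.
  apply/eqP; apply: contraNT muk => /dia <-.
  by rewrite /wexp -ek enum_valK.
rewrite (topform_coef gltP h); apply/prodf_neq0 => k _.
rewrite expf_neq0 // /garnir_sign; case: enum_val => [_|u]; first exact: oner_neq0.
by rewrite signr_eq0.
Qed.

Lemma garnir_nondiag mu : ~ Wdiag mu -> mmap1 garnir_point mu = 0.
Proof.
move=> nd; have [[a b] /andP[/= ab mab]] : exists p : 'I_m * 'I_m,
    (p.1 != p.2) && (wexp mu p.1 p.2 != 0%N).
  apply/not_existsP => h; apply: nd => a b ab; apply/eqP/negPn/negP => ne.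
  by apply: (h (a, b)); rewrite /= ab ne.
rewrite /mmap1 (bigD1 (enum_rank (inl (a, b) : vars gamma))) //=.
rewrite {1}/garnir_point /point enum_rankK /= mxE (negbTE ab) expr0n.
by rewrite -/(wexp mu a b) (negbTE mab) mul0r.
Qed.

Lemma wt_garnir_top w mu :
  wt w (garnir_top mu) = (\sum_k mu k * wt w (garnir_mon k))%N.
Proof. by rewrite wt_sum; apply: eq_bigr => k _; rewrite wtMn. Qed.

Lemma garnir_top_ge (w v : 'I_N -> nat) mu :
  (forall k, (v k <= wt w (garnir_mon k))%N) ->
  (wt v mu <= wt w (garnir_top mu))%N.
Proof.
by move=> h; rewrite wt_garnir_top; apply: leq_sum => k _; rewrite leq_mul2l h orbT.
Qed.

Definition svar_weight : 'I_N -> nat := on_W (fun a b => (a == i) && (b == i) : nat).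

(** In these columns the distinguished monomial of each entry carries a factor [s]. *)
Lemma garnir_top_svar mu :
  (\sum_(c : 'I_n | (c0 <= c)%N) udeg mu i c + \sum_(c : 'I_n | (c <= c0)%N) udeg mu i' c
     <= wt svar_weight (garnir_top mu))%N.
Proof.
pose b (a : 'I_m) (c : 'I_n) : nat :=
  (((a == i) && (c0 <= c)) + ((a == i') && (c <= c0)))%N.
suff <- : wt (on_U b) mu = (\sum_(c : 'I_n | (c0 <= c)%N) udeg mu i c +
    \sum_(c : 'I_n | (c <= c0)%N) udeg mu i' c)%N.
  apply: garnir_top_ge => k; rewrite /garnir_mon /U_weight /b.
  case ek: (enum_val k) => [p|u] //.
  have s1 : wt svar_weight U_(svar)%MM = 1%N.
    by rewrite wtU /svar_weight /W_weight enum_rankK /= eqxx.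
  have [->|ai] := eqVneq (val u).1 i.
    rewrite [i == i']eq_sym ine /= addn0; case: ltnP => // _.
    by rewrite wtD s1 addn1.
  have [_|//] := eqVneq (val u).1 i'.
  by case: (ltngtP (val u).2 c0) => /= cc; rewrite ?wtD ?s1 ?add0n // leq_addl.
rewrite wt_on_U /b; under eq_bigr => a _.
  under eq_bigr => c _ do rewrite mulnDr.
  rewrite big_split /=.
  over.
rewrite big_split /=; congr addn.
  rewrite (bigD1 i) //= [X in (_ + X)%N]big1 ?addn0 => [|a /negbTE ia]; last first.
    by rewrite big1 // => c _; rewrite ia muln0.
  rewrite [RHS]big_mkcond; apply: eq_bigr => c _; rewrite eqxx /=.
  by case: leqP; rewrite ?muln1 ?muln0.
rewrite (bigD1 i') //= [X in (_ + X)%N]big1 ?addn0 => [|a /negbTE ia]; last first.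
  by rewrite big1 // => c _; rewrite ia muln0.
rewrite [RHS]big_mkcond; apply: eq_bigr => c _; rewrite eqxx /=.
by case: leqP; rewrite ?muln1 ?muln0.
Qed.

Lemma udeg_wt mu a c :
  udeg mu a c = wt (on_U (fun a' c' => (a' == a) && (c' == c) : nat)) mu.
Proof. by rewrite wt_on_U sum_delta. Qed.

Lemma garnir_top_lo mu (c : 'I_n) : (c < c0)%N -> (udeg mu i c <= udeg (garnir_top mu) i c)%N.
Proof.
move=> cc; rewrite !udeg_wt; apply: garnir_top_ge => k.
rewrite /U_weight /garnir_mon; case ek: (enum_val k) => [p|u] //.
have [ui|//] := eqVneq (val u).1 i; have [uc|//] := eqVneq (val u).2 c.
by rewrite uc cc wtU ek ui uc !eqxx.
Qed.

Lemma garnir_top_hi mu (c : 'I_n) : (c0 < c)%N -> (udeg mu i' c <= udeg (garnir_top mu) i' c)%N.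
Proof.
move=> cc; rewrite !udeg_wt; apply: garnir_top_ge => k.
rewrite /U_weight /garnir_mon; case ek: (enum_val k) => [p|u] //.
have [ui|//] := eqVneq (val u).1 i'; have [uc|//] := eqVneq (val u).2 c.
by rewrite ui ine uc ltnNge (ltnW cc) cc /= wtU ek ui uc !eqxx.
Qed.

(* Among the fillings with given contents, only [mu] itself can produce its
   distinguished monomial, provided [mu] has maximal second moment. *)
Lemma garnir_top_unique mu nu : Wdiag mu -> Wdiag nu ->
  (forall a, wexp mu a a = wexp nu a a) ->
  (forall a, rowsum (udeg mu) a = rowsum (udeg nu) a) ->
  (wt (on_U (fun a c => a * c)%N) nu <= wt (on_U (fun a c => a * c)%N) mu)%N ->
  garnir_top mu \in msupp (mmap1 garnir_point nu) -> nu = mu.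
Proof.
move=> dmu dnu Wmn rmn mom hnu.
have hmu : garnir_top mu \in msupp (mmap1 garnir_point mu).
  by rewrite mcoeff_msupp garnir_top_coef.
pose eqr : rel nat := fun a b => a == b.
have eqr_refl : reflexive eqr by move=> a; apply: eqxx.
have eqr_tr : transitive eqr by move=> a b c /eqP-> /eqP->; apply: eqxx.
(* The weight [b] does not distinguish rows [i] and [i'], so the substitution preserves it. *)
have content c : (udeg mu i c + udeg mu i' c = udeg nu i c + udeg nu i' c)%N.
  pose b (a : 'I_m) (c' : 'I_n) : nat := (((a == i) + (a == i')) * (c' == c))%N.
  have bE ka : wt (on_U b) ka = (udeg ka i c + udeg ka i' c)%N.
    rewrite !udeg_wt -wt_addw; apply: eq_wt => k; rewrite /U_weight /b.
    by case: enum_val => // u; rewrite mulnDl !mulnb.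
  have H ka := wsupp_garnir addrel_eq eqr_refl eqr_tr (b := b) _ _
    (mu := ka) (tau := garnir_top mu).
  have bs c' : b i c' = b i' c' by rewrite /b !eqxx ine eq_sym ine.
  have {}H ka : garnir_top mu \in msupp (mmap1 garnir_point ka) ->
      wt (on_U b) (garnir_top mu) = wt (on_U b) ka.
    by move=> hk; apply/eqP; apply: H => // c' _; rewrite bs; apply: eqr_refl.
  by rewrite -!bE -(H _ hmu) -(H _ hnu).
have other a c : a != i -> a != i' -> udeg mu a c = udeg nu a c.
  move=> ai ai'.
  have H ka : garnir_top mu \in msupp (mmap1 garnir_point ka) ->
      udeg (garnir_top mu) a c = udeg ka a c.
    rewrite !udeg_wt => hk; apply/eqP; move: hk.
    apply: (wsupp_garnir addrel_eq eqr_refl eqr_tr) => c' _ /=;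
      by rewrite ![_ == a]eq_sym (negbTE ai) (negbTE ai').
  by rewrite -(H _ hmu) -(H _ hnu).
(* The distinguished monomial keeps the entries of row [i] before [c0], and the substitution into
   [nu] cannot create such entries. *)
have lo (c : 'I_n) : (c < c0)%N -> (udeg mu i c <= udeg nu i c)%N.
  move=> cc; apply: leq_trans (garnir_top_lo mu cc) _.
  rewrite !udeg_wt; move: hnu.
  apply: (wsupp_garnir addrel_leq leqnn leq_trans) => c' cc' /=.
    by rewrite ine.
  rewrite (_ : (c' == c) = false) ?andbF //.
  by apply/negbTE; rewrite neq_ltn (leq_trans cc cc') orbT.
have hi (c : 'I_n) : (c0 < c)%N -> (udeg mu i' c <= udeg nu i' c)%N.
  move=> cc; apply: leq_trans (garnir_top_hi mu cc) _.
  rewrite !udeg_wt; move: hnu.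
  apply: (wsupp_garnir addrel_leq leqnn leq_trans) => c' cc' /=.
    rewrite (_ : (c' == c) = false) ?andbF //.
    by apply/negbTE; rewrite neq_ltn (ltn_trans cc' cc).
  by rewrite eq_sym ine.
have rowi : forall c, udeg mu i c = udeg nu i c.
  apply: (moment_rigidity (c0 := c0)) => //.
  - by have := rmn i.
  - by move=> c cc; have := content c; have := hi c cc; lia.
  move: mom; rewrite !wt_on_U.
  have split_rows (ka : 'X_{1..N}) : (\sum_a \sum_(c : 'I_n) udeg ka a c * (a * c) =
      \sum_(c : 'I_n) udeg ka i c * (i * c) + (\sum_(c : 'I_n) udeg ka i' c * (i' * c) +
      \sum_(a | (a != i) && (a != i')) \sum_(c : 'I_n) udeg ka a c * (a * c)))%N.
    by rewrite (bigD1 i) //= (bigD1 i') //= ine.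
  rewrite !split_rows.
  rewrite (eq_bigr (fun a : 'I_m => \sum_(c : 'I_n) udeg mu a c * (a * c))%N)
    => [|a /andP[ai ai']]; last by apply: eq_bigr => c _; rewrite other.
  rewrite !addnA leq_add2r ii'.
  (* The two-row part of the second moment is a quantity depending on the contents only, minus the
     first moment of row [i]; maximality of [mu] thus says that row [i] of [mu] has no larger first
     moment than that of [nu]. *)
  have E (ka : 'X_{1..N}) : (\sum_(c : 'I_n) udeg ka i c * (i * c) +
      \sum_(c : 'I_n) udeg ka i' c * (i.+1 * c) + \sum_(c : 'I_n) udeg ka i c * c =
      \sum_(c : 'I_n) (udeg ka i c + udeg ka i' c) * (i.+1 * c))%N.
    by rewrite -!big_split; apply: eq_bigr => c _ /=; nia.
  have Emn : (\sum_(c : 'I_n) (udeg mu i c + udeg mu i' c) * (i.+1 * c) =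
      \sum_(c : 'I_n) (udeg nu i c + udeg nu i' c) * (i.+1 * c))%N.
    by apply: eq_bigr => c _; rewrite content.
  rewrite -(leq_add2r (\sum_(c : 'I_n) udeg mu i c * c)) E Emn -E.
  by rewrite leq_add2l.
apply: degrees_inj => a b.
  by have [<-|ab] := eqVneq a b; [rewrite Wmn|rewrite dmu // dnu].
have [->|ai] := eqVneq a i; first by rewrite rowi.
have [->|ai'] := eqVneq a i'; last by rewrite other.
by have := content b; rewrite rowi; lia.
Qed.

End GarnirSubstitution.

Lemma elementary_lower (S : comNzRingType) m (i i' : 'I_m) : (i < i')%N ->
  (forall a b : 'I_m, (a < b)%N -> (1%:M + delta_mx i' i : 'M[S]_m) a b = 0) /\
  (forall a : 'I_m, (1%:M + delta_mx i' i : 'M[S]_m) a a = 1).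
Proof.
move=> ii'; split=> [a b ab|a]; rewrite !mxE ?eqxx.
  have -> : (a == b) = false by apply/negbTE; rewrite neq_ltn ab.
  case: eqP => [ea|]; case: eqP => [eb|]; rewrite ?addr0 //.
  by move: ab; rewrite ea eb ltnNge ltnW.
case: eqP => [->|]; case: eqP => [e|]; rewrite ?addr0 //.
by rewrite e ltnn in ii'.
Qed.

(** * Semistandard monomials of invariants *)

Section StandardMonomialOfInvariant.
Variables (K : fieldType) (m n : nat) (gamma : m.-tuple 'I_n).
Let N := #|vars gamma|.
Implicit Types (f : {mpoly K[N]}) (mu nu : 'X_{1..N}).
Variable G : forall B : comNzRingType, set 'M[B]_m.
Hypothesis SG : forall (B : comNzRingType) (g : 'M[B]_m), SOrth m B g -> @G B g.
Hypotheses (m0 : (0 < m)%N) (gammaP : Gamma gamma).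

(** Adding row [i] to row [i'] cancels [s] there, so [s] remains only in row [i], linearly; a
    product of row degrees [k] contains it at most [k i] times. *)
Lemma garnir_row_degree (i i' : 'I_m) (c0 : 'I_n) k F :
  i' = i.+1 :> nat ->
  wsupp leq (svar_weight (gamma := gamma) i) (k i)
    (coordinate_polynomial (mrestrict (coordinate_row_degrees k) F)
       (@mpolyC N K) ((1%:M + delta_mx i' i) *m garnir_mx K gamma i i' c0)).
Proof.
move=> e; set M := _ *m _.
have ine : (i' == i) = false by apply/eqP => e'; move: e; rewrite e'; lia.
have wU a c : wsupp leq (svar_weight (gamma := gamma) i) 0 (Umx gamma K a c).
  exact: wsupp_Umx_on_W.
have ME a c : wsupp leq (svar_weight (gamma := gamma) i) (a == i) (M a c).
  have -> : M a c = garnir_mx K gamma i i' c0 a c +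
      (if a == i' then garnir_mx K gamma i i' c0 i c else 0).
    rewrite /M mulmxDl mul1mx mxE; congr (_ + _).
    rewrite mxE (bigD1 i) //= big1 ?addr0 => [|l /negbTE li]; last first.
      by rewrite mxE li andbF mul0r.
    by rewrite mxE eqxx andbT; case: ifP; rewrite ?mul1r ?mul0r.
  rewrite ![garnir_mx _ _ _ _ _ _ _]mxE eqxx; have [->|ai] := eqVneq a i.
    rewrite [i == i']eq_sym ine addr0.
    have ws (p : {mpoly K[N]}) : wsupp leq (svar_weight (gamma := gamma) i) 0 p ->
        wsupp leq (svar_weight (gamma := gamma) i) 1 ('X_(enum_rank (inl (i, i) : vars gamma)) * p).
      move=> hp; rewrite -[1%N]addn0; apply: (wsuppM addrel_leq) => //.
      by apply: wsuppX; rewrite wtU /svar_weight /W_weight enum_rankK /= eqxx.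
    apply: wsuppD; last by apply: ws; case: ifP => _; apply: wU.
    case: ifP => _; last exact: wsupp0.
    by move=> nu /wU; rewrite leqn0 => /eqP->.
  have [_|_] := eqVneq a i'; last by rewrite addr0; apply: wU.
  set p := _ * _; rewrite addrACA addNr addr0.
  by apply: wsuppD; case: ifP => _; [apply: wU | apply: wsupp0 | apply: wU | apply: wsupp0].
rewrite /coordinate_polynomial mmap_restrict big_seq_cond; apply: wsupp_sum => ka.
move=> /andP[_ /forallP/(_ i)/eqP <-]; rewrite -[wt _ _]add0n.
apply: (wsuppM addrel_leq); first exact: (wsuppC _ addrel_leq).
by apply: (wsupp_mmap1 addrel_leq) => x _; apply: ME.
Qed.

(** Let [p] be the part of [f] of row degrees [k]. If [mu] violated semistandardness at [c0], its
    distinguished monomial would occur in [p(1, garnir_mx)] with [s]-exponent above [k i]; but this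
    polynomial equals [p(h, garnir_mx)] for an elementary lower [h], where the exponent is at most
    [k i]. *)
Theorem standard_monomial f : abs_invariants gamma K G f -> f != 0 ->
  exists2 a, [/\ semistandard a, fits gamma a & tableau_monomial gamma a \in msupp f]
    & forall i, wt (W_weight (fun i' _ => i' == i : nat)) (tableau_monomial gamma a) =
                rowsum a i.
Proof.
move=> hf f0; have Zf := proj1 hf.
have [mu0 [mu0f mu0d mu0min]] := diagonal_lowest_monomial SG m0 gammaP hf f0.
pose k (i : 'I_m) : nat := wt (W_weight (fun i' _ => i' == i : nat)) mu0.
pose Om := [seq mu <- msupp f | row_degrees k mu && `[< Wdiag mu >]].
have OmP mu : mu \in Om -> [/\ mu \in msupp f, row_degrees k mu & Wdiag mu].
  by rewrite mem_filter => /andP[/andP[h1 /asboolP h2] h3].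
have diagW nu i : Wdiag nu ->
    wt (W_weight (fun i' _ => i' == i : nat)) nu = wexp nu i i.
  move=> dn; rewrite wt_on_W sum_row (bigD1 i) //= big1 ?addn0 // => j ji.
  by apply: dn; rewrite eq_sym.
have kE nu i : nu \in Om -> wexp nu i i = k i.
  by case/OmP => _ /forallP/(_ i)/eqP <- dn; rewrite diagW.
(* By balance, the [W] column degrees of a diagonal monomial are the row lengths of its [U] part. *)
have rowE nu i : nu \in Om -> wexp nu i i = rowsum (udeg nu) i.
  case/OmP => nuf _ dn.
  have := subalg_Zmx_balanced (fun j => j == i : nat) Zf nuf.
  rewrite /rowsum wt_on_U sum_row wt_on_W => <-; rewrite exchange_big sum_row.
  by rewrite (bigD1 i) //= big1 ?addn0 // => j ji; apply: dn.
have mu0Om : mu0 \in Om.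
  rewrite mem_filter mu0f andbT; apply/andP; split; last by apply/asboolP.
  by apply/forallP => i.
(* This choice of [mu] excludes cancellation of its distinguished monomial by other members of
   [Om]. *)
have [mu muOm mumax] := seq_argmax (fun mu => wt (U_weight (fun a c => a * c)%N) mu) mu0Om.
have [muf muk mud] := OmP _ muOm.
have tE : tableau_monomial gamma (udeg mu) = mu.
  by apply: tableau_monomial_degrees => // i; apply: rowE.
exists (udeg mu); rewrite tE; last by move=> i; rewrite diagW // rowE.
split=> //; last exact: udeg_fits.
move=> i i' c0 e; rewrite leqNgt; apply/negP => viol.
(* A violation at [c0] produces an entry of row [i'] in a column up to [c0], so [c0] lies within the
   staircase of row [i']. *)
have gc0 : (tnth gamma i' <= c0)%N.
  have : (0 < \sum_(j : 'I_n | (j <= c0)%N) udeg mu i' j)%N by apply: leq_ltn_trans viol.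
  rewrite lt0n sum_nat_eq0 negb_forall => /existsP[j].
  rewrite negb_imply -lt0n => /andP[jc /udeg_fits h]; exact: leq_trans h jc.
have [F fE] := subalg_Zmx Zf.
pose top := garnir_top i i' c0 mu.
have inR : top \in msupp (mmap (@mpolyC N K) (garnir_point K i i' c0)
    (mrestrict (row_degrees k) f)).
  rewrite mcoeff_msupp mmap_restrict raddf_sum /=.
  rewrite big_mkcond (bigD1_seq mu) ?msupp_uniq //= muk.
  rewrite big1_seq => [|nu /andP[ne nuf]].
    rewrite addr0 mcoeffCM mulf_neq0 -?mcoeff_msupp //.
    by rewrite mcoeff_msupp; apply: garnir_top_coef.
  case: ifP => // nuk; rewrite mcoeffCM; have [nud|nnd] := pselect (Wdiag nu); last first.
    by rewrite garnir_nondiag // mcoeff0 mulr0.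
  have nuOm : nu \in Om by rewrite mem_filter nuk nuf andbT; apply/asboolP.
  rewrite (@memN_msupp_eq0 _ _ (mmap1 (garnir_point K i i' c0) nu)) ?mulr0 //; apply/negP => htop.
  move/eqP: ne; apply; apply: garnir_top_unique htop => //.
  - by move=> a; rewrite !kE.
  - by move=> a; rewrite -!rowE // !kE.
  - exact: mumax.
have lowE := eval_lower_unitriangular Zf mu0f mu0d mu0min
  (@mpolyC N K : {rmorphism K -> {mpoly K[N]}}) (h := 1%:M + delta_mx i' i) (garnir_mx K gamma i i' c0).
move: inR; rewrite /garnir_point -lowE; last first.
- exact: (proj2 (elementary_lower _ (eq_leq (esym e)))).
- exact: (proj1 (elementary_lower _ (eq_leq (esym e)))).
rewrite {1}fE restrict_coordinate_polynomial mmap_coordinate_polynomial; last first.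
  exact: garnir_staircase.
move/(garnir_row_degree e)/(leq_trans (garnir_top_svar e gammaP gc0 mu)).
have kmu : wt (W_weight (fun i' _ => i' == i : nat)) mu0 = rowsum (udeg mu) i.
  exact: etrans (esym (kE mu i muOm)) (rowE mu i muOm).
(* Splitting row [i] at [c0] turns the bound on the exponent of [s] into the semistandard
   inequality. *)
rewrite kmu /rowsum [leqRHS](bigID (fun c : 'I_n => (c < c0)%N)) /=.
rewrite [X in (_ <= _ + X)%N](eq_bigl (fun c : 'I_n => (c0 <= c)%N)) => [|c].
  by rewrite addnC leq_add2r leqNgt viol.
by rewrite -leqNgt.
Qed.

End StandardMonomialOfInvariant.

(** * Inclusions between the subalgebras and the invariants *)

Section InvariantSubalgebras.
Variables (K : fieldType) (m n : nat) (gamma : m.-tuple 'I_n).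
Let N := #|vars gamma|.
Local Notation W := (Wmx gamma K).
Local Notation U := (Umx gamma K).
Local Notation Z := (Zmx gamma K).
Implicit Types f : {mpoly K[N]}.

Section OneGroupElement.
Variables (B : comAlgType K) (g : 'M[B]_m).

Definition act_ext (f : {mpoly K[N]}) : {mpoly B[N]} := act g (ext_scalars B f).

Let theta : {rmorphism {mpoly K[N]} -> {mpoly B[N]}} :=
  comp_mpoly [tuple match enum_val k with
                | inl p => (map_mx (@mpolyC N B) g *m Wmx gamma B) p.1 p.2
                | inr u => var B (inr u)
                end | k < N] \o map_mpoly (in_alg B).

Lemma act_extC a : act_ext a%:MP = (ext_scalars B a%:MP : {mpoly B[N]}).
Proof. by rewrite /act_ext /ext_scalars map_mpolyC /act comp_mpolyC. Qed.

Lemma fixed_is_subalgebra :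
  is_subalgebra [set f : {mpoly K[N]} | act_ext f = ext_scalars B f].
Proof.
pose ext : {rmorphism {mpoly K[N]} -> {mpoly B[N]}} := map_mpoly (in_alg B).
have D f h : act_ext (f + h) = act_ext f + act_ext h by apply: (rmorphD theta).
have M f h : act_ext (f * h) = act_ext f * act_ext h by apply: (rmorphM theta).
have eD f h : ext_scalars B (f + h) = ext_scalars B f + ext_scalars B h :> {mpoly B[N]}.
  exact: (rmorphD ext).
have eM f h : ext_scalars B (f * h) = ext_scalars B f * ext_scalars B h :> {mpoly B[N]}.
  exact: (rmorphM ext).
split=> /=.
- by rewrite -[1]/(1%:MP) act_extC.
- by move=> f h hf hh; rewrite /= D eD hf hh.
- by move=> f h hf hh; rewrite /= M eM hf hh.
- by move=> a f hf; rewrite /= -mul_mpolyC M eM hf act_extC.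
Qed.

Lemma act_ext_W : map_mx act_ext W = map_mx (@mpolyC N B) g *m Wmx gamma B.
Proof.
apply/matrixP => i j; rewrite mxE /act_ext /ext_scalars WmxE map_mpolyX /act.
by rewrite comp_mpolyXU -tnth_nth tnth_mktuple enum_rankK.
Qed.

Lemma ext_W : map_mx (@ext_scalars m n gamma K B) W = Wmx gamma B.
Proof. by apply/matrixP => i j; rewrite mxE /ext_scalars WmxE map_mpolyX mxE. Qed.

Lemma fixed_U i j : act_ext (U i j) = ext_scalars B (U i j).
Proof.
rewrite mxE; case: insub => [u|] /=; last first.
  by rewrite -[0]/(0%:MP) act_extC.
rewrite /act_ext /ext_scalars /var map_mpolyX /act.
by rewrite comp_mpolyXU -tnth_nth tnth_mktuple enum_rankK.
Qed.

Lemma fixed_gram : g^T *m g = 1%:M ->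
  forall i j, act_ext ((W^T *m W) i j) = ext_scalars B ((W^T *m W) i j).
Proof.
move=> gg i j.
have : map_mx act_ext (W^T *m W) = map_mx (@ext_scalars m n gamma K B) (W^T *m W).
  have -> : map_mx act_ext (W^T *m W) = (map_mx act_ext W)^T *m map_mx act_ext W.
    by rewrite map_trmx; apply: (map_mxM theta).
  have -> : map_mx (@ext_scalars m n gamma K B) (W^T *m W) =
      (Wmx gamma B)^T *m Wmx gamma B.
    rewrite -ext_W map_trmx.
    exact: (map_mxM (map_mpoly (in_alg B) : {rmorphism {mpoly K[N]} -> {mpoly B[N]}})).
  rewrite act_ext_W trmx_mul -mulmxA [in X in _ *m X]mulmxA map_trmx -map_mxM gg.
  by rewrite map_mx1 mul1mx.
by move/matrixP/(_ i j); rewrite mxE [RHS]mxE.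
Qed.

Lemma fixed_det : \det g = 1 -> act_ext (\det W) = ext_scalars B (\det W).
Proof.
move=> dg.
have -> : act_ext (\det W) = \det (map_mx act_ext W) by rewrite (det_map_mx theta).
have -> : ext_scalars B (\det W) = \det (Wmx gamma B).
  rewrite -ext_W.
  by rewrite (det_map_mx (map_mpoly (in_alg B) : {rmorphism {mpoly K[N]} -> {mpoly B[N]}})).
by rewrite act_ext_W det_mulmx det_map_mx dg rmorph1 mul1r.
Qed.

End OneGroupElement.

Lemma abs_invariants_is_subalgebra (G : forall B : comNzRingType, set 'M[B]_m) :
  is_subalgebra (abs_invariants gamma K G).
Proof.
have hZ := subalg_is_subalgebra (entries Z).
have hfix (B : comAlgType K) (g : 'M[B]_m) := fixed_is_subalgebra g.
split.
- split; first exact: subalgebra1 hZ.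
  by move=> B g _; apply: (subalgebra1 (hfix B g)).
- move=> f h [Zf ff] [Zh fh]; split; first exact: (subalgebraD hZ).
  by move=> B g Gg; apply: (subalgebraD (hfix B g)); [apply: ff|apply: fh].
- move=> f h [Zf ff] [Zh fh]; split; first exact: (subalgebraM hZ).
  by move=> B g Gg; apply: (subalgebraM (hfix B g)); [apply: ff|apply: fh].
- move=> a f [Zf ff]; split; first exact: (subalgebraZ hZ).
  by move=> B g Gg; apply: (subalgebraZ (hfix B g)); apply: ff.
Qed.

Let A1 : set {mpoly K[N]} :=
  subalg (entries (W^T *m W) `|` entries U) `&` subalg (entries Z).
Let A2 : set {mpoly K[N]} :=
  subalg (entries (W^T *m W) `|` [set \det W] `|` entries U) `&` subalg (entries Z).

Lemma sub_Orth_invariants : A1 `<=` abs_invariants gamma K (Orth m).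
Proof.
move=> f [hf Zf]; split=> // B g [_ gg].
apply: (subalg_sub (fixed_is_subalgebra g)) hf => _ [[i [j ->]]|[i [j ->]]].
  exact: fixed_gram.
exact: fixed_U.
Qed.

Lemma sub_SOrth_invariants : A2 `<=` abs_invariants gamma K (SOrth m).
Proof.
move=> f [hf Zf]; split=> // B g [[_ gg] dg].
apply: (subalg_sub (fixed_is_subalgebra g)) hf => _ [[[i [j ->]]|->]|[i [j ->]]].
- exact: fixed_gram.
- exact: fixed_det.
- exact: fixed_U.
Qed.

(** This rests on [Z^T Z = U^T (W^T W) U]. *)
Lemma entry_gram_Zmx (T : set {mpoly K[N]}) i j : is_subalgebra T ->
  entries (W^T *m W) `<=` T -> entries U `<=` T -> T ((Z^T *m Z) i j).
Proof.
move=> hT hW hU.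
have -> : Z^T *m Z = U^T *m (W^T *m W) *m U by rewrite /Zmx trmx_mul !mulmxA.
apply: subalgebra_mulmx => // a b; last by apply: hU; exists a, b.
apply: subalgebra_mulmx => // {a b} a b; last by apply: hW; exists a, b.
by rewrite mxE; apply: hU; exists b, a.
Qed.

Lemma entry_gram_Zmx_sub i j : subalg (entries Z) ((Z^T *m Z) i j).
Proof.
have hZ := subalg_is_subalgebra (entries Z).
apply: subalgebra_mulmx => // a b; last by apply: subalg_gen; exists a, b.
by rewrite mxE; apply: subalg_gen; exists b, a.
Qed.

Lemma gram_subalgebra_sub : subalg (entries (Z^T *m Z)) `<=` A1.
Proof.
apply: subalg_sub.
  by apply: is_subalgebraI; apply: subalg_is_subalgebra.
move=> _ [i [j ->]]; split; last exact: entry_gram_Zmx_sub.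
apply: entry_gram_Zmx; first exact: subalg_is_subalgebra.
  by move=> f hf; apply: subalg_gen; left.
by move=> f hf; apply: subalg_gen; right.
Qed.

Lemma gram_maxminor_subalgebra_sub :
  subalg (entries (Z^T *m Z) `|` maxminors Z) `<=` A2.
Proof.
apply: subalg_sub.
  by apply: is_subalgebraI; apply: subalg_is_subalgebra.
move=> _ [[i [j ->]]|[d [_ ->]]]; split.
- apply: entry_gram_Zmx; first exact: subalg_is_subalgebra.
    by move=> f hf; apply: subalg_gen; left; left.
  by move=> f hf; apply: subalg_gen; right.
- exact: entry_gram_Zmx_sub.
- have hT := subalg_is_subalgebra (entries (W^T *m W) `|` [set \det W] `|` entries U).
  (* A maximal minor of [Z = W U] is [\det W] times the corresponding minor of [U]. *)
  rewrite /maxminor /minor mxsub_mul det_mulmx mxsub_eq_id //; last first.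
    by move=> i; rewrite tnth_ord_tuple.
  apply: (subalgebraM hT); first by apply: subalg_gen; left; right.
  apply: subalgebra_det => // i j; rewrite mxE; apply: subalg_gen; right.
  by eexists; eexists.
- apply: subalgebra_det => [|i j]; first exact: subalg_is_subalgebra.
  by rewrite mxE; apply: subalg_gen; eexists; eexists.
Qed.

Lemma gram_minors_sub : gram_minors gamma K `<=` subalg (entries (Z^T *m Z)).
Proof.
move=> _ [r [a [b [_ ->]]]].
apply: subalgebra_det => [|i j]; first exact: subalg_is_subalgebra.
by rewrite mxE; apply: subalg_gen; eexists; eexists.
Qed.

End InvariantSubalgebras.

Theorem theorem3p6 (K : fieldType) (m n : nat) (gamma : m.-tuple 'I_n)
  (le : rel 'X_{1..#|vars gamma|}) :
  (0 < m <= n)%N ->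
  Gamma gamma ->
  admissible_order gamma K le ->
  let W := Wmx gamma K in
  let U := Umx gamma K in
  let Z := Zmx gamma K in
  let A1 : set {mpoly K[#|vars gamma|]} := subalg (entries (W^T *m W) `|` entries U) `&` subalg (entries Z) in
  let A2 : set {mpoly K[#|vars gamma|]} := subalg (entries (W^T *m W) `|` [set \det W] `|` entries U)
            `&` subalg (entries Z) in
  [/\ sagbi_basis le (gram_minors gamma K) A1,
      abs_invariants gamma K (Orth m) = A1
    & A1 = subalg (entries (Z^T *m Z))]
  /\
  [/\ sagbi_basis le (gram_minors gamma K `|` maxminors_ge gamma K) A2,
      abs_invariants gamma K (SOrth m) = A2
    & A2 = subalg (entries (Z^T *m Z) `|` maxminors Z)].
Proof.
move=> mn gammaP leP W U Z A1 A2; have /andP[m0 mn'] := mn.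
have moP : monomial_order le by case: leP.
have sub1 : subalg (entries (Z^T *m Z)) `<=` A1 by apply: gram_subalgebra_sub.
have sub2 : subalg (entries (Z^T *m Z) `|` maxminors Z) `<=` A2.
  exact: gram_maxminor_subalgebra_sub.
have sup1 : A1 `<=` abs_invariants gamma K (Orth m) by apply: sub_Orth_invariants.
have sup2 : A2 `<=` abs_invariants gamma K (SOrth m) by apply: sub_SOrth_invariants.
have gen1 : subalg (gram_minors gamma K) `<=` subalg (entries (Z^T *m Z)).
  by apply: subalg_sub; [apply: subalg_is_subalgebra | apply: gram_minors_sub].
have gen2 : subalg (gram_minors gamma K `|` maxminors_ge gamma K) `<=`
    subalg (entries (Z^T *m Z) `|` maxminors Z).
  apply: subalg_sub; first exact: subalg_is_subalgebra.
  move=> f [/gram_minors_sub|[d [/andP[hd _] ->]]].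
    by apply: subalg_mono => x; left.
  by apply: subalg_gen; right; exists d.
split.
(* The criterion is applied to the ring of invariants itself, whose supports are under control; [A1]
   is identified afterwards through the inclusions. *)
- pose M : set 'X_{1..#|vars gamma|} := [set mu | exists a,
    [/\ semistandard a, fits gamma a, forall i, ~~ odd (rowsum a i)
      & mu = tableau_monomial gamma a]].
  have [||||sagbi eqA] := @sagbi_criterion _ le K moP (gram_minors gamma K)
      (abs_invariants gamma K (Orth m)) M.
  + exact: abs_invariants_is_subalgebra.
  + by move=> f hf; apply/sup1/sub1/gen1/subalg_gen.
  + move=> f hf f0.
    have [|a [ss fa af] row] := standard_monomial _ m0 gammaP hf f0.
      by move=> B g [].
    exists (tableau_monomial gamma a) => //; exists a; split=> // i.
    by rewrite -row; apply: Orth_parity hf _ af.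
  + by move=> _ [a [ss fa ev ->]]; apply: attained_even.
  have eq1 : abs_invariants gamma K (Orth m) = A1.
    by apply/seteqP; split=> //; rewrite eqA => f /gen1/sub1.
  rewrite -eq1; split=> //.
  by apply/seteqP; split; [rewrite eqA | rewrite eq1].
- pose M : set 'X_{1..#|vars gamma|} := [set mu | exists a,
    [/\ semistandard a, fits gamma a, forall i j, odd (rowsum a i) = odd (rowsum a j)
      & mu = tableau_monomial gamma a]].
  have [||||sagbi eqA] := @sagbi_criterion _ le K moP
      (gram_minors gamma K `|` maxminors_ge gamma K)
      (abs_invariants gamma K (SOrth m)) M.
  + exact: abs_invariants_is_subalgebra.
  + by move=> f hf; apply/sup2/sub2/gen2/subalg_gen.
  + move=> f hf f0.
    have [//|a [ss fa af] row] := standard_monomial _ m0 gammaP hf f0.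
    exists (tableau_monomial gamma a) => //; exists a; split=> // i j.
    by rewrite -!row; apply: SOrth_parity hf _ af.
  + by move=> _ [a [ss fa par ->]]; apply: attained_parity.
  have eq2 : abs_invariants gamma K (SOrth m) = A2.
    by apply/seteqP; split=> //; rewrite eqA => f /gen2/sub2.
  rewrite -eq2; split=> //.
  by apply/seteqP; split; [rewrite eqA | rewrite eq2].
Qed.
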